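(* Let $f\in L_p(\mathbb{T}^d)$, $0<p<1$, $(1/p,\delta)\in\Sigma(d)$, and $(1/p,\beta)\in\mathrm{B}(d)$. Then $$\|f-\mathcal{S}_{n;\lambda}^{\beta,\delta}(f)\|_{\overline{p}}\asymp\widetilde{K}_\beta(f,1/n)_p,\qquad n\in\mathbb{N}.$$
   Context: Let $d\in\mathbb{N}$ and $\mathbb{T}^d=[0,2\pi)^d$. For $0<p<\infty$, $L_p(\mathbb{T}^d)$ is the space of real-valued measurable functions on $\mathbb{R}^d$, $2\pi$-periodic in each variable, with $\|f\|_p=(\int_{\mathbb{T}^d}|f(x)|^p dx)^{1/p}<\infty$. Write $(k,x)=k_1x_1+\dots+k_dx_d$, $|x|=(x,x)^{1/2}$, $x_+=\max\{x,0\}$. The notation $A(f,n)\asymp B(f,n)$ means a two-sided inequality $C_1A(f,n)\le B(f,n)\le C_2A(f,n)$ with positive constants independent of $f$ and $n$. Generalized Bochner-Riesz kernel: $\mathcal{R}_n^{\beta,\delta}(x)=\sum_{k\in\mathbb{Z}^d}\big(1-\frac{|k|^\beta}{n^\beta}\big)_+^\delta e^{i(k,x)}$. Family of polynomial operators, $\lambda\in\mathbb{T}^d$: $\mathcal{S}_{n;\lambda}^{\beta,\delta}(f;x)=(2n+1)^{-d}\sum_{k\in\{0,\dots,2n\}^d}f(t_n^k+\lambda)\,\mathcal{R}_n^{\beta,\delta}(x-t_n^k-\lambda)$, where $t_n^k=\frac{2\pi k}{2n+1}$. For functions of $x\in\mathbb{T}^d$ and $\lambda\in\mathbb{T}^d$,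 $\|\cdot\|_{\overline{p}}=\big\|\,\|\cdot\|_{p;x}\big\|_{p;\lambda}$ (the $p$-quasi-norm in $x$, then the $p$-quasi-norm in $\lambda$). Realization of the $K$-functional: $\widetilde K_\beta(f,t)_p=\inf_{T\in\mathcal{T}_{1/t}}\{\|f-T\|_p+t^\beta\|\Delta^{\beta/2}T\|_p\}$, where $\mathcal{T}_n=\{T(x)=\sum_{k\in\mathbb{Z}^d,|k|\le n}c_ke^{i(k,x)}:\ c_{-k}=\overline{c_k}\}$ and, for $T(x)=\sum_kc_ke^{i(k,x)}$, $\Delta^{\beta/2}T(x)=\sum_k|k|^\beta c_ke^{i(k,x)}$. With $\mathbb{R}_+=[0,\infty)$: $\Sigma(d)=\{(\frac1p,\delta)\in\mathbb{R}_+^2:\ \delta>\max\{\frac{d-1}{2},\,d(\frac1p-\frac12)-\frac12\}\}$, $\mathrm{B}(d)=\{(\frac1p,\beta)\in\mathbb{R}_+^2:\ \beta\in2\mathbb{N}\ \text{ or }\ \beta>d(\frac1p-1)_+\}$. *)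

(* Defs.v *)
From HB Require Import structures.
From mathcomp Require Import all_boot all_order all_algebra.
From mathcomp Require Import all_classical all_reals all_analysis.
From mathcomp.real_closed Require Import complex.

Set Implicit Arguments.
Unset Strict Implicit.
Unset Printing Implicit Defensive.
Import Order.TTheory GRing.Theory Num.Theory.
Import numFieldNormedType.Exports.

Local Open Scope classical_set_scope.
Local Open Scope ring_scope.

(** Borel-Lebesgue measure on [R^d], by recursion on [d]: the image of
    [lebesgue_measure \x (measure on R^n)] under [(t, s) |-> t :: s]. *)

Definition tcons (R : realType) (n : nat)
    (q : measurableTypeR R * n.-tuple (measurableTypeR R)) :
  n.+1.-tuple (measurableTypeR R) := [the n.+1.-tuple _ of q.1 :: q.2].

Lemma measurable_tcons (R : realType) (n : nat) :
  measurable_fun [set: measurableTypeR R * n.-tuple (measurableTypeR R)]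
    (@tcons R n).
Proof. exact: (measurable_cons measurable_fst measurable_snd). Qed.

Section pushforward_tcons.
Context (R : realType) (n : nat).
Variable mu : {measure set (n.-tuple (measurableTypeR R)) -> \bar R}.
Local Open Scope ereal_scope.

Definition pushforward_tcons : set (n.+1.-tuple (measurableTypeR R)) -> \bar R :=
  pushforward (@lebesgue_measure R \x^ mu) (@tcons R n).

Let m0 : pushforward_tcons set0 = 0.
Proof. by rewrite /pushforward_tcons /pushforward preimage_set0 measure0. Qed.

Let m_ge0 A : 0 <= pushforward_tcons A.
Proof. by rewrite /pushforward_tcons /pushforward measure_ge0. Qed.

Let m_sigma : semi_sigma_additive pushforward_tcons.
Proof.
move=> F mF tF mUF; rewrite /pushforward_tcons /pushforward preimage_bigcup.
have mpre A : measurable A -> measurable (@tcons R n @^-1` A).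
  by move=> mA; rewrite -[X in measurable X]setTI; exact: measurable_tcons.
apply: measure_semi_sigma_additive.
- by move=> k; exact: mpre.
- apply/trivIsetP => /= i j _ _ ij; rewrite -preimage_setI.
  by move/trivIsetP : tF => /(_ _ _ _ _ ij) ->//; rewrite preimage_set0.
- by rewrite -preimage_bigcup; exact: mpre.
Qed.

HB.instance Definition _ :=
  isMeasure.Build _ _ _ pushforward_tcons m0 m_ge0 m_sigma.

End pushforward_tcons.

Fixpoint borel_lebesgue (R : realType) (d : nat) :
    {measure set (d.-tuple (measurableTypeR R)) -> \bar R} :=
  match d with
  | 0 => \d_ [tuple]
  | n.+1 => pushforward_tcons (borel_lebesgue R n)
  end.

(** Lebesgue measure on [R^d], on the Lebesgue sigma-algebra (the completion
    of the Borel one), obtained as the Caratheodory extension. *)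

Definition lebesgue_space (R : realType) (d : nat) :=
  caratheodory_type ((borel_lebesgue R d)^*)%mu.

Definition lebesgue (R : realType) (d : nat) :
    {measure set (lebesgue_space R d) -> \bar R} :=
  @completed_measure_extension _ _ _ (borel_lebesgue R d).

Definition torus (R : realType) (d : nat) : set (d.-tuple R) :=
  [set x | forall j : 'I_d, 0 <= tnth x j < 2 * pi].
Arguments torus : clear implicits.

Definition eLp_norm (R : realType) (d : nat) (p : R)
    (F : d.-tuple R -> \bar R) : \bar R :=
  ((\int[lebesgue R d]_(x in torus R d) (`|F x| `^ p)) `^ p^-1)%E.

Definition Lp_norm (R : realType) (d : nat) (p : R)
    (g : d.-tuple R -> R[i]) : \bar R :=
  eLp_norm p (fun x => (ComplexField.Normc.normc (g x))%:E).

Definition vadd (R : realType) (d : nat) (x y : d.-tuple R) : d.-tuple R :=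
  [tuple tnth x j + tnth y j | j < d].

Definition vsub (R : realType) (d : nat) (x y : d.-tuple R) : d.-tuple R :=
  [tuple tnth x j - tnth y j | j < d].

Definition periodic2pi (R : realType) (d : nat) (f : d.-tuple R -> R) : Prop :=
  forall (x : d.-tuple R) (j : 'I_d),
    f [tuple tnth x i + (if i == j then 2 * pi else 0) | i < d] = f x.

Definition inLp (R : realType) (d : nat) (p : R) (f : d.-tuple R -> R) : Prop :=
  [/\ measurable_fun [set: lebesgue_space R d] (f : lebesgue_space R d -> R),
      periodic2pi f &
      (Lp_norm p (fun x => (f x)%:C%C) < +oo)%E].

Definition freq_norm (R : realType) (d : nat) (k : 'rV[int]_d) : R :=
  Num.sqrt (\sum_(j < d) (k 0 j)%:~R ^+ 2).

Definition freq_dot (R : realType) (d : nat) (k : 'rV[int]_d)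
    (x : d.-tuple R) : R :=
  \sum_(j < d) (k 0 j)%:~R * tnth x j.

Definition expi (R : realType) (t : R) : R[i] := (cos t +i* sin t)%C.

(** The sum over all of [Z^d] is a finitely supported [\sum_(k \in _)]: the
    terms with [|k| >= n] vanish since [0 `^ delta = 0] for [delta != 0]. *)
Definition bochner_riesz (R : realType) (d : nat) (beta delta : R) (n : nat)
    (x : d.-tuple R) : R[i] :=
  \sum_(k \in [set: 'rV[int]_d])
    ((Num.max (1 - freq_norm R k `^ beta / n%:R `^ beta) 0 `^ delta)%:C)%C
    * expi (freq_dot k x).

Definition grid (R : realType) (d n : nat) (k : {ffun 'I_d -> 'I_(2 * n).+1}) :
    d.-tuple R :=
  [tuple 2 * pi * (k j)%:R / (2 * n + 1)%:R | j < d].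

Definition sampling_op (R : realType) (d : nat) (beta delta : R) (n : nat)
    (lambda : d.-tuple R) (f : d.-tuple R -> R) (x : d.-tuple R) : R[i] :=
  ((2 * n + 1)%:R ^- d) *
  \sum_(k : {ffun 'I_d -> 'I_(2 * n).+1})
    (f (vadd (grid R k) lambda))%:C%C
    * bochner_riesz beta delta n (vsub (vsub x (grid R k)) lambda).

(** [||.||_{p-bar}] of a function of [lambda] and [x]: the [p]-quasi-norm in
    [x], then the [p]-quasi-norm in [lambda]. *)
Definition mixed_norm (R : realType) (d : nat) (p : R)
    (G : d.-tuple R -> d.-tuple R -> R[i]) : \bar R :=
  eLp_norm p (fun lambda => Lp_norm p (G lambda)).

Definition sampling_error (R : realType) (d : nat) (p beta delta : R)
    (n : nat) (f : d.-tuple R -> R) : \bar R :=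
  mixed_norm p (fun lambda x : d.-tuple R =>
    (f x)%:C%C - sampling_op beta delta n lambda f x).

Definition hermitian_coef (R : realType) (d : nat) (c : 'rV[int]_d -> R[i]) : Prop :=
  forall k, c (- k) = ((c k)^*)%C.

Definition trig_poly (R : realType) (d : nat) (r : R) (c : 'rV[int]_d -> R[i])
    (x : d.-tuple R) : R[i] :=
  \sum_(k \in [set k : 'rV[int]_d | freq_norm R k <= r])
    c k * expi (freq_dot k x).

Definition laplace_pow (R : realType) (d : nat) (beta : R)
    (c : 'rV[int]_d -> R[i]) (k : 'rV[int]_d) : R[i] :=
  ((freq_norm R k `^ beta)%:C)%C * c k.

(** The infimum over [T] in [T_{1/t}] runs over the coefficient families [c]
    of [T], since [Delta^{beta/2} T] is defined through them. *)
Definition K_realization (R : realType) (d : nat) (p beta : R)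
    (f : d.-tuple R -> R) (t : R) : \bar R :=
  ereal_inf
    [set (Lp_norm p (fun x => (f x)%:C%C - trig_poly t^-1 c x)%R
          + (t `^ beta)%:E
            * Lp_norm p (trig_poly t^-1 (laplace_pow beta c)))%E
    | c in @hermitian_coef R d].

Definition Sigma_set (R : realType) (d : nat) : set (R * R) :=
  [set q | [/\ 0 <= q.1, 0 <= q.2 &
    Num.max ((d%:R - 1) / 2) (d%:R * (q.1 - 1 / 2) - 1 / 2) < q.2]].

(** [2N] is the set of positive even integers. *)
Definition B_set (R : realType) (d : nat) : set (R * R) :=
  [set q | [/\ 0 <= q.1, 0 <= q.2 &
    (exists m : nat, (0 < m)%N /\ q.2 = (2 * m)%:R)
    \/ d%:R * Num.max (q.1 - 1) 0 < q.2]].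

(* Main.v *)
Require Import Defs.
From mathcomp Require Import all_boot all_order all_algebra.
From mathcomp Require Import all_classical all_reals all_analysis.
From mathcomp Require Import measurable_realfun.
From mathcomp.real_closed Require Import complex.
From mathcomp Require Import zify ring lra.
Set Implicit Arguments.
Unset Strict Implicit.
Unset Printing Implicit Defensive.
Import Order.TTheory GRing.Theory Num.Theory.
Import numFieldNormedType.Exports.
Local Open Scope classical_set_scope.
Local Open Scope ring_scope.

(** Put r = |k| / n and let S_lam be the sampling operator with shift lam.  The
    quadrature on 2n + 1 points per axis is exact in the degrees that occur, so
    that S_lam acts on polynomials T of degree at most n as the Fourier
    multiplier Phi1 (r^2) = (1 - r^beta)_+^delta, whatever lam is.  Let Phi2 and
    Phi3 satisfy, for r <= 1,
      Phi2 (r^2) r^beta = 1 - Phi1 (r^2),  Phi3 (r^2) (1 - Phi1 (r^2)) = r^beta,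
    and write T' = n^(-beta) Delta^(beta/2) T.

    Upper bound ([upper_bound]): for every T of degree at most n,
      f - S_lam f = (f - T) - S_lam (f - T) + Phi2 T'.
    Lower bound ([lower_bound]): for some lam the error f - S_lam f exceeds
    the average error by as little as desired.  Take T = S_lam f; then T' = Phi3 (T - S_mu T) for every
    mu, and T - S_mu T = (T - f) + (f - S_mu f) + S_mu (f - T) is averaged over
    mu.  It remains to bound the average over lam of S_lam (f - T), and the
    multipliers Phi2 and Phi3 on polynomials of degree at most n.

    Since p < 1, the p-th power of a sum is at most the sum of the p-th powers.
    A multiplier applied to T is, by exactness, a sum of translates of its
    kernel weighted by values of T on a grid of about n^d points, and averaging
    over the shift of the grid turns the sum of |T|^p over it into n^d times an
    integral.  Both bounds therefore follow ([gridop_majorant],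
    [multiplier_bound]) from the estimate, called [good] below,
      int |K|^p <= C n^(d (p - 1))
    for the kernels K = sum_k Phi (|k|^2 / n^2) e^(i (k, x)).

    [kernel_estimate] derives this estimate from bounds on the m-th differences
    with step h of the coefficients, squared and summed over k, by
    n^d (h / n)^(2 s) with s > d (1/p - 1/2).  At points where
    |e^(i h x_j) - 1| >= 1 for some j, differencing the coefficients does not
    decrease |K|, and Parseval applies; the points where this fails for all
    h = 2^l, l < L, form a set of measure at most 2^(-L d) times that of the
    torus.

    Each Phi is a sum of pieces, smooth except at the origin, where they behave
    like r^beta, or except at the sphere r = 1, where they behave like
    (1 - r)^delta.  The k-th derivative of a piece, minus its value on the
    singular set, is bounded by rho^(a - k), rho being the distance to that set
    and a = beta or a = delta; this is stable under sums, products and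
    compositions, and [singular_diff] turns it into e^s max (rho, e)^(a - s) for differences with step e.  Squaring and
    summing over the lattice asks for s < beta + d/2 at the origin and for
    s < delta + 1/2 at the sphere ([lattice_bound_org], [lattice_bound_sph]).
    An s with these properties and s > d (1/p - 1/2) exists by the conditions
    on beta and delta ([good_multipliers]); for an even integer beta the
    function r^beta is a polynomial in the coordinates and the origin imposes
    no condition. *)

(** * Translation invariance and averages over the torus *)

Section translation.
Context (R : realType).

Lemma lebesgue_measure_shift (a : R) (A : set (measurableTypeR R)) :
  measurable A ->
  lebesgue_measure ((fun t : measurableTypeR R => t + a) @^-1` A) =
  lebesgue_measure A.
Proof.
move=> mA.
have mphi : measurable_fun [set: measurableTypeR R]
    (fun t : measurableTypeR R => (t + a : measurableTypeR R)).
  by apply: (@measurable_realfun.measurable_funD _ _ _ setT id (cst a)) => //; exact: measurable_id.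
apply/esym.
rewrite -[RHS]/(pushforward (@lebesgue_measure R)
   (fun t : measurableTypeR R => (t + a : measurableTypeR R)) A).
apply/lebesgue_measure_unique => //= _ [[x y]] _ <-.
rewrite /pushforward.
rewrite (_ : _ @^-1` _ = [set` `]x - a, y - a]]); last first.
  by apply/seteqP; split=> t /=; rewrite !in_itv/= ltrBlDr lerBrDr.
by rewrite !lebesgue_measure_itv/= !lte_fin ltrD2r -!EFinB opprB addrA subrK.
Qed.

Local Notation tup d := (d.-tuple (measurableTypeR R)).

Lemma measurable_vadd d (a : d.-tuple R) :
  measurable_fun [set: tup d] (fun x : tup d => vadd x a : tup d).
Proof.
apply/measurable_fun_tnthP => i.
rewrite (_ : _ \o _ = (fun x : tup d => tnth x i + tnth a i)); last first.
  by apply/funext => x /=; rewrite tnth_mktuple.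
apply: (@measurable_realfun.measurable_funD _ _ _ setT (fun x : tup d => tnth x i) (cst (tnth a i))) => //.
exact: measurable_tnth.
Qed.

Lemma vadd_cons d (t a : R) (s b : d.-tuple R) :
  vadd [tuple of t :: s] [tuple of a :: b] = [tuple of t + a :: vadd s b].
Proof.
apply: eq_from_tnth => i; rewrite tnth_mktuple.
case: (unliftP ord0 i) => [j ->|->]; last by rewrite !tnth0.
by rewrite !tnthS tnth_mktuple.
Qed.

(** By induction on the dimension: a slice of the translate is a translate of a
    slice, and the remaining integral over the slices is invariant by
    induction. *)
Lemma borel_lebesgue_vadd d (a : d.-tuple R) (A : set (tup d)) :
  measurable A ->
  borel_lebesgue R d ((fun x : tup d => vadd x a) @^-1` A) =
  borel_lebesgue R d A.
Proof.
elim: d a A => [|d IH] a A mA /=.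
  rewrite /dirac; congr (_%:E); rewrite !indicE; congr (_%:R); congr nat_of_bool.
  by apply/idP/idP; rewrite !inE/= (tuple0 (vadd _ _)).
rewrite /pushforward_tcons /pushforward /=.
have [b [c ->]] : exists (b : R) (c : d.-tuple R), a = [tuple of b :: c].
  by exists (thead a), [tuple of behead a]; rewrite -tuple_eta.
set B := @tcons R d @^-1` A.
have mB : measurable B by rewrite -[B]setTI; exact: measurable_tcons.
rewrite /product_measure2.
pose G s := lebesgue_measure (ysection B s).
have mG := measurable_fun_ysection (@lebesgue_measure R) mB.
have mc := measurable_vadd c.
transitivity (\int[borel_lebesgue R d]_(s in (fun s : tup d => vadd s c : tup d) @^-1` setT)
    (G \o (fun s : tup d => vadd s c : tup d)) s)%E.
  rewrite preimage_setT; apply: eq_integral => s _; rewrite /= /G.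
  rewrite -(lebesgue_measure_shift b (measurable_ysection (vadd s c) mB)).
  congr (lebesgue_measure _); apply/seteqP; split => t /=.
    rewrite /ysection /= !inE /= /B /= /tcons /=.
    by rewrite vadd_cons.
  by rewrite /ysection /= !inE /= /B /= /tcons /= vadd_cons.
rewrite -(@ge0_integral_pushforward _ _ _ _ _ _ mc (borel_lebesgue R d) setT G)//=.
apply: eq_measure_integral => C mC _ /=.
by rewrite /pushforward/= IH.
Qed.

Local Notation leb d := (lebesgue_space R d).

(** A countable measurable cover translates to one of the same total measure.
    This is what carries the invariance from the Borel to the Lebesgue
    sigma-algebra. *)
Lemma outer_vadd d (a : d.-tuple R) (A : set (tup d)) :
  ((borel_lebesgue R d)^* ((fun x : tup d => vadd x a) @^-1` A) <=
  (borel_lebesgue R d)^* A)%mu%E.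
Proof.
rewrite /mu_ext; apply/ereal_inf_le_tmp => x [B [mB BB'] <-].
have mt (C : set (tup d)) : measurable C ->
    measurable ((fun x : tup d => vadd x a) @^-1` C).
  by move=> mC; rewrite -[X in measurable X]setTI; exact: measurable_vadd.
exists (fun k => (fun x : tup d => vadd x a) @^-1` (B k)).
  split; first by move=> k; exact: (mt _ (mB k)).
  by move=> t /= /BB' [k _ Bk]; exists k.
by apply: eq_eseriesr => k _; rewrite borel_lebesgue_vadd.
Qed.

Lemma vaddN d (a : d.-tuple R) (x : d.-tuple R) :
  vadd (vadd x a) [tuple - tnth a i | i < d] = x.
Proof. by apply: eq_from_tnth => i; rewrite !tnth_mktuple addrK. Qed.

Lemma vaddNK d (a : d.-tuple R) (x : d.-tuple R) :
  vadd (vadd x [tuple - tnth a i | i < d]) a = x.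
Proof. by apply: eq_from_tnth => i; rewrite !tnth_mktuple subrK. Qed.

Lemma outer_vaddE d (a : d.-tuple R) (A : set (tup d)) :
  ((borel_lebesgue R d)^* ((fun x : tup d => vadd x a) @^-1` A) =
  (borel_lebesgue R d)^* A)%mu%E.
Proof.
apply/eqP; rewrite eq_le outer_vadd /=.
rewrite -[X in (mu_ext _ X <= _)%E](_ :
  (fun x : tup d => vadd x [tuple - tnth a i | i < d]) @^-1`
  ((fun x : tup d => vadd x a) @^-1` A) = A); first exact: outer_vadd.
by apply/seteqP; split => x /=; rewrite vaddNK.
Qed.

Lemma measurable_vadd_lebesgue d (a : d.-tuple R) :
  measurable_fun [set: leb d] (fun x : leb d => vadd x a : leb d).
Proof.
move=> _ A mA; rewrite setTI.
have cA : caratheodory_measurable ((borel_lebesgue R d)^*)%mu A := mA.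
suff : caratheodory_measurable ((borel_lebesgue R d)^*)%mu
  ((fun x : tup d => vadd x a) @^-1` A) by [].
move=> X; have := cA ((fun x : tup d => vadd x [tuple - tnth a i | i < d]) @^-1` X).
rewrite outer_vaddE => ->; congr (_ + _)%E.
  rewrite -(outer_vaddE a); congr mu_ext.
  by apply/seteqP; split => x /=; rewrite vaddN.
rewrite -(outer_vaddE a); congr mu_ext.
by apply/seteqP; split => x /=; rewrite vaddN.
Qed.

Lemma measurable_comp_vadd d d' (T : measurableType d') (f : leb d -> T) (a : d.-tuple R) :
  measurable_fun [set: leb d] f -> measurable_fun [set: leb d] (fun x : leb d => f (vadd x a)).
Proof. move=> mf; exact: (measurableT_comp mf (measurable_vadd_lebesgue a)). Qed.

Lemma measurable_borel d (A : set (tup d)) :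
  measurable A -> measurable (A : set (leb d)).
Proof. exact: caratheodory_measurable_mu_ext. Qed.

Lemma measurable_fun_borel d d' (T : measurableType d') (f : tup d -> T) :
  measurable_fun [set: tup d] f -> measurable_fun [set: leb d] (f : leb d -> T).
Proof. by move=> mf _ B mB; apply: measurable_borel; exact: mf. Qed.

(** Change of variables along a map whose image measure is mu itself. *)
Lemma ge0_integral_invariant d (T : measurableType d) (mu : {measure set T -> \bar R})
    (phi : T -> T) (D : set T) (F : T -> \bar R) :
  measurable_fun [set: T] phi -> (forall A, mu (phi @^-1` A) = mu A) ->
  measurable D -> measurable_fun [set: T] F -> (forall x, 0 <= F x)%E ->
  (\int[mu]_(x in phi @^-1` D) F (phi x) = \int[mu]_(x in D) F x)%E.
Proof.
move=> mphi inv mD mF F0.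
rewrite -(@ge0_integral_pushforward _ _ _ _ _ _ mphi mu D F mD (measurable_funTS mF)
  (fun x _ => F0 x)).
by apply: eq_measure_integral => A _ _; exact: inv.
Qed.

Lemma ge0_integral_vadd d (a : d.-tuple R) (D : set (leb d)) (F : leb d -> \bar R) :
  measurable D -> measurable_fun [set: leb d] F -> (forall x, 0 <= F x)%E ->
  (\int[lebesgue R d]_(x in (fun x : leb d => vadd x a) @^-1` D) F (vadd x a) =
   \int[lebesgue R d]_(x in D) F x)%E.
Proof.
apply: (@ge0_integral_invariant _ _ (lebesgue R d)); first exact: measurable_vadd_lebesgue.
by move=> A; exact: (outer_vaddE a A).
Qed.

(** The integral of a nonnegative function is a supremum over the simple
    functions below it, so that monotonicity needs no measurability.  Functions
    of lam such as the p-quasi-norm of f - S_lam f are thereby compared without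
    any theorem on their measurability. *)
Lemma le_integral_ge0 d (T : measurableType d) (mu : {measure set T -> \bar R})
    (D : set T) (f g : T -> \bar R) :
  (forall x, D x -> 0 <= f x)%E -> (forall x, D x -> f x <= g x)%E ->
  (\int[mu]_(x in D) f x <= \int[mu]_(x in D) g x)%E.
Proof.
move=> f0 fg.
have g0 x : D x -> (0 <= g x)%E by move=> Dx; exact: le_trans (f0 _ Dx) (fg _ Dx).
rewrite !ge0_integralE//.
apply/ereal_sup_le => _ [h hf <-]; exists h => // x.
apply: (le_trans (hf x)); rewrite /patch; case: ifPn => // xD.
by apply: fg; rewrite inE in xD.
Qed.

End translation.

Section torus_integral.
Context (R : realType).
Local Notation tup d := (d.-tuple (measurableTypeR R)).
Local Notation leb d := (lebesgue_space R d).

Definition cunit d (j : 'I_d) (s : R) : d.-tuple R :=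
  [tuple if i == j then s else 0 | i < d].

Definition tperiodic d (T : Type) (F : d.-tuple R -> T) :=
  forall x j, F (vadd x (cunit j (2 * pi))) = F x.

Lemma vaddA d (x y z : d.-tuple R) : vadd (vadd x y) z = vadd x (vadd y z).
Proof. by apply: eq_from_tnth => i; rewrite !tnth_mktuple addrA. Qed.

Lemma vaddC d (x y : d.-tuple R) : vadd x y = vadd y x.
Proof. by apply: eq_from_tnth => i; rewrite !tnth_mktuple addrC. Qed.

Lemma periodic_vadd d T (F : d.-tuple R -> T) a :
  tperiodic F -> tperiodic (fun x => F (vadd x a)).
Proof.
by move=> pF x j; rewrite vaddA (vaddC _ a) -vaddA pF.
Qed.

Lemma measurable_tnth_itv d (j : 'I_d) (i : interval R) :
  measurable ([set x | tnth x j \in i] : set (leb d)).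
Proof.
apply: measurable_borel; rewrite -[X in measurable X]setTI.
have := @measurable_tnth _ (measurableTypeR R) d j measurableT [set` i].
by apply; exact: measurable_itv.
Qed.

Lemma torusE d : torus R d =
  \bigcap_(j in [set: 'I_d]) [set x | tnth x j \in `[0, 2 * pi[].
Proof.
apply/seteqP; split => x /= xt.
  by move=> j _ /=; rewrite in_itv/= xt.
by move=> j; have := xt j Logic.I; rewrite /= in_itv.
Qed.

Lemma measurable_torus d : measurable (torus R d : set (leb d)).
Proof.
rewrite torusE; apply: fin_bigcap_measurable; first exact: finite_finset.
by move=> j _; exact: measurable_tnth_itv.
Qed.

Lemma measurable_torus_borel d : measurable (torus R d : set (tup d)).
Proof.
rewrite torusE; apply: fin_bigcap_measurable; first exact: finite_finset.
move=> j _; rewrite -[X in measurable X]setTI.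
have := @measurable_tnth _ (measurableTypeR R) d j measurableT [set` `[0, 2 * pi[].
by apply; exact: measurable_itv.
Qed.

Lemma two_pi_gt0 : 0 < 2 * pi :> R.
Proof. by rewrite mulr_gt0 ?pi_gt0. Qed.

Lemma lebesgue_torus d : lebesgue R d (torus R d) = ((2 * pi) ^+ d)%:E.
Proof.
transitivity (borel_lebesgue R d (torus R d)).
  exact: (measurable_mu_extE _ (@measurable_torus_borel d)).
elim: d => [|d IH] /=.
  rewrite /dirac indicE expr0 mem_set//.
  by case.
rewrite /pushforward_tcons /pushforward.
rewrite (_ : _ @^-1` _ = [set` `[0, 2 * pi[] `*` torus R d); last first.
  apply/seteqP; split => -[t s] /=.
    move=> ts; split; first by have := ts ord0; rewrite in_itv.
    by move=> j; have := ts (lift ord0 j); rewrite tnthS.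
  rewrite in_itv/= => -[tt ss] j; case: (unliftP ord0 j) => [i ->|->//].
  by rewrite tnthS; exact: ss.
rewrite product_measure2E; last 2 first.
- exact: measurable_itv.
- exact: measurable_torus_borel.
rewrite IH exprS EFinM; congr (_ * _)%E.
by have := lebesgue_measure_itv `[0, (2 * pi : R)[; rewrite /= lte_fin two_pi_gt0 oppr0 adde0.
Qed.

Definition tint d (F : d.-tuple R -> \bar R) : \bar R :=
  (\int[lebesgue R d]_(x in torus R d) F x)%E.

(** Cut the torus at 2 pi - s in the j-th coordinate.  The translation maps one
    part into the torus, the other into the torus after subtraction of a
    period. *)
Lemma tint_cunit d (j : 'I_d) (s : R) (F : leb d -> \bar R) :
  0 <= s < 2 * pi -> measurable_fun [set: leb d] F -> (forall x, 0 <= F x)%E ->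
  tperiodic F -> tint (fun x => F (vadd x (cunit j s))) = tint F.
Proof.
move=> /andP[s0 s2] mF F0 pF.
have mt := @measurable_torus d.
have mI (i : interval R) : measurable ([set x | tnth x j \in i] : set (leb d)).
  exact: measurable_tnth_itv.
pose A' : set (leb d) := torus R d `&` [set x | tnth x j \in `[s, +oo[].
pose B' : set (leb d) := torus R d `&` [set x | tnth x j \in `]-oo, s[].
pose A : set (leb d) := torus R d `&` [set x | tnth x j \in `]-oo, 2 * pi - s[].
pose B : set (leb d) := torus R d `&` [set x | tnth x j \in `[2 * pi - s, +oo[].
have mA' : measurable A' by apply: measurableI.
have mB' : measurable B' by apply: measurableI.
have mA : measurable A by apply: measurableI.
have mB : measurable B by apply: measurableI.
have tAB' : torus R d = A' `|` B'.
  rewrite -setIUr; apply/esym/setIidl => x _ /=; rewrite !in_itv/= andbT.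
  by case: (leP s (tnth x j)) => ?; [left|right].
have tAB : torus R d = A `|` B.
  rewrite -setIUr; apply/esym/setIidl => x _ /=; rewrite !in_itv/= andbT.
  by case: (leP (2 * pi - s) (tnth x j)) => ?; [right|left].
have dAB : [disjoint A & B].
  rewrite disj_set2E; apply/eqP/seteqP; split => // x [[_ /=] + [_ /=]].
  by rewrite !in_itv/= andbT ltNge => /negP.
have dAB' : [disjoint A' & B'].
  rewrite disj_set2E; apply/eqP/seteqP; split => // x [[_ /=] + [_ /=]].
  by rewrite !in_itv/= andbT ltNge => ? /negP.
have mFs a : measurable_fun [set: leb d] (fun x : leb d => F (vadd x a)).
  exact: measurable_comp_vadd.
rewrite /tint tAB (@ge0_integral_setU _ _ _ (lebesgue R d) A B mA mB _
  (measurable_funTS (mFs _)) (fun x _ => F0 _) dAB).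
rewrite -tAB tAB' (@ge0_integral_setU _ _ _ (lebesgue R d) A' B' mA' mB' _
  (measurable_funTS mF) (fun x _ => F0 _) dAB').
rewrite -(ge0_integral_vadd (cunit j s) mA' mF F0).
rewrite -(ge0_integral_vadd (cunit j (s - 2 * pi)) mB' mF F0).
congr (_ + _)%E.
  congr (integral _ _ _); apply/seteqP; split => x /=; rewrite /A /A' /torus/= => -[xt].
    rewrite !in_itv/= andbT tnth_mktuple tnth_mktuple eqxx => xs; split; last first.
      by have := xt j; lra.
    move=> i; rewrite !tnth_mktuple; have := xt i; case: eqP => [->|_]; lra.
  rewrite !in_itv/= andbT tnth_mktuple tnth_mktuple eqxx => xs; split.
    move=> i; have := xt i; rewrite !tnth_mktuple; case: eqP => [->|_]; lra.
  have := xt j; rewrite !tnth_mktuple eqxx; lra.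
rewrite [RHS](_ : _ = \int[lebesgue R d]_(x in B) F (vadd x (cunit j (s - 2 * pi))))%E.
  apply: eq_integral => x _; rewrite -[RHS](pF _ j); congr F.
  apply: eq_from_tnth => i; rewrite !tnth_mktuple; case: eqP => _; lra.
congr (integral _ _ _); apply/seteqP; split => x /=; rewrite /B /B' /torus/= => -[xt].
  rewrite !in_itv/= andbT tnth_mktuple tnth_mktuple eqxx => xs; split.
    move=> i; have := xt i; rewrite !tnth_mktuple; case: eqP => [->|_]; lra.
  have := xt j; rewrite !tnth_mktuple eqxx; lra.
rewrite !in_itv/= andbT tnth_mktuple tnth_mktuple eqxx => xs; split; last first.
  by have := xt j; lra.
move=> i; rewrite !tnth_mktuple; have := xt i; case: eqP => [->|_]; lra.
Qed.

(** The coordinates are translated one after the other. *)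
Lemma tint_vadd d (a : d.-tuple R) (F : leb d -> \bar R) :
  torus R d a -> measurable_fun [set: leb d] F -> (forall x, 0 <= F x)%E ->
  tperiodic F -> tint (fun x => F (vadd x a)) = tint F.
Proof.
move=> ta mF F0 pF.
pose b (k : nat) : d.-tuple R := [tuple if (i < k)%N then tnth a i else 0 | i < d].
(* b k carries the first k coordinates of a; [tint_cunit] leads from b k to b k.+1 *)
have -> : a = b d.
  by apply: eq_from_tnth => i; rewrite tnth_mktuple ltn_ord.
have mFs c : measurable_fun [set: leb d] (fun x : leb d => F (vadd x c)).
  exact: measurable_comp_vadd.
suff H k : (k <= d)%N -> tint (fun x => F (vadd x (b k))) = tint F by exact: H.
elim: k => [_|k IH kd].
  congr tint; apply/funext => x; congr F.
  by apply: eq_from_tnth => i; rewrite !tnth_mktuple addr0.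
rewrite -IH; last exact: ltnW.
rewrite -(@tint_cunit d (Ordinal kd) (tnth a (Ordinal kd)) (fun x => F (vadd x (b k)))) //.
  congr tint; apply/funext => x; congr F.
  apply: eq_from_tnth => i; rewrite !tnth_mktuple ltnS leq_eqVlt -val_eqE/=.
  by case: eqP => [ik|_]/=; [rewrite ik ltnn addr0; congr (_ + tnth a _); exact: val_inj
    |rewrite addr0].
exact: periodic_vadd.
Qed.

Lemma tint_sum d (I : Type) (s : seq I) (F : I -> leb d -> \bar R) :
  (forall i, measurable_fun [set: leb d] (F i)) -> (forall i x, 0 <= F i x)%E ->
  tint (fun x => \sum_(i <- s) F i x)%E = (\sum_(i <- s) tint (F i))%E.
Proof.
move=> mF F0; rewrite /tint ge0_integral_sum//; first exact: measurable_torus.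
by move=> i; exact: measurable_funTS.
Qed.

Lemma tintD d (F G : leb d -> \bar R) :
  measurable_fun [set: leb d] F -> measurable_fun [set: leb d] G ->
  (forall x, 0 <= F x)%E -> (forall x, 0 <= G x)%E ->
  tint (fun x => F x + G x)%E = (tint F + tint G)%E.
Proof.
move=> mF mG F0 G0; rewrite /tint ge0_integralD//; first exact: measurable_torus.
  exact: measurable_funTS.
exact: measurable_funTS.
Qed.

Lemma tintZ d (k : R) (F : leb d -> \bar R) : 0 <= k ->
  measurable_fun [set: leb d] F -> (forall x, 0 <= F x)%E ->
  tint (fun x => k%:E * F x)%E = (k%:E * tint F)%E.
Proof.
move=> k0 mF F0; rewrite /tint ge0_integralZl_EFin//; first exact: measurable_torus.
exact: measurable_funTS.
Qed.

Lemma le_tint d (F G : leb d -> \bar R) : (forall x, 0 <= F x)%E ->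
  (forall x, torus R d x -> F x <= G x)%E -> (tint F <= tint G)%E.
Proof. by move=> F0 FG; apply: le_integral_ge0. Qed.

Lemma tint_cst d (c : \bar R) : (0 <= c)%E ->
  tint (fun _ : leb d => c) = (c * ((2 * pi) ^+ d)%:E)%E.
Proof.
move=> c0; rewrite -lebesgue_torus /tint.
exact: (@integral_cst _ _ _ (lebesgue R d) _ (@measurable_torus d) c).
Qed.

Lemma tint_ge0 d (F : leb d -> \bar R) : (forall x, 0 <= F x)%E -> (0 <= tint F)%E.
Proof. by move=> F0; exact: integral_ge0. Qed.

Lemma sume_const (I : finType) (c : \bar R) : (0 <= c)%E ->
  (\sum_(i : I) c = #|I|%:R%:E * c)%E.
Proof.
move=> c0; rewrite big_const; elim: #|I| => [|k IH]/=; first by rewrite mul0e.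
by rewrite IH -natr1 EFinD ge0_muleDl ?lee_fin// mul1e addeC.
Qed.

(** The integral of F equals the average of the integrals of its translates.
    Estimates on grids that are uniform in the shift thus become estimates of
    integrals, which replaces the theorem of Fubini throughout. *)
Lemma le_tint_average d (I : finType) (a : I -> d.-tuple R) (F : leb d -> \bar R)
    (B : R) :
  (0 < #|I|)%N -> (forall i, torus R d (a i)) ->
  measurable_fun [set: leb d] F -> (forall x, 0 <= F x)%E -> tperiodic F ->
  (forall x, \sum_i F (vadd x (a i)) <= (#|I|%:R * B)%:E)%E ->
  (tint F <= (B * (2 * pi) ^+ d)%:E)%E.
Proof.
move=> I0 ta mF F0 pF FB.
have mFs c : measurable_fun [set: leb d] (fun x : leb d => F (vadd x c)).
  exact: measurable_comp_vadd.
have B0 : 0 <= B.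
  rewrite -(@pmulr_rge0 _ (#|I|%:R)) ?ltr0n// -lee_fin.
  by apply: le_trans (FB [tuple 0 | i < d]); apply: sume_ge0.
have : (\sum_(i : I) tint F <= (#|I|%:R * B)%:E * ((2 * pi) ^+ d)%:E)%E.
  rewrite -tint_cst ?lee_fin ?mulr_ge0//.
  rewrite (eq_bigr (fun i => tint (fun x => F (vadd x (a i))))); last first.
    by move=> i _; rewrite tint_vadd.
  rewrite -tint_sum//.
  apply: le_tint => // x.
  exact: sume_ge0.
rewrite sume_const; last exact: tint_ge0.
rewrite -EFinM -mulrA EFinM lee_pmul2l//.
by rewrite lte_fin ltr0n.
Qed.

End torus_integral.

(** * Trigonometric polynomials, exact quadrature and Parseval *)

Section characters.
Context (R : realType).
Local Notation C := R[i].
Local Notation normc := (@ComplexField.Normc.normc R).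
Local Notation Re := (@complex.Re R).

Lemma expiD (s t : R) : expi (s + t) = expi s * expi t.
Proof.
apply/eqP; rewrite eq_complex /= cosD sinD; apply/andP; split=> //.
by rewrite addrC.
Qed.

Lemma expi0 : expi (0 : R) = 1.
Proof. by rewrite /expi cos0 sin0. Qed.

Lemma expiN (t : R) : expi (- t) = ((expi t)^*)%C.
Proof. by rewrite /expi cosN sinN. Qed.

Lemma normc_expi (t : R) : normc (expi t) = 1.
Proof. by rewrite /= cos2Dsin2 sqrtr1. Qed.

Lemma expi_2pi : expi (2 * pi : R) = 1.
Proof. by rewrite mulrC mulr_natr /expi cos2pi sin2pi. Qed.

Lemma expi_nat (t : R) (n : nat) : expi (n%:R * t) = expi t ^+ n.
Proof.
elim: n => [|n IH]; first by rewrite mul0r expi0.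
by rewrite -natr1 mulrDl mul1r expiD IH exprSr.
Qed.

Lemma expi_2pi_int (z : int) : expi (z%:~R * (2 * pi) : R) = 1.
Proof.
case: z => n; first by rewrite expi_nat expi_2pi expr1n.
by rewrite NegzE mulrNz mulNr expiN expi_nat expi_2pi expr1n; apply: conjc1.
Qed.

Lemma expi_neq1 (t : R) : 0 < t < 2 * pi -> expi t != 1.
Proof.
move=> /andP[t0 t2]; apply/eqP => -[/eqP + _].
have -> : t = (t / 2) *+ 2 by rewrite -mulr_natr divfK.
rewrite cos_mulr2n cos2sin2 => h.
have : sin (t / 2) > 0.
  by apply: sin_gt0_pi; rewrite divr_gt0//= ltr_pdivrMr// mulrC.
move: h; have := @sin2cos2 R (t / 2).
move=> _ /eqP h s0.
have : sin (t / 2) ^+ 2 = 0 by move: h; rewrite mulr2n; lra.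
by move/eqP; rewrite sqrf_eq0 gt_eqF.
Qed.

Variable d : nat.
Local Notation K := 'rV[int]_d.

Definition chi (k : K) (x : d.-tuple R) : C := expi (freq_dot k x).

Lemma freq_dotDl (k l : K) x :
  freq_dot (R := R) (k + l) x = freq_dot k x + freq_dot l x.
Proof.
by rewrite /freq_dot -big_split; apply: eq_bigr => j _; rewrite mxE rmorphD mulrDl.
Qed.

Lemma freq_dotNl (k : K) x : freq_dot (R := R) (- k) x = - freq_dot k x.
Proof.
rewrite /freq_dot -sumrN; apply: eq_bigr => j _; by rewrite mxE rmorphN mulNr.
Qed.

Lemma chiDl k l x : chi (k + l) x = chi k x * chi l x.
Proof. by rewrite /chi freq_dotDl expiD. Qed.

Lemma chiNl k x : chi (- k) x = ((chi k x)^*)%C.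
Proof. by rewrite /chi freq_dotNl expiN. Qed.

Lemma chiDr k x y : chi k (vadd x y) = chi k x * chi k y.
Proof.
rewrite /chi -expiD /freq_dot -big_split; congr expi; apply: eq_bigr => j _.
by rewrite tnth_mktuple mulrDr.
Qed.

Lemma chiNr k x : chi k [tuple - tnth x j | j < d] = chi (- k) x.
Proof.
rewrite /chi freq_dotNl /freq_dot -sumrN; congr expi; apply: eq_bigr => j _.
by rewrite tnth_mktuple mulrN.
Qed.

Lemma vsubE (x y : d.-tuple R) : vsub x y = vadd x [tuple - tnth y j | j < d].
Proof. by apply: eq_from_tnth => i; rewrite !tnth_mktuple. Qed.

Lemma chiBr k x y : chi k (vsub x y) = chi k x * chi (- k) y.
Proof. by rewrite vsubE chiDr chiNr. Qed.

Lemma normc_chi k x : normc (chi k x) = 1.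
Proof. exact: normc_expi. Qed.

Lemma chi_conj k x : chi k x * chi (- k) x = 1.
Proof. by rewrite -chiDl subrr /chi /freq_dot big1 ?expi0// => j _; rewrite mxE mul0r. Qed.

Lemma chi0l x : chi 0 x = 1.
Proof. by rewrite -(subrr 0) chiDl chi_conj. Qed.

Lemma chi_cunit k x j : chi k (vadd x (cunit j (2 * pi))) = chi k x.
Proof.
rewrite chiDr; suff -> : chi k (cunit j (2 * pi)) = 1 by rewrite mulr1.
rewrite /chi /freq_dot (bigD1 j)//= tnth_mktuple eqxx big1; last first.
  by move=> i /negbTE ij; rewrite tnth_mktuple ij mulr0.
by rewrite addr0 expi_2pi_int.
Qed.

(** Sums over Z^d of finitely supported terms are taken over cubes, which are
    finite sequences of frequencies. *)
Definition inbox (N : nat) (k : K) : bool := [forall j, `|k 0 j| <= N%:Z].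

Definition box (N : nat) : seq K :=
  [seq (\row_j ((f j)%:Z - N%:Z) : K) | f : {ffun 'I_d -> 'I_(2 * N).+1} <- enum {: {ffun 'I_d -> 'I_(2 * N).+1}}].

Lemma mem_box N k : (k \in box N) = inbox N k.
Proof.
apply/mapP/forallP => [[f _ ->] j|h].
  rewrite mxE; have := ltn_ord (f j); move: (nat_of_ord (f j)) => m. lia.
have hj j : (`|(k 0 j + N%:Z)%R|%N < (2 * N).+1)%N by have := h j; move: (k 0 j) => z; lia.
exists [ffun j => Ordinal (hj j)]; first by rewrite mem_enum.
apply/rowP => j; rewrite mxE ffunE /=; have := h j; move: (k 0 j) => z; lia.
Qed.

Lemma uniq_box N : uniq (box N).
Proof.
rewrite map_inj_uniq ?enum_uniq// => f g /rowP fg; apply/ffunP => j.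
have := fg j; rewrite !mxE => /addIr [] /val_inj; exact.
Qed.

Lemma size_box N : size (box N) = ((2 * N).+1 ^ d)%N.
Proof. by rewrite size_map -cardE card_ffun !card_ord. Qed.

Lemma sum_supp (V : nmodType) (s s' : seq K) (F : K -> V) : uniq s -> uniq s' ->
  (forall k, F k != 0 -> (k \in s) = (k \in s')) ->
  \sum_(k <- s) F k = \sum_(k <- s') F k.
Proof.
move=> us us' h.
rewrite (bigID (fun k => F k == 0)) /= big1 ?add0r; last by move=> k /eqP.
rewrite [RHS](bigID (fun k => F k == 0)) /= [X in _ = X + _]big1 ?add0r; last first.
  by move=> k /eqP.
rewrite -big_filter -[RHS]big_filter; apply: perm_big.
apply: uniq_perm; rewrite ?filter_uniq// => k; rewrite !mem_filter.
by case: (boolP (F k == 0)) => //= /h ->.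
Qed.

Definition supp (N : nat) (V : nmodType) (a : K -> V) :=
  forall k, a k != 0 -> inbox N k.

Definition tp (N : nat) (a : K -> C) (x : d.-tuple R) : C :=
  \sum_(k <- box N) a k * chi k x.

Lemma tp_supp N M a x : supp N a -> supp M a -> tp N a x = tp M a x.
Proof.
move=> sN sM; apply: sum_supp; rewrite ?uniq_box// => k.
by rewrite mulf_eq0 negb_or !mem_box => /andP[ak _]; rewrite sN// sM.
Qed.

Lemma fsbig_box N (A : set K) (F : K -> C) : (forall k, A k -> F k != 0 -> inbox N k) ->
  \sum_(k \in A) F k = \sum_(k <- box N | k \in A) F k.
Proof.
move=> h; rewrite fsbig_mkcond [RHS]big_mkcond /=.
rewrite (@fsbigE _ _ _ _ setT (box N)) ?uniq_box//.
  by apply: eq_big => k; rewrite ?in_setT// /patch.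
move=> k _; rewrite mem_box /patch; case: ifPn => // kA kN.
apply/eqP; apply/negPn/negP => Fk; move: kN; apply/negP; rewrite negbK.
by apply: h => //; rewrite inE in kA.
Qed.

Definition tgrid (P : nat) (g : {ffun 'I_d -> 'I_P}) : d.-tuple R :=
  [tuple 2 * pi * (g j)%:R / P%:R | j < d].

Lemma tgrid_torus P (g : {ffun 'I_d -> 'I_P}) : torus R d (tgrid g).
Proof.
move=> j; rewrite tnth_mktuple; have := ltn_ord (g j).
move: (g j : nat) => m mP.
have P0 : 0 < P%:R :> R by rewrite ltr0n (leq_ltn_trans _ mP).
rewrite divr_ge0 ?mulr_ge0 ?pi_ge0//= ltr_pdivrMr// ltr_pM2l ?two_pi_gt0//.
by rewrite ltr_nat.
Qed.

Lemma sum_root1 (P : nat) (m : int) : (0 < P)%N ->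
  \sum_(r < P) expi (m%:~R * (2 * pi * r%:R / P%:R) : R) =
  if (P%:Z %| m)%Z then P%:R else 0.
Proof.
move=> P0; have P0' : P%:R != 0 :> R by rewrite pnatr_eq0 -lt0n.
set w : C := expi (m%:~R * (2 * pi) / P%:R : R).
have wr (r : 'I_P) : expi (m%:~R * (2 * pi * r%:R / P%:R) : R) = w ^+ r.
  rewrite -expi_nat; congr expi; field; exact: P0'.
rewrite (eq_bigr _ (fun r _ => wr r)).
have wP : w ^+ P = 1.
  rewrite -expi_nat -(expi_2pi_int m); congr expi; field; exact: P0'.
have [/dvdzP [q mq]|ndvd] := ifPn.
  suff w1 : w = 1.
    rewrite (eq_bigr (fun=> 1)); last by move=> r _; rewrite w1 expr1n.
    by rewrite sumr_const card_ord.
  rewrite -(expi_2pi_int q) /w mq rmorphM /=; congr expi; field; exact: P0'.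
have w1 : w != 1.
  have mE := divz_eq m P%:Z.
  have r0 : (0 <= m %% P%:Z)%Z by apply: modz_ge0; rewrite intr_eq0 || lia.
  have rP : (m %% P%:Z < P%:Z)%Z by apply: ltz_pmod; lia.
  have rn0 : (m %% P%:Z)%Z != 0 by rewrite -dvdz_mod0P || (apply: contra ndvd => /eqP h; apply/dvdz_mod0P).
  set r := (m %% P%:Z)%Z in mE r0 rP rn0 *.
  have -> : w = expi (r%:~R * (2 * pi) / P%:R : R).
    rewrite /w {1}mE -[RHS]mul1r -(expi_2pi_int (m %/ P%:Z)%Z) -expiD; congr expi.
    rewrite rmorphD rmorphM /=; field; exact: P0'.
  apply: expi_neq1.
  have rr0 : 0 < r%:~R :> R by rewrite ltr0z lt_neqAle eq_sym rn0.
  have rrP : r%:~R < P%:R :> R by rewrite -[P%:R]/(P%:Z%:~R) ltr_int.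
  have PP : 0 < P%:R :> R by rewrite ltr0n.
  rewrite divr_gt0 ?mulr_gt0 ?pi_gt0//= ltr_pdivrMr// mulrC ltr_pM2l ?two_pi_gt0//.
apply/eqP; rewrite -(mulrI_eq0 _ (mulfI (_ : w - 1 != 0))) ?subr_eq0//.
by rewrite -subrX1 wP subrr.
Qed.

Lemma sum_chi_grid (P : nat) (k : K) : (0 < P)%N ->
  \sum_(g : {ffun 'I_d -> 'I_P}) chi k (tgrid g) =
  if [forall j, (P%:Z %| (k 0%R j))%Z] then (P ^ d)%:R else 0.
Proof.
move=> P0.
have -> : \sum_(g : {ffun 'I_d -> 'I_P}) chi k (tgrid g) =
  \prod_(j < d) \sum_(r < P) expi ((k 0 j)%:~R * (2 * pi * r%:R / P%:R) : R).
  rewrite bigA_distr_bigA /=; apply: eq_bigr => g _.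
  rewrite /chi /freq_dot.
  rewrite (big_morph (@expi R) expiD expi0).
  by apply: eq_bigr => j _; rewrite tnth_mktuple.
have [/forallP h|/forallPn [j hj]] := ifPn.
  rewrite (eq_bigr (fun=> P%:R)); last by move=> j _; rewrite sum_root1// h.
  by rewrite prodr_const card_ord natrX.
by rewrite (bigD1 j)//= sum_root1// (negbTE hj) mul0r.
Qed.

(** After expansion the pair of frequencies k, l contributes only if k - l is
    divisible by P in each coordinate; the degrees being A and B with
    A + B < P, this leaves the pairs with k = l. *)
Lemma quadrature (P A B : nat) (a c : K -> C) (lam x : d.-tuple R) :
  (A + B < P)%N -> supp A a -> supp B c ->
  \sum_(g : {ffun 'I_d -> 'I_P})
    tp B c (vadd (tgrid g) lam) * tp A a (vsub (vsub x (tgrid g)) lam) =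
  (P ^ d)%:R * tp A (fun k => a k * c k) x.
Proof.
move=> ABP sa sc.
have P0 : (0 < P)%N by exact: leq_ltn_trans ABP.
transitivity (\sum_(k <- box A) \sum_(l <- box B)
   (a k * c l * chi k x * chi (l - k) lam) *
   \sum_(g : {ffun 'I_d -> 'I_P}) chi (l - k) (tgrid g)).
  under [RHS]eq_bigr do under eq_bigr do rewrite mulr_sumr.
  under [RHS]eq_bigr do rewrite exchange_big /=.
  rewrite exchange_big /=; apply: eq_bigr => g _.
  rewrite mulrC big_distrl; apply: eq_bigr => k _ /=.
  rewrite big_distrr; apply: eq_bigr => l _ /=.
  rewrite !chiBr chiDr !chiDl; ring.
rewrite mulr_sumr.
apply: eq_big_seq => k; rewrite mem_box => kA.
have [ak0|ak0] := eqVneq (a k) 0.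
  by rewrite big1 => [|l _]; rewrite ak0 !(mul0r, mulr0).
rewrite (eq_big_seq (fun l => if l == k then (P ^ d)%:R * (a k * c k * chi k x) else 0)); last first.
  move=> l; rewrite mem_box => lB; rewrite sum_chi_grid//.
  have [->|lk] := eqVneq l k.
    rewrite subrr ifT; last by apply/forallP => j; rewrite mxE dvdz0.
    by rewrite chi0l; ring.
  rewrite ifN ?mulr0//; apply: contra lk => /forallP h; apply/eqP/rowP => j.
  have := h j; have := forallP kA j; have := forallP lB j; rewrite !mxE.
  move: (l 0 j) (k 0 j) => u v uB vA /dvdzP [q uv].
  have [q0|q0|q0] := ltgtP q 0; [nia|nia|by move: uv; rewrite q0 mul0r => /eqP; rewrite subr_eq0 => /eqP].
have [kB|kB] := boolP (inbox B k).
  rewrite (bigD1_seq k) ?mem_box ?uniq_box//= eqxx big1 ?addr0; last first.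
    by move=> l /negbTE ->.
  by [].
have c0 : c k = 0 by apply/eqP; apply/negPn/negP => /sc; rewrite (negbTE kB).
rewrite big1_seq => [|l /andP[_]]; first by rewrite c0 mulr0 mul0r mulr0.
by rewrite mem_box => lB; case: eqP lB => // ->; rewrite (negbTE kB).
Qed.

End characters.

Section parseval.
Context (R : realType) (d : nat).
Local Notation C := R[i].
Local Notation normc := (@ComplexField.Normc.normc R).
Local Notation K := 'rV[int]_d.
Local Notation leb d := (lebesgue_space R d).

Lemma normc_sqr (z : C) : ((normc z ^+ 2)%:C)%C = z * (z^*)%C.
Proof.
case: z => a b; rewrite /= sqr_sqrtr ?addr_ge0 ?sqr_ge0//.
apply/eqP; rewrite eq_complex /=; apply/andP; split; apply/eqP; ring.
Qed.

Lemma normc_ge0 (z : C) : 0 <= normc z.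
Proof. by case: z => a b /=; exact: sqrtr_ge0. Qed.

Lemma normc_real (x : R) : normc ((x)%:C)%C = `|x|.
Proof. by rewrite /= expr0n addr0 sqrtr_sqr. Qed.

Lemma normc_conj (z : C) : normc (z^*)%C = normc z.
Proof. by case: z => a b /=; rewrite sqrrN. Qed.

(** The double sum of the square is evaluated as in [quadrature], with the
    conjugate polynomial as second factor. *)
Lemma parseval_grid N (a : K -> C) P (x : d.-tuple R) : (N + N < P)%N -> supp N a ->
  \sum_(g : {ffun 'I_d -> 'I_P}) normc (tp N a (vadd (tgrid R g) x)) ^+ 2 =
  (P ^ d)%:R * \sum_(k <- box d N) normc (a k) ^+ 2.
Proof.
move=> NP sa; apply: complexI; rewrite rmorph_sum rmorphM rmorph_nat rmorph_sum /=.
have sca : supp N (fun k => ((a k)^*)%C).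
  by move=> k; rewrite conjc_eq0; exact: sa.
have := @quadrature R d P N N (fun k => ((a k)^*)%C) a x [tuple 0 | j < d] NP sca sa.
have chi0 k : chi k ([tuple 0 | j < d] : d.-tuple R) = 1.
  by rewrite /chi /freq_dot big1 ?expi0// => j _; rewrite tnth_mktuple mulr0.
rewrite [in RHS]/tp => H.
transitivity ((P ^ d)%:R * \sum_(k <- box d N) (a k)^*%C * a k * chi k [tuple 0 | j < d]); last first.
  congr (_ * _); apply: eq_bigr => k _.
  by rewrite chi0 mulr1 normc_sqr mulrC.
rewrite -H; apply: eq_bigr => g _; rewrite normc_sqr; congr (_ * _).
rewrite /tp rmorph_sum; apply: eq_bigr => k _ /=.
rewrite rmorphM; congr (_ * _).
by rewrite !chiBr chi0 mul1r -chiDr chiNl.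
Qed.

Definition cmeas (f : leb d -> C) :=
  measurable_fun [set: leb d] (fun x => complex.Re (f x)) /\
  measurable_fun [set: leb d] (fun x => complex.Im (f x)).

Lemma cmeas_cst (c : C) : cmeas (fun=> c).
Proof. by split; exact: measurable_cst. Qed.

Lemma cmeasD f g : cmeas f -> cmeas g -> cmeas (fun x => f x + g x).
Proof.
move=> [f1 f2] [g1 g2]; split.
  rewrite (_ : (fun x => _) = (fun x => complex.Re (f x) + complex.Re (g x))).
    exact: measurable_realfun.measurable_funD.
  by apply/funext => x; case: (f x) => ? ?; case: (g x).
rewrite (_ : (fun x => _) = (fun x => complex.Im (f x) + complex.Im (g x))).
  exact: measurable_realfun.measurable_funD.
by apply/funext => x; case: (f x) => ? ?; case: (g x).
Qed.

Lemma cmeasM f g : cmeas f -> cmeas g -> cmeas (fun x => f x * g x).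
Proof.
move=> [f1 f2] [g1 g2]; split.
  rewrite (_ : (fun x => _) = (fun x => complex.Re (f x) * complex.Re (g x)
     - complex.Im (f x) * complex.Im (g x))).
    by apply: measurable_funB; exact: measurable_funM.
  by apply/funext => x; case: (f x) => ? ?; case: (g x).
rewrite (_ : (fun x => _) = (fun x => complex.Re (f x) * complex.Im (g x)
     + complex.Im (f x) * complex.Re (g x))).
  by apply: measurable_realfun.measurable_funD; exact: measurable_funM.
by apply/funext => x; case: (f x) => ? ?; case: (g x).
Qed.

Lemma cmeas_sum (I : Type) (s : seq I) (f : I -> leb d -> C) :
  (forall i, cmeas (f i)) -> cmeas (fun x => \sum_(i <- s) f i x).
Proof.
move=> mf; elim: s => [|i s IH].
  by under eq_fun do rewrite big_nil; exact: cmeas_cst.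
by under eq_fun do rewrite big_cons; exact: cmeasD.
Qed.

Lemma measurable_freq_dot (k : K) :
  measurable_fun [set: leb d] (fun x : leb d => freq_dot k x).
Proof.
rewrite /freq_dot; apply: measurable_sum => j.
apply: measurable_funM; first exact: measurable_cst.
exact: (measurable_fun_borel (@measurable_tnth _ (measurableTypeR R) d j)).
Qed.

Lemma cmeas_chi (k : K) : cmeas (chi (R := R) k).
Proof.
split; rewrite /chi /expi /=.
  apply: (@measurableT_comp _ _ _ _ _ _ (@cos R)); last exact: measurable_freq_dot.
  by apply: continuous_measurable_fun; exact: continuous_cos.
apply: (@measurableT_comp _ _ _ _ _ _ (@sin R)); last exact: measurable_freq_dot.
by apply: continuous_measurable_fun; exact: continuous_sin.
Qed.

Lemma cmeas_tp N a : cmeas (tp (R := R) (d := d) N a).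
Proof.
by apply: cmeas_sum => k; apply: cmeasM; [exact: cmeas_cst|exact: cmeas_chi].
Qed.

Lemma cmeas_real (f : leb d -> R) : measurable_fun [set: leb d] f ->
  cmeas (fun x => ((f x)%:C)%C).
Proof. by move=> mf; split => //=; exact: measurable_cst. Qed.

Lemma cmeas_vadd a (f : leb d -> C) : cmeas f -> cmeas (fun x => f (vadd x a)).
Proof.
move=> [f1 f2]; split.
  exact: (measurable_comp_vadd a f1).
exact: (measurable_comp_vadd a f2).
Qed.

Lemma measurable_normc (f : leb d -> C) : cmeas f ->
  measurable_fun [set: leb d] (fun x => normc (f x)).
Proof.
move=> [f1 f2].
rewrite (_ : (fun x => _) = (fun x => Num.sqrt (complex.Re (f x) ^+ 2 + complex.Im (f x) ^+ 2))); last first.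
  by apply/funext => x; case: (f x).
apply: (@measurableT_comp _ _ _ _ _ _ (@Num.sqrt R)).
  by apply: continuous_measurable_fun; exact: sqrt_continuous.
by apply: measurable_realfun.measurable_funD; exact: measurable_funX.
Qed.

Lemma tp_tperiodic N a : tperiodic (tp (R := R) (d := d) N a).
Proof. by move=> x j; apply: eq_bigr => k _; rewrite chi_cunit. Qed.

(** Parseval is exact on every translate of a fine grid, hence holds for the
    integral by averaging. *)
Lemma parseval_le N (a : K -> C) : supp N a ->
  (tint (fun x : leb d => (normc (tp N a x) ^+ 2)%:E) <=
   ((\sum_(k <- box d N) normc (a k) ^+ 2) * (2 * pi) ^+ d)%:E)%E.
Proof.
move=> sa; apply: (@le_tint_average _ _ {ffun 'I_d -> 'I_(N + N).+1} (@tgrid R d (N + N).+1)).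
- by rewrite card_ffun !card_ord expn_gt0.
- by move=> g; exact: tgrid_torus.
- apply/measurable_EFinP; apply: measurable_funX; apply: measurable_normc.
  exact: cmeas_tp.
- by move=> x; rewrite lee_fin sqr_ge0.
- by move=> x j; rewrite tp_tperiodic.
move=> x; rewrite sumEFin lee_fin card_ffun !card_ord.
under eq_bigr do rewrite vaddC.
by rewrite parseval_grid.
Qed.

Definition dk (j : 'I_d) (h : nat) : K := \row_i (if i == j then h%:Z else 0).

Definition fdiff (j : 'I_d) (h : nat) (a : K -> C) : K -> C :=
  fun k => a (k + dk j h) - a k.

Lemma supp_fdiff j h N a : supp N a -> supp (N + h) (fdiff j h a).
Proof.
move=> sa k; have [ak|ak] := eqVneq (a k) 0; last first.
  move=> _; apply/forallP => i; have := forallP (sa _ ak) i; lia.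
rewrite /fdiff ak subr0 => /sa /forallP sk; apply/forallP => i.
by have := sk i; rewrite !mxE; move: (k 0 i) => z; case: eqP => _; lia.
Qed.

(** Summation by parts.  The modulus of the factor is |e^(i h x_j) - 1|, so the
    polynomial is dominated by the differenced one where this is at least 1. *)
Lemma tp_fdiff j h N a x : supp N a ->
  tp (N + h) (fdiff j h a) x = (chi (- dk j h) x - 1) * tp N a x.
Proof.
move=> sa.
have sa' : supp (N + h) a.
  by move=> k /sa /forallP sk; apply/forallP => i; have := sk i; lia.
have key : chi (- dk j h) x * tp N a x =
    \sum_(k <- box d (N + h)) a (k + dk j h) * chi k x.
  have -> : tp N a x =
      \sum_(k <- [seq k + dk j h | k <- box d (N + h)]) a k * chi k x.
    apply: sum_supp; first exact: uniq_box.
      by rewrite map_inj_uniq ?uniq_box//; exact: addIr.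
    move=> k; rewrite mulf_eq0 negb_or => /andP[ak _].
    rewrite mem_box sa//; apply/esym/mapP; exists (k - dk j h); last by rewrite subrK.
    rewrite mem_box; apply/forallP => i; have := forallP (sa _ ak) i.
    by rewrite !mxE; move: (k 0 i) => z; case: eqP => _; lia.
  rewrite big_map big_distrr; apply: eq_bigr => k _ /=.
  by rewrite mulrCA -chiDl addrCA addNr addr0.
rewrite mulrBl mul1r key (tp_supp _ sa sa') /tp -sumrB.
by apply: eq_bigr => k _; rewrite mulrBl.
Qed.

Fixpoint fdiffn (m : nat) (j : 'I_d) (h : nat) (a : K -> C) : K -> C :=
  if m is m'.+1 then fdiffn m' j h (fdiff j h a) else a.

Lemma supp_fdiffn m j h N a : supp N a -> supp (N + m * h) (fdiffn m j h a).
Proof.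
elim: m N a => [|m IH] N a sa /=; first by rewrite mul0n addn0.
by rewrite mulSn addnA; apply: IH; exact: supp_fdiff.
Qed.

Lemma tp_fdiffn m j h N a x : supp N a ->
  tp (N + m * h) (fdiffn m j h a) x = (chi (- dk j h) x - 1) ^+ m * tp N a x.
Proof.
elim: m N a => [|m IH] N a sa /=; first by rewrite mul0n addn0 mul1r.
rewrite mulSn addnA IH; last exact: supp_fdiff.
by rewrite tp_fdiff// exprSr mulrA.
Qed.

Lemma chi_dk j h x : chi (- dk j h) x = (expi (h%:R * tnth x j))^*%C :> C.
Proof.
rewrite chiNl /chi /freq_dot (bigD1 j)//= big1 ?addr0; last first.
  by move=> i /negbTE ij; rewrite mxE ij mul0r.
by rewrite mxE eqxx.
Qed.

Lemma normc_chi_dk j h x : normc (chi (- dk j h) x - 1) =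
  normc (expi (h%:R * tnth x j) - 1 : C).
Proof.
by rewrite chi_dk -[in RHS]normc_conj; congr normc; rewrite rmorphB rmorph1.
Qed.

End parseval.

(** * Quasi-norms of kernels from differences of their coefficients *)

Section dyadic.
Context (R : realType) (d : nat).
Local Notation C := R[i].
Local Notation normc := (@ComplexField.Normc.normc R).
Local Notation K := 'rV[int]_d.
Local Notation leb d := (lebesgue_space R d).

(** The points where no frequency 2^l, l < L, in any direction makes the factor
    of [tp_fdiff] at least 1: essentially a neighbourhood of the origin of
    diameter 2^(-L). *)
Definition near0 (L : nat) (x : d.-tuple R) : bool :=
  [forall l : 'I_L, forall j, normc (expi ((2 ^ l)%:R * tnth x j) - 1 : C) < 1].

Definition near0_ind (L : nat) (x : d.-tuple R) : R := (near0 L x)%:R.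

Lemma measurable_near0_ind L :
  measurable_fun [set: leb d] (near0_ind L : leb d -> R).
Proof.
pose A : set (leb d) := \bigcap_(i in [set: 'I_L * 'I_d])
  [set x | normc (expi ((2 ^ i.1)%:R * tnth x i.2) - 1 : C) < 1].
rewrite (_ : near0_ind L = \1_A); last first.
  apply/funext => x; rewrite indicE /near0_ind; congr (_%:R); congr nat_of_bool.
  apply/idP/idP => [/forallP h|].
    by rewrite inE => -[l j] _ /=; have /forallP := h l; exact.
  rewrite inE => h; apply/forallP => l; apply/forallP => j.
  exact: (h (l, j)).
apply: measurable_indic; apply: fin_bigcap_measurable; first exact: finite_finset.
move=> [l j] _ /=.
have mf : measurable_fun [set: leb d]
    (fun x : leb d => normc (expi ((2 ^ l)%:R * tnth x j) - 1 : C)).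
  apply: (@measurable_normc R d (fun x => expi ((2 ^ l)%:R * tnth x j) - 1)).
  have -> : (fun x : d.-tuple R => expi ((2 ^ l)%:R * tnth x j) - 1 : C) =
      (fun x => chi (dk j (2 ^ l)) x + -1).
    apply/funext => x; congr (_ + _); rewrite /chi /freq_dot (bigD1 j)//=.
    rewrite big1 ?addr0 ?mxE ?eqxx// => i /negbTE ij; by rewrite mxE ij mul0r.
  by apply: cmeasD; [exact: cmeas_chi|exact: cmeas_cst].
have := mf measurableT [set` `]-oo, (1:R)[] (measurable_itv _).
by rewrite setTI; congr measurable; apply/seteqP; split => x /=; rewrite in_itv.
Qed.

Lemma near0_tperiodic L : tperiodic (near0_ind L).
Proof.
move=> x j; rewrite /near0_ind /near0; congr (_%:R); congr nat_of_bool.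
apply: eq_forallb => l; apply: eq_forallb => i.
rewrite tnth_mktuple tnth_mktuple; case: eqP => _; last by rewrite addr0.
by rewrite mulrDr expiD -[(2 ^ l)%:R]/((2 ^ l)%:Z%:~R) expi_2pi_int mulr1.
Qed.

Lemma odd_factor (n : nat) : (0 < n)%N -> exists e o, n = (2 ^ e * o)%N /\ odd o.
Proof.
elim/ltn_ind: n => n IH n0.
have [on|en] := boolP (odd n); first by exists 0, n; rewrite mul1n.
have nE : n = (n./2).*2 by rewrite -[LHS]odd_double_half (negbTE en).
have [| |e [q [h oo]]] := IH n./2; [lia|lia|].
by exists e.+1, q; split => //; rewrite nE h expnS -mul2n mulnA.
Qed.

Lemma expi_pi_odd (o : nat) : odd o -> expi (o%:R * pi : R) = -1 :> C.
Proof.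
move=> oo; rewrite expi_nat.
have -> : expi (pi : R) = -1.
  by rewrite /expi cospi sinpi; apply/eqP; rewrite eq_complex /= oppr0 !eqxx.
by rewrite -signr_odd oo expr1.
Qed.

(** The j-th coordinates of the two points differ by an odd multiple of
    pi / 2^l for some l < L, so e^(i 2^l x_j) takes opposite values there, and
    these cannot both have distance less than 1 to the point 1. *)
Lemma near0_grid_sep (L : nat) (x : d.-tuple R) (g g' : {ffun 'I_d -> 'I_(2 ^ L)}) j :
  near0 L (vadd x (tgrid R g)) -> near0 L (vadd x (tgrid R g')) ->
  (g j < g' j)%N -> False.
Proof.
move=> ng ng' gg'.
have [| e [q [mE oo]]] := @odd_factor (g' j - g j); first by rewrite subn_gt0.
have eL : (e < L)%N.
  rewrite -(ltn_exp2l _ _ (isT : (1 < 2)%N)); have := ltn_ord (g' j).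
  apply: leq_ltn_trans; apply: (@leq_trans (g' j - g j)); last exact: leq_subr.
  by rewrite mE leq_pmulr//; case: (q) oo.
have lL : (L - e.+1 < L)%N by lia.
have /forallP /(_ j) := forallP ng (Ordinal lL).
have /forallP /(_ j) := forallP ng' (Ordinal lL).
have -> : nat_of_ord (Ordinal lL) = (L - e.+1)%N by [].
rewrite !tnth_mktuple.
set l := (L - e.+1)%N.
set t := _ * (_ + 2 * pi * (g j)%:R / _).
set t' := _ * (_ + _ / _).
have tt' : t' = t + q%:R * pi.
  have L0 : (2 ^ L)%:R != 0 :> R by rewrite pnatr_eq0 -lt0n expn_gt0.
  have g'E : (g' j)%:R = (g j)%:R + (2 ^ e * q)%:R :> R by rewrite -natrD -mE subnKC// ltnW.
  have LE : (2 ^ L)%:R = (2 ^ l)%:R * (2 ^ e)%:R * 2 :> R.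
    by rewrite -!natrM -expnD -expnSr; congr (2 ^ _)%:R; rewrite /l; lia.
  rewrite /t /t' g'E natrM; move: L0; rewrite LE => L0; field.
  by move: L0; rewrite !mulf_eq0 !negb_or => /andP[/andP[-> ->] _].
rewrite tt' expiD expi_pi_odd// mulrN1.
move: (expi t) => z h1 h2.
have := le_normcD (z - 1) (- z - 1).
have -> : z - 1 + (- z - 1) = - (1 + 1) by ring.
rewrite normcN.
have -> : normc (1 + 1 : C) = 2.
  by rewrite -[1 + 1]/(2%:R) -(rmorph_nat (real_complex R)) normc_real normr_nat.
lra.
Qed.

(** By [near0_grid_sep] at most one point of a translated grid lies in
    [near0]. *)
Lemma near0_grid_sum (L : nat) (x : d.-tuple R) :
  \sum_(g : {ffun 'I_d -> 'I_(2 ^ L)}) near0_ind L (vadd x (tgrid R g)) <= 1.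
Proof.
have [g0 h0|h] := pickP (fun g : {ffun 'I_d -> 'I_(2 ^ L)} => near0 L (vadd x (tgrid R g))).
  rewrite (bigD1 g0)//= big1 ?addr0 /near0_ind ?lern1 ?leq_b1//.
  move=> g gg0; case: (boolP (near0 _ _)) => // hg; exfalso.
  move: gg0 => /eqP; apply; apply/ffunP => j; apply: val_inj => /=.
  have [lt|gt|//] := ssrnat.ltngtP (g j) (g0 j).
    by case: (near0_grid_sep hg h0 lt).
  by case: (near0_grid_sep h0 hg gt).
by rewrite big1// => g _; rewrite /near0_ind h.
Qed.

Lemma tint_near0 (L : nat) :
  (tint (fun x : leb d => (near0_ind L x)%:E) <=
   (((2 ^ L)%:R ^- d) * (2 * pi) ^+ d)%:E)%E.
Proof.
have c : #|{ffun 'I_d -> 'I_(2 ^ L)}| = ((2 ^ L) ^ d)%N by rewrite card_ffun !card_ord.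
apply: (@le_tint_average _ _ {ffun 'I_d -> 'I_(2 ^ L)} (@tgrid R d (2 ^ L))).
- by rewrite c !expn_gt0.
- by move=> g; exact: tgrid_torus.
- by apply/measurable_EFinP; exact: measurable_near0_ind.
- by move=> x; rewrite lee_fin ler0n.
- by move=> x j; rewrite near0_tperiodic.
move=> x; rewrite sumEFin lee_fin c natrX mulfV ?near0_grid_sum//.

Qed.

(** With theta = p / 2 and t = b^2 / M this is t^theta <= 1 + t.  It plays the
    part of the inequality of Hoelder on each dyadic shell. *)
Lemma powR_weight (b M p : R) : 0 <= b -> 0 < M -> 0 < p -> p < 2 ->
  b `^ p <= M `^ (p / 2 - 1) * b ^+ 2 + M `^ (p / 2).
Proof.
move=> b0 M0 p0 p2.
have bp : b `^ p = (b ^+ 2) `^ (p / 2).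
  rewrite -powR_mulrn// -powRrM; congr powR; lra.
rewrite bp; have [bM|Mb] := leP (b ^+ 2) M.
  apply: ler_wpDl; first by rewrite mulr_ge0 ?powR_ge0 ?sqr_ge0.
  by apply: ge0_ler_powR; rewrite ?nnegrE ?sqr_ge0 ?divr_ge0 ?(ltW p0) ?(ltW M0).
apply: ler_wpDr; first exact: powR_ge0.
have b20 : 0 < b ^+ 2 by exact: lt_trans Mb.
rewrite -{1}[p / 2](subrK 1) powRD; last by rewrite (gt_eqF b20) implybT.
rewrite powRr1 ?(ltW b20)// ler_wpM2r ?(ltW b20)//.
rewrite -(opprB 1) !powRN lef_pV2 ?posrE ?powR_gt0//.
by apply: ge0_ler_powR; rewrite ?nnegrE ?(ltW M0) ?(ltW b20) ?(ltW Mb)//; lra.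
Qed.

(** The shells are determined by the first l at which x leaves [near0]; on the
    shell of l some differenced polynomial of step 2^l dominates. *)
Lemma kernel_pointwise (p : R) (m L N : nat) (a : K -> C) (M : nat -> R)
   (x : d.-tuple R) : 0 < p -> p < 2 -> supp N a -> (forall l, 0 < M l) ->
  normc (tp N a x) `^ p <=
   \sum_(l < L) (M l `^ (p / 2 - 1) *
       (\sum_(j < d) normc (tp (N + m * 2 ^ l) (fdiffn m j (2 ^ l) a) x) ^+ 2) +
       M l `^ (p / 2) * near0_ind l x) +
   (M L `^ (p / 2 - 1) * normc (tp N a x) ^+ 2 + M L `^ (p / 2) * near0_ind L x).
Proof.
move=> p0 p2 sa M0; set b := normc (tp N a x).
have b0 : 0 <= b := normc_ge0 _.
have t0 l : 0 <= M l `^ (p / 2 - 1) *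
       (\sum_(j < d) normc (tp (N + m * 2 ^ l) (fdiffn m j (2 ^ l) a) x) ^+ 2) +
       M l `^ (p / 2) * near0_ind l x.
  rewrite addr_ge0 ?mulr_ge0 ?powR_ge0 ?ler0n// sumr_ge0// => j _.
  exact: sqr_ge0.
have [nL|fL] := boolP (near0 L x).
  apply: ler_wpDl; first exact: sumr_ge0.
  by rewrite /near0_ind nL mulr1; exact: powR_weight.
apply: ler_wpDr.
  by rewrite addr_ge0 ?mulr_ge0 ?powR_ge0 ?ler0n ?sqr_ge0.
have ex : exists l, ~~ near0 l x by exists L.
case: (ex_minnP ex) => l' fl' min.
case: l' fl' min => [|l] fl' min; first by case/negP: fl'; apply/forallP => -[].
have lL : (l < L)%N by apply: min.
have nl : near0 l x by apply/negPn/negP => /min; rewrite ltnn.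
rewrite (bigD1 (Ordinal lL))//=; apply: ler_wpDr; first exact: sumr_ge0.
rewrite /near0_ind nl mulr1.
apply: (le_trans (powR_weight b0 (M0 l) p0 p2)); rewrite lerD2r ler_wpM2l ?powR_ge0//.
move: fl' => /forallPn [i /forallPn [j]]; rewrite -leNgt => fl'.
have il : i = l :> nat.
  apply/eqP; have := ltn_ord i; rewrite ltnS leq_eqVlt => /orP[//|il]; exfalso.
  have /forallP /(_ j) := forallP nl (Ordinal il).
  by rewrite /= ltNge fl'.
rewrite (bigD1 j)//=; apply: ler_wpDr; first by apply: sumr_ge0 => *; exact: sqr_ge0.
rewrite tp_fdiffn// ComplexField.Normc.normcM exprMn ler_peMl ?sqr_ge0//.
have nX (z : C) k : normc (z ^+ k) = normc z ^+ k.
  elim: k => [|k IH]; first by rewrite !expr0 ComplexField.Normc.normc1.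
  by rewrite !exprS ComplexField.Normc.normcM IH.
rewrite nX normc_chi_dk -exprM exprn_ege1// -il; exact: fl'.
Qed.

End dyadic.

Section kernel.
Context (R : realType) (d : nat).
Local Notation C := R[i].
Local Notation normc := (@ComplexField.Normc.normc R).
Local Notation K := 'rV[int]_d.
Local Notation leb d := (lebesgue_space R d).

(** The bound is normalized by the measure of the torus, as the averages give
    it. *)
Definition tint_bounded (F : leb d -> R) (B : R) :=
  [/\ measurable_fun [set: leb d] F, (forall x, 0 <= F x) &
      (tint (fun x => (F x)%:E) <= (B * (2 * pi) ^+ d)%:E)%E].

Lemma tint_boundedD F G A B : tint_bounded F A -> tint_bounded G B ->
  tint_bounded (fun x => F x + G x) (A + B).
Proof.
move=> [mF F0 FA] [mG G0 GB]; split.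
- exact: measurable_realfun.measurable_funD.
- by move=> x; rewrite addr_ge0.
under eq_fun do rewrite EFinD.
rewrite tintD; last 4 first.
- exact/measurable_EFinP.
- exact/measurable_EFinP.
- by move=> x; rewrite lee_fin.
- by move=> x; rewrite lee_fin.
by rewrite mulrDl EFinD leeD.
Qed.

Lemma tint_boundedZ F k B : 0 <= k -> tint_bounded F B ->
  tint_bounded (fun x => k * F x) (k * B).
Proof.
move=> k0 [mF F0 FB]; split.
- by apply: measurable_funM => //; exact: measurable_cst.
- by move=> x; rewrite mulr_ge0.
under eq_fun do rewrite EFinM.
have mF' : measurable_fun [set: leb d] (fun x => (F x)%:E) by exact/measurable_EFinP.
rewrite (tintZ k0 mF' (fun x => F0 x)).
by rewrite -mulrA EFinM lee_wpmul2l// lee_fin.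
Qed.

Lemma tint_bounded0 : tint_bounded (fun=> 0) 0.
Proof.
split => //.
by rewrite tint_cst// mul0e mul0r.
Qed.

Lemma tint_bounded_sum (I : Type) (s : seq I) (F : I -> leb d -> R) (B : I -> R) :
  (forall i, tint_bounded (F i) (B i)) ->
  tint_bounded (fun x => \sum_(i <- s) F i x) (\sum_(i <- s) B i).
Proof.
move=> FB; elim: s => [|i s IH].
  by under eq_fun do rewrite big_nil; rewrite big_nil; exact: tint_bounded0.
by under eq_fun do rewrite big_cons; rewrite big_cons; exact: tint_boundedD.
Qed.

Lemma tint_bounded_le F A B : A <= B -> tint_bounded F A -> tint_bounded F B.
Proof.
move=> AB [mF F0 FA]; split => //; apply: (le_trans FA).
by rewrite lee_fin ler_wpM2r// exprn_ge0// mulr_ge0// pi_ge0.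
Qed.

Lemma tint_bounded_tp2 N (a : K -> C) D : supp N a ->
  \sum_(k <- box d N) normc (a k) ^+ 2 <= D ->
  tint_bounded (fun x => normc (tp N a x) ^+ 2) D.
Proof.
move=> sa aD; apply: (tint_bounded_le aD); split.
- by apply: measurable_funX; apply: measurable_normc; exact: cmeas_tp.
- by move=> x; exact: sqr_ge0.
exact: parseval_le.
Qed.

Lemma tint_bounded_near0 L :
  tint_bounded (near0_ind L) ((2 ^ L)%:R ^- d).
Proof.
split; [exact: measurable_near0_ind|by move=> x; exact: ler0n|exact: tint_near0].
Qed.

Lemma kernel_integral (p : R) (m L N : nat) (a : K -> C) (M D : nat -> R) (D0 : R) :
  0 < p -> p < 2 -> supp N a -> (forall l, 0 < M l) ->
  (forall l j, (l < L)%N -> \sum_(k <- box d (N + m * 2 ^ l))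
      normc (fdiffn m j (2 ^ l) a k) ^+ 2 <= D l) ->
  \sum_(k <- box d N) normc (a k) ^+ 2 <= D0 ->
  (tint (fun x : leb d => (normc (tp N a x) `^ p)%:E) <=
   ((\sum_(l < L) (M l `^ (p / 2 - 1) * (d%:R * D l) +
        M l `^ (p / 2) * (2 ^ l)%:R ^- d) +
     (M L `^ (p / 2 - 1) * D0 + M L `^ (p / 2) * (2 ^ L)%:R ^- d))
    * (2 * pi) ^+ d)%:E)%E.
Proof.
move=> p0 p2 sa M0 hD hD0.
have [_ _ H] : tint_bounded (fun x =>
   \sum_(l < L) (M l `^ (p / 2 - 1) *
       (\sum_(j < d) normc (tp (N + m * 2 ^ l) (fdiffn m j (2 ^ l) a) x) ^+ 2) +
       M l `^ (p / 2) * near0_ind l x) +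
   (M L `^ (p / 2 - 1) * normc (tp N a x) ^+ 2 + M L `^ (p / 2) * near0_ind L x))
   (\sum_(l < L) (M l `^ (p / 2 - 1) * (d%:R * D l) +
        M l `^ (p / 2) * (2 ^ l)%:R ^- d) +
     (M L `^ (p / 2 - 1) * D0 + M L `^ (p / 2) * (2 ^ L)%:R ^- d)).
  apply: tint_boundedD.
    apply: tint_bounded_sum => l.
    apply: tint_boundedD; (apply: tint_boundedZ; first exact: powR_ge0); last first.
      exact: tint_bounded_near0.
    have -> : d%:R * D l = \sum_(j < d) D l by rewrite sumr_const card_ord mulr_natl.
    apply: tint_bounded_sum => j; apply: tint_bounded_tp2; last exact: hD.
    exact: supp_fdiffn.
  apply: tint_boundedD; (apply: tint_boundedZ; first exact: powR_ge0); last first.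
    exact: tint_bounded_near0.
  exact: tint_bounded_tp2.
apply: le_trans H; apply: le_tint => x.
  by rewrite lee_fin powR_ge0.
by move=> _; rewrite lee_fin; exact: kernel_pointwise.
Qed.

Lemma dyadic_level (m n : nat) : (0 < m)%N -> exists L, (n < 2 ^ L * m)%N /\
  forall l, (l < L)%N -> (2 ^ l * m <= n)%N.
Proof.
move=> m0; have ex : exists L, (n < 2 ^ L * m)%N.
  by exists n; apply: (leq_trans (ltn_expl n (isT : 1 < 2)%N)); rewrite leq_pmulr.
case: (ex_minnP ex) => L hL min; exists L; split => // l lL.
by rewrite leqNgt; apply/negP => /min; rewrite leqNgt lL.
Qed.

Lemma geometric_le (q : R) (L : nat) : 1 < q -> \sum_(l < L) q ^+ l <= q ^+ L / (q - 1).
Proof.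
move=> q1; rewrite ler_pdivlMr ?subr_gt0// mulrC -subrX1; lra.
Qed.

(** The weight M balances the two terms of a shell: both become the same
    product of powers of n and of the dyadic scale y. *)
Lemma kernel_term (X y s p D E : R) : 0 < X -> 0 < y ->
  let M := X `^ (D - 2 * s) * y `^ (2 * s + D) in
  M `^ (p / 2 - 1) * (E * (X `^ D * (y / X) `^ (2 * s))) + M `^ (p / 2) * y `^ (- D) =
  (E + 1) * (X `^ (p / 2 * (D - 2 * s)) * y `^ (p * s + p / 2 * D - D)).
Proof.
move=> X0 y0 M.
have Xn : X != 0 by rewrite gt_eqF.
have yn : y != 0 by rewrite gt_eqF.
have pw (z u v : R) : z != 0 -> z `^ (u + v) = z `^ u * z `^ v.
  by move=> zn; rewrite powRD// zn implybT.
have Me r : M `^ r = X `^ (r * (D - 2 * s)) * y `^ (r * (2 * s + D)).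
  by rewrite /M powRM ?powR_ge0// -!powRrM; congr (_ `^ _ * _ `^ _); rewrite mulrC.
have yX : (y / X) `^ (2 * s) = y `^ (2 * s) * X `^ (- (2 * s)).
  by rewrite powRM ?invr_ge0 ?ltW// -powR_inv1 ?ltW// -powRrM; congr (_ * _ `^ _); ring.
rewrite !Me yX.
rewrite (_ : X `^ ((p / 2 - 1) * (D - 2 * s)) * y `^ ((p / 2 - 1) * (2 * s + D)) *
  (E * (X `^ D * (y `^ (2 * s) * X `^ (- (2 * s))))) =
  E * ((X `^ ((p / 2 - 1) * (D - 2 * s)) * (X `^ D * X `^ (- (2 * s)))) *
    (y `^ ((p / 2 - 1) * (2 * s + D)) * y `^ (2 * s)))); last by ring.
rewrite [RHS](mulrDl E) mul1r -!pw// -mulrA -pw//.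
congr (E * (X `^ _ * y `^ _) + X `^ _ * y `^ _); by field.
Qed.

(** With the weights of [kernel_term] the shell of 2^l contributes a constant
    times 2^(l e), where e = p s + p d / 2 - d is positive by the hypothesis on
    s.  The geometric sum is then governed by its last term, 2^L being
    comparable to n. *)
Theorem kernel_estimate (p s C0 : R) (m : nat) : 0 < p -> p < 2 -> (0 < m)%N ->
  d%:R * (1 / p - 1 / 2) < s ->
  exists2 C1 : R, 0 < C1 & forall (n N : nat) (a : K -> C),
    (0 < n)%N -> supp N a ->
    \sum_(k <- box d N) normc (a k) ^+ 2 <= C0 * n%:R `^ d%:R ->
    (forall h j, (0 < h)%N -> (h * m <= n)%N -> \sum_(k <- box d (N + m * h))
      normc (fdiffn m j h a k) ^+ 2 <= C0 * (n%:R `^ d%:R * (h%:R / n%:R) `^ (2 * s))) ->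
    (tint (fun x : leb d => (normc (tp N a x) `^ p)%:E) <=
      (C1 * n%:R `^ (d%:R * (p - 1)))%:E)%E.
Proof.
move=> p0 p2 m0 hs.
wlog C00 : C0 / 0 <= C0.
  move=> W; have [C1 C10 H] := W `|C0| (normr_ge0 _); exists C1 => // n N a n0 sa h1 h2.
  apply: H => //.
    by apply: (le_trans h1); rewrite ler_wpM2r ?powR_ge0// ler_norm.
  move=> h j hh hm; apply: (le_trans (h2 h j hh hm)).
  by rewrite ler_wpM2r ?mulr_ge0 ?powR_ge0// ler_norm.
pose D : R := d%:R.
pose e : R := p * s + p / 2 * D - D.
have e0 : 0 < e.
  have : p * (D * (1 / p - 1 / 2)) < p * s by rewrite ltr_pM2l.
  have -> : p * (D * (1 / p - 1 / 2)) = D - p / 2 * D by field; rewrite gt_eqF.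
  rewrite /e; lra.
pose q : R := 2 `^ e.
have q1 : 1 < q.
  by rewrite -[ltLHS]expR0 /q /powR pnatr_eq0/= ltr_expR mulr_gt0// ln_gt0// ltr1n.
pose V : R := (2 * pi) ^+ d.
have V0 : 0 < V by rewrite exprn_gt0// two_pi_gt0.
pose B1 : R := (D * C0 + 1) * (q / (q - 1)).
have B10 : 0 <= B1.
  rewrite mulr_ge0 ?divr_ge0 ?subr_ge0 ?(ltW q1)//.
    by rewrite addr_ge0// mulr_ge0// ler0n.
  by rewrite (le_trans _ (ltW q1)).
pose B2 : R := C0 + m%:R `^ D.
have B20 : 0 <= B2 by rewrite addr_ge0 ?powR_ge0.
exists ((B1 + B2 + 1) * V).
  by rewrite mulr_gt0// ltr_wpDl// addr_ge0.
move=> n N a n0 sa h1 h2.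
have [L [nL lL]] := dyadic_level n m0.
pose X : R := n%:R.
have X0 : 0 < X by rewrite ltr0n.
have Xn : X != 0 by rewrite gt_eqF.
(* the last term involves no difference; M is there the square of the height n^d of the kernel *)
pose M l : R := if l == L then X `^ (2 * D) else
  X `^ (D - 2 * s) * (2 ^ l)%:R `^ (2 * s + D).
have y0 l : 0 < (2 ^ l)%:R :> R by rewrite ltr0n expn_gt0.
have M0 l : 0 < M l by rewrite /M; case: ifP => _; rewrite ?mulr_gt0 ?powR_gt0.
have := @kernel_integral p m L N a M
  (fun l => C0 * (X `^ D * ((2 ^ l)%:R / X) `^ (2 * s))) (C0 * X `^ D) p0 p2 sa M0.
move=> /(_ _ h1) H; apply: (le_trans (H _)) => {H}.
  by move=> l j ll; apply: h2; rewrite ?expn_gt0// lL.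
rewrite lee_fin mulrAC ler_wpM2r ?(ltW V0)//.
have yD l : (2 ^ l)%:R ^- d = (2 ^ l)%:R `^ (- D) :> R.
  by rewrite powRN powR_mulrn ?(ltW (y0 _)).
have ME : M L = X `^ (2 * D) by rewrite /M eqxx.
have pw (z u v : R) : z != 0 -> z `^ (u + v) = z `^ u * z `^ v.
  by move=> zn; rewrite powRD// zn implybT.
have T1 : \sum_(l < L) (M l `^ (p / 2 - 1) * (D * (C0 * (X `^ D * ((2 ^ l)%:R / X) `^ (2 * s))))
   + M l `^ (p / 2) * (2 ^ l)%:R ^- d) <= B1 * X `^ (D * (p - 1)).
  under eq_bigr => l _.
    rewrite /M ltn_eqF// yD (mulrA D C0) kernel_term//.
    over.
  rewrite -mulr_sumr -mulr_sumr.
  under eq_bigr => l _.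
    rewrite -/e natrX -powR_mulrn// -powRrM mulrC powRrM powR_mulrn ?powR_ge0//.
    over.
  rewrite -/q.
  case: L nL lL M ME M0 => [|L] nL lL M ME M0.
    by rewrite big_ord0 !mulr0 mulr_ge0 ?powR_ge0.
  have qL : q ^+ L <= X `^ e.
    rewrite /q -powR_mulrn ?powR_ge0// -powRrM mulrC powRrM powR_mulrn//.
    apply: ge0_ler_powR; rewrite ?nnegrE ?exprn_ge0 ?(ltW X0) ?(ltW e0)//.
    rewrite -natrX ler_nat; apply: leq_trans (lL L (ltnSn _)).
    by rewrite leq_pmulr.
  rewrite /B1 -[leRHS]mulrA ler_wpM2l//.
    by rewrite addr_ge0// mulr_ge0// ler0n.
  apply: (le_trans (ler_wpM2l (powR_ge0 _ _) (geometric_le L.+1 q1))).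
  have -> : D * (p - 1) = p / 2 * (D - 2 * s) + e by rewrite /e; field.
  rewrite pw// [leRHS]mulrCA ler_wpM2l ?powR_ge0// exprS -!mulrA.
  rewrite ler_wpM2l//; first by rewrite (le_trans _ (ltW q1)).
  by rewrite mulrC ler_wpM2l// invr_ge0 subr_ge0 ltW.
have T2 : M L `^ (p / 2 - 1) * (C0 * X `^ D) + M L `^ (p / 2) * (2 ^ L)%:R ^- d <=
   B2 * X `^ (D * (p - 1)).
  rewrite ME -!powRrM /B2 [leRHS]mulrDl; apply: lerD.
    rewrite mulrCA ler_wpM2l// -pw//.
    by rewrite (_ : 2 * D * (p / 2 - 1) + D = D * (p - 1))//; field.
  have -> : D * (p - 1) = 2 * D * (p / 2) - D by field.
  rewrite pw// [leRHS]mulrCA ler_wpM2l ?powR_ge0//.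
  rewrite yD !powRN ler_pdivlMr ?powR_gt0// mulrC ler_pdivrMr ?powR_gt0//.
  rewrite -powRM ?ler0n// -natrM mulnC.
  by apply: ge0_ler_powR; rewrite ?nnegrE ?ler0n// ler_nat ltnW.
rewrite -/X -/D.
apply: (le_trans (lerD T1 T2)); rewrite -mulrDl ler_wpM2r ?powR_ge0//; lra.
Qed.

End kernel.

(** * Truncated powers and iterated differences *)

Section powers.
Context (R : realType).

(** The truncated power x_+^a.  It vanishes for x <= 0 also if a <= 0, so that
    the derivative of order k is again a multiple of a truncated power. *)
Definition ppow (a x : R) : R := if 0 < x then x `^ a else 0.

Lemma ppow_ge0 a x : 0 <= ppow a x.
Proof. by rewrite /ppow; case: ifP => // _; exact: powR_ge0. Qed.

Lemma ppowE a x : 0 < x -> ppow a x = x `^ a.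
Proof. by rewrite /ppow => ->. Qed.

Lemma ppow_le0 a x : x <= 0 -> ppow a x = 0.
Proof. by rewrite /ppow ltNge => ->. Qed.

Lemma ppow_mulr a x : ppow a x = ppow (a - 1) x * x.
Proof.
rewrite /ppow; case: ifPn => [x0|_]; last by rewrite mul0r.
by rewrite mulrC -[X in X * _]powRr1 ?(ltW x0)// -powRD ?(gt_eqF x0) ?implybT// addrC subrK.
Qed.

Lemma continuous_ppow0 (b : R) : 0 < b -> {for 0, continuous (ppow b)}.
Proof.
move=> b0; apply/cvgrPdist_lt => e e0; rewrite ppow_le0//.
near=> z; rewrite sub0r normrN ger0_norm ?ppow_ge0//.
have [z0|z0] := ltP 0 z; last by rewrite ppow_le0.
rewrite ppowE//.
have -> : e = (e `^ (b^-1)) `^ b by rewrite -powRrM mulVf ?gt_eqF// powRr1// ltW.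
apply: gt0_ltr_powR => //; rewrite ?nnegrE ?(ltW z0) ?powR_ge0//.
near: z; apply: lt_nbhsl; exact: powR_gt0.
Unshelve. all: by end_near. Qed.

Lemma is_derive_ppow (a x : R) : (1 < a) || (x != 0) ->
  is_derive x 1 (ppow a) (a * ppow (a - 1) x).
Proof.
move=> h; have [x0|x0|x0] := ltgtP x 0.
- rewrite (ppow_le0 _ (ltW x0)) mulr0.
  apply: (@near_eq_is_derive _ _ _ (fun=> 0 : R)).
  near=> z; rewrite ppow_le0//; apply: ltW.
  by near: z; exact: lt_nbhsl.
- rewrite ppowE//; have D := @is_derive1_powR R a x x0.
  apply: near_eq_is_derive D.
  near=> z; rewrite ppowE//; near: z; exact: lt_nbhsr.
move: h; rewrite x0 eqxx orbF => a1.
rewrite (ppow_le0 _ (lexx 0)) mulr0.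
apply/is_derive1_caratheodory; exists (ppow (a - 1)); split.
- by move=> z; rewrite (ppow_le0 a (lexx 0)) !subr0 -ppow_mulr.
- by apply: continuous_ppow0; rewrite subr_gt0.
- by rewrite ppow_le0.
Unshelve. all: by end_near. Qed.

Fixpoint falling (g : R) (k : nat) : R :=
  if k is k'.+1 then falling g k' * (g - k'%:R) else 1.

(** The k-th derivative of [ppow g].  Towers of functions, each the derivative
    of the preceding one, are the outer functions of the compositions below. *)
Definition pow_tower (g : R) (k : nat) (x : R) : R := falling g k * ppow (g - k%:R) x.

Lemma is_derive_pow_tower g k (x : R) : (k.+1%:R < g) || (x != 0) ->
  is_derive x 1 (pow_tower g k) (pow_tower g k.+1 x).
Proof.
move=> h; rewrite /pow_tower /=.
have -> : falling g k * (g - k%:R) * ppow (g - k.+1%:R) x =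
    falling g k *: ((g - k%:R) * ppow (g - k%:R - 1) x).
  by rewrite /GRing.scale /= mulrA -natr1 opprD addrA.
apply: (@is_deriveZ _ _ _ (ppow (g - k%:R)) (falling g k)).
apply: is_derive_ppow; move: h; rewrite -natr1 => /orP[h|->]; last by rewrite orbT.
by rewrite ltrBrDl h.
Qed.

Lemma is_derive_continuous (f : R -> R) (x df : R) : is_derive x 1 f df ->
  {for x, continuous f}.
Proof. by case=> h _; apply: differentiable_continuous; exact/derivable1_diffP. Qed.

Lemma mean_value_bound (f df : R -> R) (a b B : R) : a <= b ->
  (forall x, a <= x <= b -> is_derive x 1 f (df x)) ->
  (forall x, a <= x <= b -> `|df x| <= B) ->
  `|f b - f a| <= B * (b - a).
Proof.
move=> ab fd dB.
have [| |c cab ->] := @MVT_segment R f df a b ab.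
- by move=> x; rewrite in_itv/= => /andP[ax xb]; apply: fd; rewrite !ltW.
- apply: continuous_in_subspaceT => x; rewrite inE/= in_itv/= => xab.
  exact: is_derive_continuous (fd _ xab).
by rewrite normrM (ger0_norm (_ : 0 <= b - a)) ?subr_ge0// ler_wpM2r ?subr_ge0// dB//; move: cab; rewrite in_itv.
Qed.

Fixpoint Dn (m : nat) (e : R) (f : R -> R) : R -> R :=
  if m is m'.+1 then Dn m' e (fun t => f (t + e) - f t) else f.

Fixpoint dbound (m : nat) (f : R -> R) (a b B : R) : Prop :=
  if m is m'.+1 then exists2 f' : R -> R,
    (forall x, a <= x <= b -> is_derive x 1 f (f' x)) & dbound m' f' a b B
  else forall x, a <= x <= b -> `|f x| <= B.

Lemma is_derive_shift_sub (f f' : R -> R) (e x : R) :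
  is_derive x 1 f (f' x) -> is_derive (x + e) 1 f (f' (x + e)) ->
  is_derive x 1 (fun t => f (t + e) - f t) (f' (x + e) - f' x).
Proof.
move=> h1 h2; apply: is_deriveB => //.
rewrite -[f' (x + e)]mulr1.
apply: (@is_derive1_comp _ f (fun t => t + e)) => //.
by rewrite -[1 in X in is_derive _ _ _ X]addr0; apply: is_deriveD.
Qed.

Lemma dbound_shift_sub m f a b B e : 0 <= e -> a <= b - e -> dbound m.+1 f a b B ->
  dbound m (fun t => f (t + e) - f t) a (b - e) (e * B).
Proof.
move=> e0 ab; elim: m f => [|m IH] f [f' ff' h]/=.
  move=> x /andP[ax xb].
  have -> : e * B = B * (x + e - x) by ring.
  apply: (@mean_value_bound f f'); first by rewrite lerDl.
    by move=> y /andP[xy ye]; apply: ff'; lra.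
  by move=> y /andP[xy ye]; apply: h; lra.
exists (fun t => f' (t + e) - f' t); last exact: IH.
by move=> x /andP[ax xb]; apply: is_derive_shift_sub; apply: ff'; lra.
Qed.

(** Each difference is a derivative times e, by the mean value theorem. *)
Lemma Dn_le m f a b B e t : 0 <= e -> dbound m f a b B -> a <= t ->
  t + m%:R * e <= b -> `|Dn m e f t| <= e ^+ m * B.
Proof.
move=> e0; elim: m f b B => [|m IH] f b B fB ta tb /=.
  by rewrite mul1r; apply: fB; rewrite ta; move: tb; rewrite mul0r addr0.
have tb' : t + m%:R * e <= b - e by move: tb; rewrite -natr1 mulrDl mul1r; lra.
have me : 0 <= m%:R * e by rewrite mulr_ge0.
rewrite exprSr -mulrA; apply: (IH _ (b - e)) => //.
by apply: dbound_shift_sub => //; lra.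
Qed.

Lemma Dn_crude m f B e t : (forall i, (i <= m)%N -> `|f (t + i%:R * e)| <= B) ->
  `|Dn m e f t| <= 2 ^+ m * B.
Proof.
elim: m f B => [|m IH] f B fB /=.
  by rewrite mul1r; have := fB 0%N (leqnn _); rewrite mul0r addr0.
rewrite exprSr -mulrA; apply: IH => i im.
apply: (le_trans (ler_normB _ _)).
have -> : 2 * B = B + B by ring.
apply: lerD; last first.
  by apply: fB; exact: leqW.
by have := fB i.+1 im; rewrite -natr1 mulrDl mul1r addrA.
Qed.

Lemma Dn_ext m f g e t : (forall i, (i <= m)%N -> f (t + i%:R * e) = g (t + i%:R * e)) ->
  Dn m e f t = Dn m e g t.
Proof.
elim: m f g => [|m IH] f g fg /=.
  by have := fg 0%N (leqnn _); rewrite mul0r addr0.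
apply: IH => i im; congr (_ - _); last by apply: fg; exact: leqW.
by have := fg i.+1 im; rewrite -natr1 mulrDl mul1r addrA.
Qed.

Lemma Dn_subc m f c e t : (0 < m)%N -> Dn m e (fun x => f x - c) t = Dn m e f t.
Proof.
case: m => // m _ /=; apply: Dn_ext => i _; ring.
Qed.

(** Differences in the variable commute with derivatives in a parameter. *)
Lemma Dn_param m (F F' : R -> R -> R) (e t s : R) :
  (forall x : R, is_derive s 1 (F ^~ x) (F' s x)) ->
  is_derive s 1 (fun r => Dn m e (F r) t) (Dn m e (F' s) t).
Proof.
elim: m F F' => [|m IH] F F' h /=; first exact: h.
apply: (IH (fun r x => F r (x + e) - F r x) (fun r x => F' r (x + e) - F' r x)).
Qed.

End powers.

(** * Symbols with power weights *)

Section symbols.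
Context (R : realType) (P : Type) (U : P -> R -> Prop) (rho : P -> R -> R) (rmax : R).
Hypothesis rho0 : forall q t, U q t -> 0 < rho q t.
Hypothesis rhom : forall q t, U q t -> rho q t <= rmax.

(** Order-a bounds relative to the distance [rho] to a singular set, uniform in
    the parameter q. *)
Definition bsym (a : R) (g : P -> R -> R) :=
  exists C, forall q t, U q t -> `|g q t| <= C * rho q t `^ a.

(** Symbols of order a and smoothness m: the k-th derivative in t is bounded
    by a multiple of rho^(a - k) for k <= m. *)
Fixpoint sym (m : nat) (a : R) (g : P -> R -> R) : Prop :=
  bsym a g /\
  if m is m'.+1 then exists2 g', (forall q t, U q t -> is_derive t 1 (g q) (g' q t)) &
    sym m' (a - 1) g' else True.

(** The value of u itself is left unbounded: a composition H (u) sees it only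
    through the bounds on H. *)
Definition dsym (m : nat) (b : R) (u : P -> R -> R) : Prop :=
  if m is m'.+1 then exists2 u', (forall q t, U q t -> is_derive t 1 (u q) (u' q t)) &
    sym m' (b - 1) u' else True.

Lemma bsymP a g : bsym a g -> exists2 C, 0 <= C &
  forall q t, U q t -> `|g q t| <= C * rho q t `^ a.
Proof.
move=> [C h]; exists `|C| => // q t /h /le_trans; apply.
by rewrite ler_wpM2r ?powR_ge0// ler_norm.
Qed.

Lemma powR_split (x u v : R) : 0 < x -> x `^ (u + v) = x `^ u * x `^ v.
Proof. by move=> x0; rewrite powRD// (gt_eqF x0) implybT. Qed.

Lemma bsym_le a b g : b <= a -> bsym a g -> bsym b g.
Proof.
move=> ba /bsymP [C C0 h]; exists (C * rmax `^ (a - b)) => q t Uqt.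
apply: (le_trans (h _ _ Uqt)); rewrite -mulrA ler_wpM2l//.
have -> : rho q t `^ a = rho q t `^ (a - b) * rho q t `^ b.
  by rewrite -powR_split ?rho0// subrK.
rewrite ler_wpM2r ?powR_ge0//.
apply: ge0_ler_powR; rewrite ?subr_ge0 ?nnegrE ?(ltW (rho0 Uqt)) ?rhom//.
by rewrite (le_trans (ltW (rho0 Uqt)))// rhom.
Qed.

Lemma bsymD a f g : bsym a f -> bsym a g -> bsym a (fun q t => f q t + g q t).
Proof.
move=> [C hC] [D hD]; exists (C + D) => q t Uqt.
by rewrite (le_trans (ler_normD _ _))// mulrDl lerD ?hC ?hD.
Qed.

Lemma bsymM a b f g : bsym a f -> bsym b g -> bsym (a + b) (fun q t => f q t * g q t).
Proof.
move=> /bsymP[C C0 hC] /bsymP[D D0 hD]; exists (C * D) => q t Uqt.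
by rewrite normrM powR_split ?rho0// mulrACA ler_pM ?hC ?hD.
Qed.

Lemma bsym_bound a g B : a <= 0 -> (forall q t, U q t -> `|g q t| <= B) -> bsym a g.
Proof.
move=> a0 gB; apply: (bsym_le a0); exists B => q t Uqt.
by rewrite powRr0 mulr1 gB.
Qed.

Lemma symB m a g : sym m a g -> bsym a g.
Proof. by case: m => [|m] []. Qed.

Lemma symW m a g : sym m.+1 a g -> sym m a g.
Proof.
elim: m a g => [|m IH] a g [ga [g' gd sg']]; first by split.
by split => //; exists g' => //; apply: IH.
Qed.

Lemma sym_dsym m a g : sym m a g -> dsym m a g.
Proof. by case: m => [|m] []. Qed.

Lemma dsymW m a g : dsym m.+1 a g -> dsym m a g.
Proof. by case: m => [//|m] [g' gd sg']; exists g' => //; exact: symW. Qed.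

Lemma sym_le m a b g : b <= a -> sym m a g -> sym m b g.
Proof.
elim: m a b g => [|m IH] a b g ba [ga h]; split => //; [exact: bsym_le ga|exact: bsym_le ga|].
move: h => [g' gd sg']; exists g' => //; apply: IH sg'; lra.
Qed.

(** Equality is asked on the whole line of each q that occurs, because the
    derivatives are those of the functions on the line. *)
Lemma sym_ext m a f g : (forall q t, U q t -> f q =1 g q) -> sym m a f -> sym m a g.
Proof.
move=> fg; have fg' q t (Uqt : U q t) : f q = g q by apply/funext; exact: fg Uqt.
case: m => [|m] [[C hC] h]; (split; first by exists C => q t Uqt; rewrite -(fg' _ _ Uqt) hC) => //.
by move: h => [g' gd sg']; exists g' => // q t Uqt; rewrite -(fg' _ _ Uqt); exact: gd.
Qed.

Lemma sym0 m a : sym m a (fun _ _ => 0).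
Proof.
elim: m a => [|m IH] a; split => //; try (by exists 0 => q t _; rewrite normr0 mul0r).
by exists (fun _ _ => 0) => // q t _; exact: is_derive_cst.
Qed.

Lemma sym_cst m a c : a <= 0 -> sym m a (fun _ _ => c).
Proof.
move=> a0; case: m => [|m]; (split; first exact: (@bsym_bound _ _ `|c|)) => //.
by exists (fun _ _ => 0); [move=> q t _; exact: is_derive_cst|exact: sym0].
Qed.

Lemma symD m a f g : sym m a f -> sym m a g -> sym m a (fun q t => f q t + g q t).
Proof.
elim: m a f g => [|m IH] a f g [fa hf] [ga hg]; (split; first exact: bsymD) => //.
move: hf hg => [f' df sf] [g' dg sg]; exists (fun q t => f' q t + g' q t); last exact: IH.
by move=> q t Uqt; apply: is_deriveD; [exact: df|exact: dg].
Qed.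

Lemma symM m a b f g : sym m a f -> sym m b g -> sym m (a + b) (fun q t => f q t * g q t).
Proof.
elim: m a b f g => [|m IH] a b f g sf sg; (split; first exact: bsymM (symB sf) (symB sg)) => //.
have sf0 := symW sf; have sg0 := symW sg.
move: sf sg => [fa [f' df sf]] [ga [g' dg sg]].
exists (fun q t => f q t * g' q t + g q t * f' q t).
  by move=> q t Uqt; apply: is_deriveM; [exact: df|exact: dg].
apply: symD.
  by rewrite -addrA; exact: IH.
by rewrite (addrC a) -addrA; exact: IH.
Qed.

Lemma symM0l m a f g : sym m 0 f -> sym m a g -> sym m a (fun q t => f q t * g q t).
Proof. by move=> sf sg; rewrite -[a]add0r; exact: symM. Qed.

Lemma symM0r m a f g : sym m a f -> sym m 0 g -> sym m a (fun q t => f q t * g q t).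
Proof. by move=> sf sg; rewrite -[a]addr0; exact: symM. Qed.

Lemma symZ m a c g : sym m a g -> sym m a (fun q t => c * g q t).
Proof. by move=> sg; apply: symM0l => //; exact: sym_cst. Qed.

Lemma symN m a g : sym m a g -> sym m a (fun q t => - g q t).
Proof.
move=> sg; apply: (@sym_ext _ _ (fun q t => -1 * g q t)); last exact: symZ.
by move=> q t _ x; rewrite mulN1r.
Qed.

Lemma symBB m a f g : sym m a f -> sym m a g -> sym m a (fun q t => f q t - g q t).
Proof. by move=> sf sg; apply: symD => //; exact: symN. Qed.

Lemma symX m a g k : sym m 0 g -> a <= 0 -> sym m a (fun q t => g q t ^+ k).
Proof.
move=> sg a0; apply: (@sym_le _ 0) => //.
elim: k => [|k IH]; first exact: sym_cst.
apply: (@sym_ext _ _ (fun q t => g q t * g q t ^+ k)); last exact: symM0l.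
by move=> q t _ x; rewrite exprS.
Qed.

Lemma dsym_cstD m b c u : dsym m b u -> dsym m b (fun q t => c + u q t).
Proof.
case: m => // m [u' du su]; exists u' => // q t Uqt.
by rewrite -[u' q t]add0r; apply: is_deriveD; exact: du.
Qed.

(** The chain rule: every derivative of H costs b orders, and u' restores
    b - 1 of them. *)
Lemma sym_comp m a b (H : nat -> R -> R) (u : P -> R -> R) : dsym m b u ->
  (forall k, (k <= m)%N -> bsym (a - k%:R * b) (fun q t => H k (u q t))) ->
  (forall k q t, (k < m)%N -> U q t -> is_derive (u q t) 1 (H k) (H k.+1 (u q t))) ->
  sym m a (fun q t => H 0 (u q t)).
Proof.
elim: m a H => [|m IH] a H du hH dH.
  by split => //; have := hH 0 (leqnn _); rewrite mul0r subr0.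
split; first by have := hH 0 (leq0n _); rewrite mul0r subr0.
have du' := dsymW du.
case: du => u' uu' su'.
exists (fun q t => H 1 (u q t) * u' q t).
  by move=> q t Uqt; apply: is_derive1_comp; [exact: dH|exact: uu'].
rewrite (_ : a - 1 = a - b + (b - 1)); last by ring.
apply: symM => //.
apply: (IH (a - b) (fun k => H k.+1)) => //.
  move=> k km; have := hH k.+1 km; congr bsym; rewrite -natr1; ring.
by move=> k q t km Uqt; exact: dH.
Qed.

Lemma sym_comp0 m a (H : nat -> R -> R) (u : P -> R -> R) B : sym m 0 u -> a <= 0 ->
  (forall k q t, (k <= m)%N -> U q t -> `|H k (u q t)| <= B) ->
  (forall k q t, (k < m)%N -> U q t -> is_derive (u q t) 1 (H k) (H k.+1 (u q t))) ->
  sym m a (fun q t => H 0 (u q t)).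
Proof.
move=> su a0 hB hH; apply: (sym_le a0); apply: (@sym_comp _ 0 0) => //.
  exact: sym_dsym.
move=> k km; rewrite mulr0 subr0; apply: (@bsym_bound _ _ B) => //.
by move=> q t Uqt; exact: hB.
Qed.

Lemma pow_tower0 (g x : R) : pow_tower g 0 x = ppow g x.
Proof. by rewrite /pow_tower subr0 mul1r. Qed.

(** Away from 0 all derivatives of a power are bounded. *)
Lemma pow_tower_bound (g c b : R) (m : nat) : 0 < c -> c <= b ->
  exists2 B, 0 <= B & forall k x, (k <= m)%N -> c <= x <= b -> `|pow_tower g k x| <= B.
Proof.
move=> c0 cb.
exists (\sum_(k < m.+1) `|falling g k| * (b `^ (g - k%:R) + c `^ (g - k%:R))).
  by apply: sumr_ge0 => k _; rewrite mulr_ge0 ?addr_ge0 ?powR_ge0.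
move=> k x km /andP[cx xb]; have x0 := lt_le_trans c0 cx.
rewrite (bigD1 (Ordinal (km : (k < m.+1)%N)))//=; apply: ler_wpDr.
  by apply: sumr_ge0 => i _; rewrite mulr_ge0 ?addr_ge0 ?powR_ge0.
rewrite /pow_tower normrM ler_wpM2l// ger0_norm ?ppow_ge0// ppowE//.
have [e0|e0] := leP 0 (g - k%:R).
  apply: ler_wpDr; first exact: powR_ge0.
  by apply: ge0_ler_powR; rewrite ?nnegrE ?(ltW x0)// (le_trans (ltW x0)).
apply: ler_wpDl; first exact: powR_ge0.
rewrite -[g - k%:R]opprK !(powRN _ (- (g - k%:R))) lef_pV2 ?posrE ?powR_gt0//.
apply: ge0_ler_powR; rewrite ?nnegrE ?(ltW x0) ?(ltW c0) ?oppr_ge0 ?(ltW e0)//.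
Qed.

Lemma sym_pow m a g c u : a <= 0 -> 0 < c -> sym m 0 u ->
  (forall q t, U q t -> c <= u q t) -> sym m a (fun q t => ppow g (u q t)).
Proof.
move=> a0 c0 su uc.
have /bsymP[b b0 ub] := symB su.
have [|B B0 hB] := @pow_tower_bound g c (b + c) m c0; first by rewrite lerDr.
have ucb q t : U q t -> c <= u q t <= b + c.
  move=> Uqt; rewrite uc//=; apply: (le_trans (ler_norm _)).
  by apply: (le_trans (ub _ _ Uqt)); rewrite powRr0 mulr1 lerDl ltW.
apply: (@sym_ext _ _ (fun q t => pow_tower g 0 (u q t))).
  by move=> q t _ x; rewrite pow_tower0.
apply: (@sym_comp0 _ _ (pow_tower g) u B) => //.
  by move=> k q t km Uqt; apply: hB => //; exact: ucb.
move=> k q t km Uqt; apply: is_derive_pow_tower.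
by rewrite (gt_eqF (lt_le_trans c0 (uc _ _ Uqt))) orbT.
Qed.

End symbols.

Section cutoffs.
Context (R : realType).

(** A step from 1 (for v <= a) to 0 (for v >= b) of finite smoothness M, built
    from truncated powers so that it stays inside the calculus of symbols. *)
Definition cut (M a b v : R) : R := ppow M (b - v) / (ppow M (b - v) + ppow M (v - a)).

Lemma cut_den_ge (M a b v : R) : 0 <= M -> a < b ->
  ((b - a) / 2) `^ M <= ppow M (b - v) + ppow M (v - a).
Proof.
move=> M0 ab; have h0 : 0 < (b - a) / 2 by lra.
have [h|h] := leP ((b - a) / 2) (b - v).
  apply: ler_wpDr; first exact: ppow_ge0.
  rewrite ppowE; last by lra.
  by apply: ge0_ler_powR; rewrite ?nnegrE//; lra.
apply: ler_wpDl; first exact: ppow_ge0.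
rewrite ppowE; last by lra.
by apply: ge0_ler_powR; rewrite ?nnegrE//; lra.
Qed.

Lemma cut_den_gt0 (M a b v : R) : 0 <= M -> a < b ->
  0 < ppow M (b - v) + ppow M (v - a).
Proof.
move=> M0 ab; apply: lt_le_trans (cut_den_ge v M0 ab); apply: powR_gt0; lra.
Qed.

Lemma cut1 (M a b v : R) : 0 <= M -> a < b -> v <= a -> cut M a b v = 1.
Proof.
move=> M0 ab va; have := cut_den_gt0 v M0 ab; rewrite /cut (@ppow_le0 _ M (v - a)); last by lra.
by rewrite addr0 => h; rewrite divff// gt_eqF.
Qed.

Lemma cut0 (M a b v : R) : b <= v -> cut M a b v = 0.
Proof. by move=> bv; rewrite /cut ppow_le0 ?mul0r//; lra. Qed.

Lemma cut_itv (M a b v : R) : 0 <= M -> a < b -> 0 <= cut M a b v <= 1.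
Proof.
move=> M0 ab; have h := cut_den_gt0 v M0 ab.
rewrite /cut divr_ge0 ?ppow_ge0 ?(ltW h)//= ler_pdivrMr// mul1r lerDl.
exact: ppow_ge0.
Qed.

Lemma one_sub_cut (M a b v : R) : 0 <= M -> a < b ->
  1 - cut M a b v = ppow M (v - a) * (ppow M (b - v) + ppow M (v - a))^-1.
Proof.
move=> M0 ab; have h := cut_den_gt0 v M0 ab.
by rewrite /cut; field; rewrite gt_eqF.
Qed.

End cutoffs.

Section cutoff_symbols.
Context (R : realType) (P : Type) (U : P -> R -> Prop) (rho : P -> R -> R) (rmax : R).
Hypothesis rho0 : forall q t, U q t -> 0 < rho q t.
Hypothesis rhom : forall q t, U q t -> rho q t <= rmax.
Local Notation sym := (@sym R P U rho).
Local Notation bsym := (@bsym R P U rho).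
Local Notation dsym := (@dsym R P U rho).

Lemma sym_cst0 m c : sym m 0 (fun _ _ => c).
Proof. by apply: (sym_cst rho0 rhom); exact: lexx. Qed.

(** If g lives where rho is bounded below, powers of rho of every exponent are
    comparable to constants on its support. *)
Lemma bsym_gap a g B r0 : 0 < r0 -> (forall q t, U q t -> `|g q t| <= B) ->
  (forall q t, U q t -> g q t != 0 -> r0 <= rho q t) -> bsym a g.
Proof.
move=> r00 gB gap; have [a0|a0] := leP a 0; first exact: (bsym_bound rho0 rhom a0 gB).
exists (B / r0 `^ a) => q t Uqt.
have B0 : 0 <= B := le_trans (normr_ge0 _) (gB _ _ Uqt).
have [->|g0] := eqVneq (g q t) 0.
  by rewrite normr0 mulr_ge0 ?divr_ge0 ?powR_ge0.
rewrite mulrAC ler_pdivlMr ?powR_gt0//; apply: ler_pM; rewrite ?powR_ge0 ?gB//.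
by apply: ge0_ler_powR; rewrite ?nnegrE ?(ltW a0) ?(ltW r00) ?(ltW (rho0 Uqt)) ?gap.
Qed.

Lemma sym_ppow m a M u r0 : 0 < r0 -> m.+1%:R < M -> sym m 0 u ->
  (forall q t, U q t -> 0 < u q t -> r0 <= rho q t) \/ a <= 0 ->
  sym m a (fun q t => ppow M (u q t)).
Proof.
move=> r00 mM su gap.
have M0 : 0 < M by apply: lt_trans mM; rewrite ltr0n.
have /bsymP[b b0 ub] := symB su.
apply: (@sym_ext _ _ _ _ _ _ (fun q t => pow_tower M 0 (u q t))).
  by move=> q t _ x; rewrite pow_tower0.
have kM k : (k <= m)%N -> 0 < M - k%:R.
  move=> km; rewrite subr_gt0; apply: le_lt_trans mM; rewrite ler_nat; exact: leqW.
apply: (@sym_comp _ _ _ _ rho0 _ _ 0 (pow_tower M) u); first exact: sym_dsym.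
  move=> k km; rewrite mulr0 subr0.
  have B1 q t : U q t -> `|pow_tower M k (u q t)| <= `|falling M k| * b `^ (M - k%:R).
    move=> Uqt; rewrite /pow_tower normrM ler_wpM2l// ger0_norm ?ppow_ge0//.
    rewrite /ppow; case: ifP => u0; last exact: powR_ge0.
    apply: ge0_ler_powR; rewrite ?nnegrE ?(ltW (kM _ km)) ?(ltW u0)//.
    by apply: (le_trans (ler_norm _)); rewrite (le_trans (ub _ _ Uqt))// powRr0 mulr1.
  case: gap => [gap|a0]; last exact: (bsym_bound rho0 rhom a0 B1).
  apply: (bsym_gap _ r00 B1) => q t Uqt; rewrite /pow_tower mulf_eq0 negb_or => /andP[_].
  by rewrite /ppow; case: ifP => [u0 _|_]; [exact: gap|rewrite eqxx].
move=> k q t km Uqt; apply: is_derive_pow_tower.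
by rewrite (le_lt_trans _ mM)// ler_nat ltnS ltnW.
Qed.

Lemma sym_cut_den m M a b v : m.+1%:R < M -> a < b -> sym m 0 v ->
  sym m 0 (fun q t => (ppow M (b - v q t) + ppow M (v q t - a))^-1).
Proof.
move=> mM ab sv.
have M0 : 0 <= M by apply/ltW; apply: lt_trans mM; rewrite ltr0n.
apply: (@sym_ext _ _ _ _ _ _ (fun q t => ppow (-1) (ppow M (b - v q t) + ppow M (v q t - a)))).
  move=> q t _ x; rewrite ppowE ?powR_inv1 ?(ltW (cut_den_gt0 _ _ _))//.
  exact: cut_den_gt0.
apply: (@sym_pow _ _ _ _ _ rho0 rhom _ _ _ (((b - a) / 2) `^ M)) => //.
- by apply: powR_gt0; lra.
- apply: symD; apply: (@sym_ppow _ _ _ _ 1) => //; try (by right).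
    by apply: (symBB rho0 rhom) => //; exact: sym_cst0.
  by apply: (symBB rho0 rhom) => //; exact: sym_cst0.
- by move=> q t _; exact: cut_den_ge.
Qed.

Lemma sym_cut m M a b v : m.+1%:R < M -> a < b -> sym m 0 v ->
  sym m 0 (fun q t => cut M a b (v q t)).
Proof.
move=> mM ab sv; apply: (symM0l rho0); last exact: sym_cut_den.
apply: (@sym_ppow _ _ _ _ 1) => //; last by right.
by apply: (symBB rho0 rhom) => //; exact: sym_cst0.
Qed.

Lemma sym_one_sub_cut m M a b v k r0 : m.+1%:R < M -> a < b -> sym m 0 v -> 0 < r0 ->
  (forall q t, U q t -> a < v q t -> r0 <= rho q t) ->
  sym m k (fun q t => cut M a b (v q t) - 1).
Proof.
move=> mM ab sv r00 gap.
have M0 : 0 <= M by apply/ltW; apply: lt_trans mM; rewrite ltr0n.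
apply: (@sym_ext _ _ _ _ _ _ (fun q t => - (ppow M (v q t - a) *
   (ppow M (b - v q t) + ppow M (v q t - a))^-1))).
  by move=> q t _ x; rewrite -one_sub_cut// opprB.
apply: (symN rho0 rhom); apply: (symM0r rho0); last exact: sym_cut_den.
apply: (@sym_ppow _ _ _ _ r0) => //.
  by apply: (symBB rho0 rhom) => //; exact: sym_cst0.
by left => q t Uqt; rewrite subr_gt0; exact: gap.
Qed.

Lemma symZq m a (sg : P -> R) g : (forall q t, U q t -> `|sg q| <= 1) ->
  sym m a g -> sym m a (fun q t => sg q * g q t).
Proof.
move=> s1; elim: m a g => [|m IH] a g [/bsymP[C C0 gC] h].
  split => //; exists C => q t Uqt; rewrite normrM -[leRHS]mul1r ler_pM ?gC//; exact: s1 Uqt.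
split.
  exists C => q t Uqt; rewrite normrM -[leRHS]mul1r ler_pM ?gC//; exact: s1 Uqt.
case: h => g' gd sg'; exists (fun q t => sg q * g' q t); last exact: IH.
by move=> q t Uqt; apply: (@is_deriveZ _ _ _ (g q) (sg q)); exact: gd.
Qed.

(** The gain from order 0 to order k comes from the mean value theorem at
    y = 0; the derivatives are those of a power on the interval [1 - th, 1],
    where it is smooth.  The parameter sg in [0, 1] serves
    [difb_quot]. *)
Lemma sym_pow_near1 m k g th (sg : P -> R) (y : P -> R -> R) : 0 <= k ->
  (forall q t, U q t -> 0 <= sg q <= 1) ->
  (forall q t, U q t -> 0 <= y q t <= th) -> th < 1 -> sym m k y ->
  sym m k (fun q t => ppow g (1 - sg q * y q t) - 1).
Proof.
move=> k0 s01 y01 th1 sy.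
pose H (i : nat) (x : R) := if i is 0%N then ppow g x - 1 else pow_tower g i x.
have c0 : 0 < Num.min (1 - th) 1 by rewrite lt_min subr_gt0 th1 ltr01.
have [|B B0 hB] := @pow_tower_bound R g _ 1 m.+1 c0; first by rewrite ge_min lexx orbT.
have xb q t : U q t -> Num.min (1 - th) 1 <= 1 - sg q * y q t <= 1.
  move=> Uqt; have /andP[s0 s1] := s01 _ _ Uqt; have /andP[y0 y1] := y01 _ _ Uqt.
  rewrite lerBlDr lerDl mulr_ge0// andbT ge_min lerD2l lerN2.
  by rewrite (le_trans _ y1)// ler_piMl.
have sN : sym m k (fun q t => - (sg q * y q t)).
  apply: (symN rho0 rhom); apply: symZq => // q t Uqt.
  by have /andP[h1 h2] := s01 _ _ Uqt; rewrite ger0_norm.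
have D : dsym m k (fun q t => 1 + - (sg q * y q t)) by apply: dsym_cstD; exact: sym_dsym.
have /bsymP[Y Y0 yY] := symB sy.
apply: (@sym_comp _ _ _ _ rho0 _ _ k H _ D).
  case=> [_|i im].
    rewrite mul0r subr0 /=; exists (B * Y) => q t Uqt.
    have /andP[x1 x2] := xb _ _ Uqt.
    have -> : ppow g (1 - sg q * y q t) - 1 = - (ppow g 1 - ppow g (1 - sg q * y q t)).
      by rewrite [ppow g 1]ppowE// powR1 opprB.
    rewrite normrN -mulrA.
    apply: (@le_trans _ _ (B * (1 - (1 - sg q * y q t)))).
      apply: (@mean_value_bound _ (ppow g) (pow_tower g 1)) => //.
        move=> x /andP[xx _]; have x0 : 0 < x by exact: lt_le_trans (lt_le_trans c0 x1) xx.
        apply: (near_eq_is_derive _ (@is_derive_pow_tower _ g 0 x _)).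
          by near=> z; rewrite pow_tower0.
        by rewrite (gt_eqF x0) orbT.
      by move=> x /andP[xx x1']; apply: hB => //; rewrite (le_trans x1 xx).
    rewrite ler_wpM2l// opprB addrCA subrr addr0.
    have /andP[s0 s1] := s01 _ _ Uqt; have /andP[y0 y1] := y01 _ _ Uqt.
    apply: le_trans (yY _ _ Uqt); apply: le_trans (ler_norm _).
    by rewrite ler_piMl.
  apply: (@bsym_bound _ _ _ _ _ rho0 rhom _ _ B).
    by rewrite subr_le0 ler_peMl// ler1n.
  by move=> q t Uqt; apply: hB; [exact: leqW|exact: xb].
move=> [|i] q t im Uqt; have /andP[x1 _] := xb _ _ Uqt.
  have x0 : 0 < 1 - sg q * y q t by exact: lt_le_trans x1.
  rewrite [H _ _]/= -[pow_tower g 1 _]subr0; apply: is_deriveB.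
  apply: (near_eq_is_derive _ (@is_derive_pow_tower _ g 0 _ _)).
    by near=> z; rewrite pow_tower0.
  by rewrite (gt_eqF x0) orbT.
apply: is_derive_pow_tower.
by rewrite (gt_eqF (lt_le_trans c0 x1)) orbT.
Unshelve. all: by end_near. Qed.

End cutoff_symbols.

(** * Differences near a singular set *)

Section singular_differences.
Context (R : realType).
Local Notation P := (R * R)%type.

(** The squared radius along a line parallel to an axis: t is the running
    coordinate and q.1 the contribution of the others.  The component q.2 is
    an additional parameter in [0, 1]. *)
Definition rad2 (q : P) (t : R) : R := q.1 + t ^+ 2.

Definition okpar (q : P) : Prop := 0 <= q.1 /\ 0 <= q.2 <= 1.

Definition dom (q : P) (t : R) : Prop := okpar q /\ rad2 q t < 16.

Definition pos_on (rho : P -> R -> R) (q : P) (t : R) : Prop := dom q t /\ 0 < rho q t.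

Lemma rad2_shift (q : P) (t e : R) : okpar q -> rad2 q t < 9 -> 0 <= e -> e <= 1 ->
  dom q (t + e).
Proof.
move=> okq v9 e0 e1; split=> //; rewrite /rad2 in v9 *; case: okq => q0 _.
have t3 : t < 3 by rewrite ltNge; apply/negP => h; nra.
have te : t * e <= 3 by nra.
have e2 : e ^+ 2 <= 1 by nra.
rewrite sqrrD; lra.
Qed.

Lemma sym_dbound (U : P -> R -> Prop) rho m a g : sym U rho m a g -> a <= m%:R ->
  exists2 C, 0 <= C & forall q x0 x1 r0, 0 < r0 ->
    (forall x, x0 <= x <= x1 -> U q x /\ r0 <= rho q x) ->
    dbound m (g q) x0 x1 (C * r0 `^ (a - m%:R)).
Proof.
elim: m a g => [|m IH] a g [/bsymP[C C0 gC] h] am.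
  exists C => // q x0 x1 r0 r00 hx x xx; have [Uqx rx] := hx x xx.
  apply: (le_trans (gC _ _ Uqx)); rewrite ler_wpM2l// subr0.
  rewrite -(opprK a) !(powRN _ (- a)) lef_pV2 ?posrE ?powR_gt0//; last exact: lt_le_trans rx.
  apply: ge0_ler_powR; rewrite ?nnegrE ?oppr_ge0 ?(ltW r00)//.
  exact: le_trans (ltW r00) rx.
case: h => g' gd sg'; have [|C' C'0 H] := IH _ _ sg'; first by move: am; rewrite -natr1; lra.
exists C' => // q x0 x1 r0 r00 hx; exists (g' q).
  by move=> x xx; apply: gd; have [] := hx x xx.
have := H q x0 x1 r0 r00 hx; congr dbound; congr (_ * _ `^ _); rewrite -natr1; ring.
Qed.

Variables (rho : P -> R -> R) (m : nat).
Hypothesis rho_ge0 : forall q t, dom q t -> 0 <= rho q t.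
Hypothesis rho_lip : forall q t t', dom q t -> dom q t' ->
  `|rho q t' - rho q t| <= `|t' - t|.
Hypothesis m0 : (0 < m)%N.

(** If the nodes are within a multiple of e of the singular set, g - c0 is of
    size e^k at each of them.  Otherwise rho is comparable to rho (t) between
    the nodes, and m derivatives give e^m rho^(k - m) <= e^s rho^(k - s). *)
Lemma singular_diff (k s c0 : R) (g : P -> R -> R) : 0 <= k -> k <= s -> s <= m%:R ->
  sym (pos_on rho) rho m k (fun q t => g q t - c0) ->
  (forall q t, dom q t -> rho q t = 0 -> g q t = c0) ->
  exists2 C, 0 <= C & forall q t e, okpar q -> rad2 q t < 9 -> 0 < e ->
    m%:R * e <= 1 ->
    `|Dn m e (g q) t| <= C * (e `^ s * Num.max (rho q t) e `^ (k - s)).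
Proof.
move=> k0 ks sm sg gz.
have [|C1 C10 h1] := sym_dbound sg; first exact: le_trans sm.
have /bsymP[C2 C20 h2] := symB sg.
have h2' q t : dom q t -> `|g q t - c0| <= C2 * rho q t `^ k.
  move=> D; have := rho_ge0 D; rewrite le_eqVlt => /orP[/eqP r0|r0]; last exact: h2.
  by rewrite gz// subrr normr0 mulr_ge0 ?powR_ge0.
pose mr : R := m%:R.
have mr1 : 1 <= mr by rewrite ler1n.
have mr0 : 0 < mr by lra.
(* A serves the nodes near the singular set, B those far from it *)
pose A := 2 ^+ m * (C2 * (3 * mr) `^ k) * (2 * mr) `^ (s - k).
pose B := C1 * 2 `^ (mr - k).
have A0 : 0 <= A by rewrite !mulr_ge0 ?powR_ge0 ?exprn_ge0.
have B0 : 0 <= B by rewrite mulr_ge0 ?powR_ge0.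
exists (A + B); first exact: addr_ge0.
move=> q t e okq v9 e0 me.
have nodes x : t <= x <= t + mr * e -> dom q x.
  move=> /andP[x1 x2]; have -> : x = t + (x - t) by ring.
  by apply: rad2_shift => //; rewrite -/mr in me; lra.
have dt : dom q t by apply: nodes; rewrite lexx/= lerDl mulr_ge0// ltW.
have rl x : t <= x <= t + mr * e -> `|rho q x - rho q t| <= mr * e.
  move=> xx; apply: (le_trans (rho_lip dt (nodes _ xx))).
  by move: xx => /andP[x1 x2]; rewrite ger0_norm; lra.
have Y0 : 0 <= e `^ s * Num.max (rho q t) e `^ (k - s) by rewrite mulr_ge0 ?powR_ge0.
have me0 : 0 < mr * e by rewrite mulr_gt0.
have [near|far] := leP (rho q t) (2 * (mr * e)).
  suff H : `|Dn m e (g q) t| <= A * (e `^ s * Num.max (rho q t) e `^ (k - s)).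
    by apply: (le_trans H); rewrite ler_wpM2r// lerDl.
  rewrite -(Dn_subc (g q) c0)//.
  apply: (@le_trans _ _ (2 ^+ m * (C2 * (3 * (mr * e)) `^ k))).
    apply: Dn_crude => i im.
    have xx : t <= t + i%:R * e <= t + mr * e.
      by rewrite lerDl mulr_ge0 ?(ltW e0)//= lerD2l ler_wpM2r ?(ltW e0)// ler_nat.
    apply: (le_trans (h2' _ _ (nodes _ xx))); rewrite ler_wpM2l//.
    have := rl _ xx; rewrite ler_norml => /andP[_ rr].
    apply: ge0_ler_powR; rewrite ?nnegrE ?rho_ge0//; [exact: nodes| |]; lra.
  have mx0 : 0 < Num.max (rho q t) e by rewrite lt_max e0 orbT.
  have mx : Num.max (rho q t) e <= (2 * mr) * e.
    by rewrite ge_max -mulrA near/= mulrA ler_peMl ?(ltW e0)//; lra.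
  have E1 : (2 * mr * e) `^ (k - s) <= Num.max (rho q t) e `^ (k - s).
    have m2 : 0 < 2 * mr * e by rewrite -mulrA mulr_gt0.
    rewrite -(opprB s) !powRN lef_pV2 ?posrE ?powR_gt0//.
    by apply: ge0_ler_powR; rewrite ?nnegrE ?subr_ge0 ?(ltW mx0) ?(ltW m2).
  apply: (@le_trans _ _ (A * (e `^ s * (2 * mr * e) `^ (k - s)))); last first.
    by rewrite ler_wpM2l// ler_wpM2l ?powR_ge0.
  have mr2 : 0 < 2 * mr by lra.
  have -> : (3 * (mr * e)) `^ k = (3 * mr) `^ k * e `^ k.
    by rewrite mulrA powRM ?(ltW e0) ?mulr_ge0 ?(ltW mr0).
  have -> : (2 * mr * e) `^ (k - s) = (2 * mr) `^ (k - s) * e `^ (k - s).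
    by rewrite powRM ?(ltW e0) ?mulr_ge0 ?(ltW mr0).
  have -> : e `^ k = e `^ s * e `^ (k - s) by rewrite -powR_split//; congr (_ `^ _); ring.
  have c : (2 * mr) `^ (s - k) * (2 * mr) `^ (k - s) = 1.
    by rewrite -powR_split// (_ : s - k + (k - s) = 0) ?powRr0//; ring.
  rewrite le_eqVlt; apply/orP; left; apply/eqP; rewrite /A -[LHS]mul1r -[X in X * _ = _]c; ring.
suff HB : `|Dn m e (g q) t| <= B * (e `^ s * Num.max (rho q t) e `^ (k - s)).
  by apply: (le_trans HB); rewrite ler_wpM2r// lerDr.
have r0 : 0 < rho q t by lra.
have er : e <= rho q t.
  by apply: le_trans (ltW far); rewrite mulrA ler_peMl ?(ltW e0)//; lra.
rewrite (max_idPl er).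
have r2 : 0 < rho q t / 2 by lra.
have Hx x : t <= x <= t + mr * e -> pos_on rho q x /\ rho q t / 2 <= rho q x.
  move=> xx; have := rl _ xx; rewrite ler_norml => /andP[rr _].
  split; last lra.
  split; [exact: nodes|lra].
have H := h1 q t (t + mr * e) _ r2 Hx.
have := Dn_le (ltW e0) H (lexx t) (lexx _); rewrite Dn_subc// => /le_trans; apply.
have -> : (rho q t / 2) `^ (k - mr) = 2 `^ (mr - k) * rho q t `^ (k - mr).
  rewrite powRM ?(ltW r0)//.
  rewrite mulrC -powR_inv1// -powRrM; congr (_ `^ _ * _); ring.
have -> : e ^+ m = e `^ s * e `^ (mr - s).
  by rewrite -powR_mulrn ?(ltW e0)// -powR_split//; congr (_ `^ _); rewrite /mr; ring.
have -> : rho q t `^ (k - s) = rho q t `^ (k - mr) * rho q t `^ (mr - s).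
  by rewrite -powR_split//; congr (_ `^ _); ring.
rewrite /B.
have E2 : e `^ (mr - s) <= rho q t `^ (mr - s).
  by apply: ge0_ler_powR; rewrite ?nnegrE ?subr_ge0 ?(ltW e0) ?(ltW r0).
rewrite [leLHS](_ : _ = C1 * 2 `^ (mr - k) * (e `^ s * (rho q t `^ (k - mr) * e `^ (mr - s)))); last by ring.
by rewrite ler_wpM2l// ler_wpM2l ?powR_ge0// ler_wpM2l ?powR_ge0.
Qed.

End singular_differences.

Section quotient_trick.
Context (R : realType).

(** (1 - (1 - s y)^g) / y, with its limit g s at y = 0. *)
Definition quot (g s y : R) : R := if y == 0 then g * s else (1 - ppow g (1 - s * y)) / y.

Lemma is_derive_quot (g s y : R) : 0 < 1 - s * y ->
  is_derive s 1 (fun r => quot g r y) (g * ppow (g - 1) (1 - s * y)).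
Proof.
move=> h; rewrite /quot; have [y0|y0] := eqVneq y 0.
  rewrite y0 mulr0 subr0 ppowE// powR1.
  exact: (@is_deriveZ _ _ _ id g).
have D1 : is_derive s 1 (fun r : R => 1 - r * y) (0 - y).
  apply: is_deriveB.
  rewrite -[y in X in is_derive _ _ _ X]mulr1 (_ : (fun r : R => r * y) = (fun r => y * r)).
    exact: (@is_deriveZ _ _ _ id y).
  by apply/funext => r; rewrite mulrC.
have D2 : is_derive (1 - s * y) 1 (ppow g) (g * ppow (g - 1) (1 - s * y)).
  by apply: is_derive_ppow; rewrite (gt_eqF h) orbT.
have D3 := @is_derive1_comp _ (ppow g) (fun r => 1 - r * y) s _ _ D2 D1.
have D4 : is_derive s 1 (fun r : R => 1 - ppow g (1 - r * y))
    (0 - g * ppow (g - 1) (1 - s * y) * (0 - y)).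
  by apply: is_deriveB; exact: D3.
have D5 := @is_deriveZ _ _ _ _ y^-1 s 1 _ D4.
rewrite (_ : (fun r : R => _) = (y^-1 \*: (fun r : R => 1 - ppow g (1 - r * y)))); last first.
  by apply/funext => r; rewrite /= mulrC.
apply: is_derive_eq; rewrite /GRing.scale /=; field; exact: y0.
Qed.

(** The division by y is avoided: the difference of [quot g s y] vanishes for
    s = 0, and its derivative in s is the difference of g (1 - s y)^(g - 1),
    without denominator. *)
Lemma Dn_quot m (e t B g : R) (chi0 y : R -> R) : (0 <= B) ->
  (forall x, 0 <= y x < 1) ->
  (forall s, 0 <= s <= 1 ->
     `|Dn m e (fun x => chi0 x * ppow (g - 1) (1 - s * y x)) t| <= B) ->
  `|Dn m e (fun x => chi0 x * quot g 1 (y x)) t| <= `|g| * B.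
Proof.
move=> B0 y01 h.
have pos s x : 0 <= s <= 1 -> 0 < 1 - s * y x.
  by move=> /andP[s0 s1]; have /andP[y0 y1] := y01 x; nra.
pose F s x := chi0 x * quot g s (y x).
pose F' s x := chi0 x * (g * ppow (g - 1) (1 - s * y x)).
have := @mean_value_bound _ (fun s => Dn m e (F s) t) (fun s => Dn m e (F' s) t) 0 1 (`|g| * B) ler01.
have F0 : Dn m e (F 0) t = 0.
  have -> : F 0 = (fun _ => 0).
    apply/funext => x; rewrite /F /quot mul0r subr0 ppowE// powR1 subrr mul0r mulr0.
    by case: ifP; rewrite mulr0.
  by elim: (m) => //= k IH; rewrite subrr.
rewrite F0 !subr0 mulr1; apply.
  move=> s s01; apply: Dn_param => x; rewrite /F /F'.
  by apply: (@is_deriveZ _ _ _ _ (chi0 x)); apply: is_derive_quot; exact: pos.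
move=> s s01.
have -> : Dn m e (F' s) t = g * Dn m e (fun x => chi0 x * ppow (g - 1) (1 - s * y x)) t.
  rewrite /F'; move: (chi0) => c.
  rewrite -[X in g * Dn _ _ X _]/(fun x => c x * ppow (g - 1) (1 - s * y x)).
  have DZ (k : nat) (f : R -> R) : Dn k e (fun x => g * f x) t = g * Dn k e f t.
    elim: k f => //= k IH f; rewrite -IH; apply: Dn_ext => i _; ring.
  by rewrite -DZ; apply: Dn_ext => i _; ring.
by rewrite normrM ler_wpM2l// h.
Qed.

End quotient_trick.

(** * Distances to the origin and to the unit sphere *)

Section basic_symbols.
Context (R : realType).
Local Notation P := (R * R)%type.

Definition rho_one (q : P) (t : R) : R := 1.
Definition rho_org (q : P) (t : R) : R := Num.sqrt (rad2 q t).
(** The factor 1/16 makes this distance 1-Lipschitz in t where r < 4. *)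
Definition rho_sph (q : P) (t : R) : R := `|1 - rad2 q t| / 16.

Lemma sym_tcst (U : P -> R -> Prop) rho m a c : bsym U rho a (fun q _ => c q) ->
  sym U rho m a (fun q _ => c q).
Proof.
move=> bc; case: m => [|m]; split => //.
by exists (fun _ _ => 0); [move=> q t _; exact: is_derive_cst|exact: sym0].
Qed.

Lemma rad2_ge0 (q : P) t : okpar q -> 0 <= rad2 q t.
Proof. by move=> [q0 _]; rewrite addr_ge0// sqr_ge0. Qed.

Lemma dom_bound (q : P) t : dom q t -> q.1 <= 16 /\ `|t| <= 4.
Proof.
rewrite /dom /rad2 => -[[q0 _] v]; split; first by nra.
by rewrite ler_norml; apply/andP; split; nra.
Qed.

Section with_rho.
Variables (rho : P -> R -> R) (rmax : R).
Local Notation U := (pos_on rho).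
Let rho0 : forall q t, U q t -> 0 < rho q t. Proof. by move=> q t []. Qed.
Hypothesis rhom : forall q t, U q t -> rho q t <= rmax.

Lemma sym_tid m a : a <= 1 -> bsym U rho a (fun _ t => t) -> sym U rho m a (fun _ t => t).
Proof.
move=> a1 bt; case: m => [|m]; split => //.
exists (fun _ _ => 1); first by move=> q t _; exact: is_derive_id.
by apply: (sym_cst rho0 rhom); rewrite subr_le0.
Qed.

Lemma sym_rad2 m a : a <= 1 -> bsym U rho a (fun _ t => t) ->
  bsym U rho (a + a) (fun q _ => q.1) -> sym U rho m (a + a) (@rad2 R).
Proof.
move=> a1 bt bq; apply: symD; first exact: sym_tcst.
apply: (@sym_ext _ _ _ _ _ _ (fun _ t => t * t)); first by move=> q t _ x; rewrite expr2.
by apply: (symM rho0); exact: sym_tid.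
Qed.

(** Smooth functions are symbols of order 0 for every distance: rho is bounded
    above, so negative powers of rho are bounded below. *)
Lemma sym_transfer m a b f : b <= 0 -> sym (pos_on rho_one) rho_one m a f ->
  sym U rho m b f.
Proof.
elim: m a b f => [|m IH] a b f b0 [[C fC] h]; (split; first
  (apply: (bsym_bound rho0 rhom b0) => q t [D _];
   have := fC q t; rewrite powR1; apply; split => //; exact: ltr01)) => //.
case: h => f' df sf; exists f'; last by apply: IH sf; lra.
by move=> q t [D _]; apply: df; split => //; exact: ltr01.
Qed.

End with_rho.

Lemma rho_one_pos (q : P) t : pos_on rho_one q t -> 0 < rho_one q t.
Proof. by case. Qed.

Lemma rho_one_le (q : P) t : pos_on rho_one q t -> rho_one q t <= 1.
Proof. by []. Qed.

Lemma sym_rad2_one m : sym (pos_on rho_one) rho_one m 0 (@rad2 R).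
Proof.
rewrite -[0]addr0; apply: (@sym_rad2 _ 1) => //.
  exists 4 => q t [D _]; rewrite powR1 mulr1; exact: (dom_bound D).2.
exists 16 => q t [D _]; rewrite powR1 mulr1.
by rewrite ger0_norm ?(dom_bound D).1//; case: D => -[].
Qed.

Lemma rho_org_sqr (q : P) t : okpar q -> rho_org q t ^+ 2 = rad2 q t.
Proof. by move=> okq; rewrite sqr_sqrtr// rad2_ge0. Qed.

Lemma rho_org_le (q : P) t : dom q t -> rho_org q t <= 4.
Proof.
move=> [okq v16]; rewrite -(ler_sqr) ?nnegrE ?sqrtr_ge0//.
rewrite rho_org_sqr// expr2; lra.
Qed.

Lemma sym_rad2_org m : sym (pos_on rho_org) rho_org m 2 (@rad2 R).
Proof.
rewrite (_ : 2 = 1 + 1); last by ring.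
have le4 (q : P) t : pos_on rho_org q t -> rho_org q t <= 4.
  by move=> [D _]; exact: rho_org_le.
apply: (sym_rad2 le4) => //.
  exists 1 => q t [[okq _] _]; rewrite mul1r powRr1 ?sqrtr_ge0//.
  rewrite -(ler_sqr) ?nnegrE ?sqrtr_ge0// rho_org_sqr// real_normK ?num_real//.
  by rewrite /rad2 lerDr; case: okq.
exists 1 => q t [[okq _] r0]; rewrite mul1r.
rewrite (_ : 1 + 1 = 2%:R)//; rewrite powR_mulrn ?(ltW r0)// rho_org_sqr//.
by rewrite ger0_norm /rad2 ?lerDl ?sqr_ge0//; case: okq.
Qed.

(** r^(2 g) has order 2 g at the origin, whatever the smoothness m. *)
Lemma sym_ppow_org m g : sym (pos_on rho_org) rho_org m (g + g)
  (fun q t => ppow g (rad2 q t)).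
Proof.
have pos (q : P) t : pos_on rho_org q t -> 0 < rho_org q t by case.
apply: (@sym_ext _ _ _ _ _ _ (fun q t => pow_tower g 0 (rad2 q t))).
  by move=> q t _ x; rewrite pow_tower0.
apply: (@sym_comp _ _ _ _ pos _ _ 2 (pow_tower g)).
- by apply: sym_dsym; exact: sym_rad2_org.
- move=> k _; exists `|falling g k| => q t [[okq _] r0].
  have v0 : 0 < rad2 q t by rewrite -rho_org_sqr// exprn_gt0.
  rewrite /pow_tower normrM ler_wpM2l// ppowE// ger0_norm ?powR_ge0//.
  rewrite -rho_org_sqr// -powR_mulrn ?(ltW r0)// -powRrM.
  rewrite (_ : 2%:R * (g - k%:R) = g + g - k%:R * 2)//; ring.
move=> k q t _ [[okq _] r0]; apply: is_derive_pow_tower.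
by rewrite gt_eqF ?orbT// -rho_org_sqr// exprn_gt0.
Qed.

Lemma rho_org_lip (q : P) (t t' : R) : dom q t -> dom q t' ->
  `|rho_org q t' - rho_org q t| <= `|t' - t|.
Proof.
move=> [okq _] [_ _].
have H (x y : R) : rho_org q y <= rho_org q x + `|y - x|.
  have rx : `|x| <= rho_org q x.
    rewrite -(ler_sqr) ?nnegrE ?sqrtr_ge0// rho_org_sqr// real_normK ?num_real//.
    by rewrite /rad2 lerDr; case: okq.
  have n0 := normr_ge0 (y - x); have nx := normr_ge0 x.
  rewrite -(ler_sqr) ?nnegrE ?addr_ge0 ?sqrtr_ge0// rho_org_sqr// sqrrD rho_org_sqr//.
  rewrite real_normK ?num_real// /rad2.
  have h : x * (y - x) <= rho_org q x * `|y - x|.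
    by apply: le_trans (ler_norm _) _; rewrite normrM ler_wpM2r.
  rewrite mulr2n; nra.
rewrite ler_norml; apply/andP; split.
  by have := H t' t; rewrite distrC; lra.
by have := H t t'; lra.
Qed.

Lemma rho_sph_lip (q : P) (t t' : R) : dom q t -> dom q t' ->
  `|rho_sph q t' - rho_sph q t| <= `|t' - t|.
Proof.
move=> D D'; rewrite /rho_sph -mulrBl normrM [X in _ * X]ger0_norm ?invr_ge0//.
rewrite ler_pdivrMr//; apply: (le_trans (ler_dist_dist _ _)).
have -> : 1 - rad2 q t' - (1 - rad2 q t) = (t - t') * (t + t').
  by rewrite /rad2; ring.
rewrite normrM distrC ler_wpM2l// (le_trans (ler_normD _ _))//.
have := (dom_bound D).2; have := (dom_bound D').2; lra.
Qed.

End basic_symbols.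

(** * Pieces of the multipliers localized at the origin *)

Section pieces.
Context (R : realType).
Local Notation P := (R * R)%type.
Variables (m : nat) (g delta : R).
Hypothesis m0 : (0 < m)%N.
Hypothesis g0 : 0 < g.
Hypothesis d0 : 0 < delta.

(** With this exponent the cutoffs have the derivatives that symbols of
    smoothness m require. *)
Definition cexp : R := m.+2%:R.

Lemma cexp_ge0 : 0 <= cexp. Proof. exact: ler0n. Qed.
Lemma cexp_gt : m.+1%:R < cexp. Proof. by rewrite ltr_nat. Qed.

Definition chi0 (v : R) := cut cexp (1 / 16) (1 / 8) v.
Definition chi1 (v : R) := cut cexp (1 / 8) (1 / 4) v.
Definition chi2 (v : R) := cut cexp (1 / 64) (1 / 16) v.
Definition chi3 (v : R) := cut cexp 1 2 v.
(** r^beta near the origin, with beta = 2 g and v = r^2, cut off before it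
    reaches 1: powers of 1 - [ub] are then smooth functions of [ub]. *)
Definition ub (v : R) := chi1 v * ppow g v.
(** The value of 1 - (1 - r^beta)^delta near the origin. *)
Definition wb (v : R) := 1 - ppow delta (1 - ub v).
(** v away from the origin, changed near it so as to stay at least 1/64. *)
Definition vt (v : R) := v * (1 - chi2 v) + chi2 v * (1 / 64).
(** 1 - r^beta away from the origin. *)
Definition xs (v : R) := 1 - ppow g (vt v).
Definition ws (v : R) := ppow delta (xs v).

(** Pieces with O live near the origin, pieces with M away from the origin and
    are smooth, pieces with S live away from the origin and are singular at the
    sphere.  The digit refers to the multiplier that contains the piece. *)
Definition O1 v := chi0 v * ppow delta (1 - ub v).
Definition O2 v := chi0 v * quot delta 1 (ub v).
Definition O3 v := chi0 v * quot (1 / delta) 1 (wb v).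
Definition M2 v := (chi3 v - chi0 v) * ppow (- g) (vt v).
Definition M3 v := (chi3 v - chi0 v) * ppow g (vt v).
Definition S1 v := (1 - chi0 v) * ws v.
Definition S2 v := S1 v * ppow (- g) (vt v).
Definition S3 v := S1 v * (ppow g (vt v) * ppow (-1) (1 - ws v)).

(** The bound on differences that the criterion for kernels asks for, in terms
    of the distance [rho] to a singular set. *)
Definition difb (rho : P -> R -> R) (k s : R) (Phi : R -> R) :=
  exists2 C, 0 <= C & forall q t e, okpar q -> rad2 q t < 9 -> 0 < e ->
    m%:R * e <= 1 ->
    `|Dn m e (fun x => Phi (rad2 q x)) t| <=
      C * (e `^ s * Num.max (rho q t) e `^ (k - s)).

Lemma difb_of_sym rho rmax k s c0 Phi :
  (forall q t, dom q t -> 0 <= rho q t) ->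
  (forall q t, pos_on rho q t -> rho q t <= rmax) ->
  (forall q t t', dom q t -> dom q t' -> `|rho q t' - rho q t| <= `|t' - t|) ->
  0 <= k -> 0 <= s -> s <= m%:R ->
  sym (pos_on rho) rho m k (fun q t => Phi (rad2 q t) - c0) ->
  (forall q t, dom q t -> rho q t = 0 -> Phi (rad2 q t) = c0) ->
  difb rho (Num.min k s) s Phi.
Proof.
move=> r0 rm rl k0 s0 sm sg z.
have pos q t : pos_on rho q t -> 0 < rho q t by case.
apply: (@singular_diff R rho m r0 rl m0 (Num.min k s) s c0 (fun q t => Phi (rad2 q t))) => //.
- by rewrite le_min k0.
- by rewrite ge_min lexx orbT.
by apply: (sym_le pos rm _ sg); rewrite ge_min lexx.
Qed.

Lemma ub_itv v : 0 <= ub v <= (1 / 4) `^ g.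
Proof.
have /andP[c0 c1] : 0 <= chi1 v <= 1 by apply: cut_itv; [exact: cexp_ge0|lra].
rewrite mulr_ge0 ?ppow_ge0//=.
have [h|h] := leP (1 / 4) v; first by rewrite /ub /chi1 cut0// mul0r powR_ge0.
rewrite (le_trans (ler_piMl (ppow_ge0 _ _) c1))//.
rewrite /ppow; case: ifP => [v0|_]; last exact: powR_ge0.
by apply: ge0_ler_powR; rewrite ?nnegrE ?(ltW g0) ?(ltW v0)//; lra.
Qed.

Lemma theta_lt1 : (1 / 4) `^ g < 1 :> R.
Proof.
by have := @gt0_ltr_powR R g g0 (1 / 4) 1; rewrite powR1; apply; rewrite ?nnegrE; lra.
Qed.

Lemma ub_lt1 v : 0 <= ub v < 1.
Proof.
by have /andP[-> h] := ub_itv v; rewrite (le_lt_trans h theta_lt1).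
Qed.

Lemma wb_itv v : 0 <= wb v <= 1 - (1 - (1 / 4) `^ g) `^ delta.
Proof.
have /andP[u0 u1] := ub_itv v; have th := theta_lt1; rewrite /wb.
rewrite ppowE; last by lra.
rewrite subr_ge0 lerD2l lerN2; apply/andP; split.
  have := @ge0_ler_powR R delta (ltW d0) (1 - ub v) 1; rewrite powR1.
  by apply; rewrite ?nnegrE; lra.
by apply: ge0_ler_powR; rewrite ?nnegrE ?(ltW d0)//; lra.
Qed.

Lemma wb_bound_lt1 : 1 - (1 - (1 / 4) `^ g) `^ delta < 1 :> R.
Proof. by rewrite ltrBlDr ltrDl powR_gt0// subr_gt0 theta_lt1. Qed.

Section origin_type.
Variables (rho : P -> R -> R) (k s : R).
Hypothesis rho_ge0 : forall q t, dom q t -> 0 <= rho q t.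
Hypothesis rhom : forall q t, pos_on rho q t -> rho q t <= 4.
Hypothesis rho_lip : forall q t t', dom q t -> dom q t' ->
  `|rho q t' - rho q t| <= `|t' - t|.
Hypothesis k0 : 0 <= k.
Hypothesis s0 : 0 <= s.
Hypothesis sm : s <= m%:R.
Hypothesis rz : forall q t, dom q t -> rho q t = 0 -> rad2 q t = 0.
Hypothesis gap : forall q t, pos_on rho q t -> 1 / 16 < rad2 q t -> 1 / 4 <= rho q t.
Hypothesis sv : sym (pos_on rho) rho m 0 (@rad2 R).
Hypothesis su : sym (pos_on rho) rho m k (fun q t => ppow g (rad2 q t)).
Let pos q t : pos_on rho q t -> 0 < rho q t. Proof. by case. Qed.

Lemma sym_ub : sym (pos_on rho) rho m k (fun q t => ub (rad2 q t)).
Proof.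
apply: (symM0l pos) => //.
by apply: (sym_cut pos rhom) => //; [exact: cexp_gt|lra].
Qed.

Lemma sym_wb : sym (pos_on rho) rho m k (fun q t => wb (rad2 q t)).
Proof.
apply: (@sym_ext _ _ _ _ _ _ (fun q t => - (ppow delta (1 - 1 * ub (rad2 q t)) - 1))).
  by move=> q t _ x; rewrite mul1r opprB.
apply: (symN pos rhom).
apply: (@sym_pow_near1 _ _ _ _ _ pos rhom m k delta ((1 / 4) `^ g) (fun _ => 1)
  (fun q t => ub (rad2 q t)) k0) => //.
- by move=> q t _; rewrite ler01 lexx.
- by move=> q t _; exact: ub_itv.
- exact: theta_lt1.
exact: sym_ub.
Qed.

Lemma sym_chi0 : sym (pos_on rho) rho m 0 (fun q t => chi0 (rad2 q t)).
Proof. by apply: (sym_cut pos rhom) => //; [exact: cexp_gt|lra]. Qed.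

Lemma sym_chi0B1 : sym (pos_on rho) rho m k (fun q t => chi0 (rad2 q t) - 1).
Proof.
apply: (@sym_one_sub_cut _ _ _ _ _ pos rhom m cexp _ _ _ _ (1 / 4)) => //.
- exact: cexp_gt.
- lra.
Qed.

(** The parameter s of [Dn_quot] is the component q.2. *)
Lemma difb_family a th (y : R -> R) : (forall v, 0 <= y v <= th) -> th < 1 ->
  y 0 = 0 -> sym (pos_on rho) rho m k (fun q t => y (rad2 q t)) ->
  exists2 C, 0 <= C & forall (q : P) t e, okpar q -> rad2 q t < 9 -> 0 < e ->
    m%:R * e <= 1 ->
    `|Dn m e (fun x => chi0 (rad2 q x) * ppow a (1 - q.2 * y (rad2 q x))) t| <=
      C * (e `^ s * Num.max (rho q t) e `^ (Num.min k s - s)).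
Proof.
move=> yth th1 yz sy.
apply: (@singular_diff R rho m rho_ge0 rho_lip m0 (Num.min k s) s 1
  (fun q t => chi0 (rad2 q t) * ppow a (1 - q.2 * y (rad2 q t)))) => //.
- by rewrite le_min k0.
- by rewrite ge_min lexx orbT.
- apply: (@sym_le _ _ _ _ _ pos rhom _ k); first by rewrite ge_min lexx.
  apply: (@sym_ext _ _ _ _ _ _ (fun q t => chi0 (rad2 q t) *
     (ppow a (1 - q.2 * y (rad2 q t)) - 1) + (chi0 (rad2 q t) - 1))).
    by move=> q t _ x; ring.
  apply: symD; last exact: sym_chi0B1.
  apply: (symM0l pos); first exact: sym_chi0.
  apply: (@sym_pow_near1 _ _ _ _ _ pos rhom m k a th (fun q => q.2)
    (fun q t => y (rad2 q t)) k0) => //.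
  by move=> q t [[[_ ?] _] _].
move=> q t D /(rz D) ->; rewrite yz mulr0 subr0 ppowE// powR1 mulr1.
by apply: cut1; [exact: cexp_ge0|lra|lra].
Qed.

Lemma ub0 : ub 0 = 0.
Proof. by rewrite /ub ppow_le0// mulr0. Qed.

Lemma wb0 : wb 0 = 0.
Proof. by rewrite /wb ub0 subr0 ppowE// powR1 subrr. Qed.

(** By [Dn_quot] it suffices to treat chi0 (1 - s y)^(a - 1), which is a symbol
    of order k up to its value 1 at the origin, uniformly in s. *)
Lemma difb_quot a th (y : R -> R) : (forall v, 0 <= y v <= th) -> th < 1 ->
  y 0 = 0 -> sym (pos_on rho) rho m k (fun q t => y (rad2 q t)) ->
  (forall q q' t, q.1 = q'.1 -> rho q t = rho q' t) ->
  difb rho (Num.min k s) s (fun v => chi0 v * quot a 1 (y v)) /\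
  difb rho (Num.min k s) s (fun v => chi0 v * ppow a (1 - y v)).
Proof.
move=> yth th1 yz sy rq; split; last first.
  have [C C0 H] := difb_family a yth th1 yz sy.
  exists C => // q t e okq v e0 me.
  have okq1 : okpar (q.1, 1 : R) by split; [case: okq|rewrite ler01 lexx].
  have := H (q.1, 1) t e okq1 v e0 me; rewrite (rq (q.1, 1) q t erefl).
  by under [X in Dn _ _ X]eq_fun do rewrite mul1r.
have [C C0 H] := difb_family (a - 1) yth th1 yz sy.
exists (`|a| * C); first exact: mulr_ge0.
move=> q t e okq v e0 me; rewrite -mulrA.
apply: (@Dn_quot _ m e t _ a (fun x => chi0 (rad2 q x)) (fun x => y (rad2 q x))).
- by rewrite !mulr_ge0 ?powR_ge0.
- by move=> x; have /andP[-> h] := yth (rad2 q x); rewrite (le_lt_trans h th1).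
move=> r r01; have okq1 : okpar (q.1, r) by split; [case: okq|].
by have := H (q.1, r) t e okq1 v e0 me; rewrite (rq (q.1, r) q t erefl).
Qed.

End origin_type.

End pieces.

(** * Pieces of the multipliers localized at the unit sphere *)

Section sphere_pieces.
Context (R : realType).
Local Notation P := (R * R)%type.
Variables (m : nat) (g delta : R).
Hypothesis m0 : (0 < m)%N.
Hypothesis g0 : 0 < g.
Hypothesis d0 : 0 < delta.
Local Notation chi0 := (@chi0 R m).
Local Notation chi2 := (@chi2 R m).
Local Notation chi3 := (@chi3 R m).
Local Notation vt := (@vt R m).
Local Notation xs := (@xs R m g).
Local Notation ws := (@ws R m g delta).
Local Notation difb := (@difb R m).

Lemma vt_ge v : 1 / 64 <= vt v.
Proof.
have /andP[c0 c1] : 0 <= chi2 v <= 1 by apply: cut_itv; [exact: cexp_ge0|lra].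
have [h|h] := leP v (1 / 64).
  by rewrite /vt /chi2 cut1 ?cexp_ge0//; lra.
rewrite /vt; nra.
Qed.

Lemma vtE v : 1 / 16 <= v -> vt v = v.
Proof. by move=> h; rewrite /vt /chi2 cut0//; ring. Qed.

Lemma vt_le v : v <= 1 / 16 -> vt v <= 1 / 16.
Proof.
move=> h.
have /andP[c0 c1] : 0 <= chi2 v <= 1 by apply: cut_itv; [exact: cexp_ge0|lra].
rewrite /vt; nra.
Qed.

Local Notation one := (@rho_one R).
Local Notation sph := (@rho_sph R).
Let opos := @rho_one_pos R.
Let ole := @rho_one_le R.

Lemma sym_cut_one a b : a < b ->
  sym (pos_on one) one m 0 (fun q t => cut (cexp R m) a b (rad2 q t)).
Proof.
move=> ab; apply: (sym_cut opos ole) => //; [exact: cexp_gt|exact: sym_rad2_one].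
Qed.

Lemma sym_vt : sym (pos_on one) one m 0 (fun q t => vt (rad2 q t)).
Proof.
have s2 : sym (pos_on one) one m 0 (fun q t => chi2 (rad2 q t)).
  by apply: sym_cut_one; lra.
apply: symD; apply: (symM0l opos); rewrite ?sym_rad2_one//.
- exact: sym_rad2_one.
- by apply: (symBB opos ole) => //; apply: (sym_cst0 opos ole).
- by apply: (sym_cst0 opos ole).
Qed.

Lemma sym_ppow_vt a : sym (pos_on one) one m 0 (fun q t => ppow a (vt (rad2 q t))).
Proof.
apply: (@sym_pow _ _ _ _ _ opos ole _ _ _ (1 / 64)) => //; last first.
- by move=> q t _; exact: vt_ge.
- exact: sym_vt.
Qed.

Lemma difb_smooth s a : 0 <= s -> s <= m%:R ->
  difb one (Num.min 0 s) s (fun v => (chi3 v - chi0 v) * ppow a (vt v)).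
Proof.
move=> s0 sm; apply: (@difb_of_sym _ _ m0 _ 1 0 s 0) => //.
- by move=> q t t' _ _; rewrite subrr normr0.
- apply: (@sym_ext _ _ _ _ _ _ (fun q t => (chi3 (rad2 q t) - chi0 (rad2 q t)) *
    ppow a (vt (rad2 q t)))); first by move=> q t _ x; rewrite subr0.
  apply: (symM0l opos); last exact: sym_ppow_vt.
  apply: (symBB opos ole).
    by apply: (@sym_cut_one 1 2); lra.
  by apply: (@sym_cut_one (1 / 16) (1 / 8)); lra.
by move=> q t _ /eqP; rewrite oner_eq0.
Qed.

(** The mean value theorem on [c, 1]. *)
Lemma one_sub_powR_le (c a : R) : 0 < c -> c <= 1 -> exists2 B, 0 < B &
  forall x, c <= x <= 1 -> 1 - x `^ a <= B * (1 - x).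
Proof.
move=> c0 c1; have [B B0 hB] := @pow_tower_bound R a c 1 1 c0 c1.
exists (B + 1); first lra.
move=> x /andP[cx x1].
have H : `|ppow a 1 - ppow a x| <= B * (1 - x).
  apply: (@mean_value_bound _ (ppow a) (pow_tower a 1)) => //.
    move=> y /andP[xy _]; have y0 : 0 < y by apply: lt_le_trans xy; exact: lt_le_trans cx.
    apply: (near_eq_is_derive _ (@is_derive_pow_tower _ a 0 y _)).
      by near=> z; rewrite pow_tower0.
    by rewrite (gt_eqF y0) orbT.
  by move=> y /andP[xy y1]; apply: hB => //; rewrite (le_trans cx xy).
have x0 : 0 < x by exact: lt_le_trans cx.
move: H; rewrite !ppowE// powR1 => H.
apply: (le_trans (ler_norm _)); apply: (le_trans H); rewrite ler_wpM2r//; lra.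
Unshelve. all: by end_near. Qed.

Lemma xs_le0 v : 1 <= v -> xs v <= 0.
Proof.
move=> v1; rewrite /xs vtE; last lra.
rewrite ppowE; last lra.
rewrite subr_le0; have := @ge0_ler_powR R g (ltW g0) 1 v.
by rewrite powR1; apply; rewrite ?nnegrE; lra.
Qed.

(** 1 - r^beta vanishes to first order at the sphere: apply [one_sub_powR_le]
    to the exponent g, and to 1/g for the converse. *)
Lemma xs_comparable : exists c B, [/\ 0 < c, 0 < B & forall v, 0 <= v < 1 ->
  c * (1 - v) <= xs v <= B * (1 - v)].
Proof.
have [||B B0 hB] := @one_sub_powR_le (1 / 64) g; [lra|lra|].
have z0 : 0 < (1 / 64 : R) `^ g by apply: powR_gt0; lra.
have z1 : (1 / 64 : R) `^ g <= 1.
  by have := @ge0_ler_powR R g (ltW g0) (1 / 64) 1; rewrite powR1; apply; rewrite ?nnegrE; lra.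
have [D D0 hD] := @one_sub_powR_le _ (1 / g) z0 z1.
exists (1 / (2 * D)), (2 * B); split; [by rewrite divr_gt0// mulr_gt0|lra|].
move=> v /andP[v0 v1].
have tv := vt_ge v.
have t1 : vt v <= 1.
  have [h|h] := leP (1 / 16) v; first by rewrite vtE//; lra.
  by have := vt_le (ltW h); lra.
have t2 : 1 - vt v <= 2 * (1 - v) /\ 1 - v <= 2 * (1 - vt v).
  have [h|h] := leP (1 / 16) v; first by rewrite vtE//; lra.
  by have := vt_le (ltW h); lra.
have tp : 0 < vt v by lra.
rewrite /xs ppowE//; apply/andP; split; last first.
  have /le_trans -> // : 1 - vt v `^ g <= B * (1 - vt v) by apply: hB; rewrite tv.
  have := ler_wpM2l (ltW B0) t2.1; lra.
have z2 : (1 / 64) `^ g <= vt v `^ g <= 1.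
  apply/andP; split; first by apply: ge0_ler_powR; rewrite ?nnegrE ?(ltW g0)//; lra.
  by have := @ge0_ler_powR R g (ltW g0) (vt v) 1; rewrite powR1; apply; rewrite ?nnegrE; lra.
have := hD _ z2; rewrite -powRrM mulrC mul1r mulVf ?gt_eqF// powRr1 ?(ltW tp)// => h.
rewrite mul1r mulrC ler_pdivrMr ?mulr_gt0//.
have := t2.2; nra.
Qed.

Let spos (q : P) t : pos_on sph q t -> 0 < sph q t. Proof. by case. Qed.

Lemma sph_le (q : P) t : dom q t -> sph q t <= 1.
Proof.
move=> [okq v16]; have v0 := rad2_ge0 t okq; rewrite /rho_sph ler_pdivrMr// mul1r ler_norml; lra.
Qed.

Let sle (q : P) t : pos_on sph q t -> sph q t <= 1.
Proof. by move=> [D _]; exact: sph_le. Qed.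

(** A power delta of a function comparable to the distance to the sphere;
    the truncation makes all derivatives vanish outside. *)
Lemma sym_ws : sym (pos_on sph) sph m delta (fun q t => ws (rad2 q t)).
Proof.
have [c [B [c0 B0 hx]]] := xs_comparable.
apply: (@sym_ext _ _ _ _ _ _ (fun q t => pow_tower delta 0 (xs (rad2 q t)))).
  by move=> q t _ x; rewrite pow_tower0.
apply: (@sym_comp _ _ _ _ spos _ _ 1 (pow_tower delta)).
- have sN : sym (pos_on one) one m 0 (fun q t => - ppow g (vt (rad2 q t))).
    by apply: (symN opos ole); exact: sym_ppow_vt.
  have : dsym (pos_on sph) sph m 1 (fun q t => - ppow g (vt (rad2 q t))).
    case: (m) sN => // k [_ [f df sf]]; exists f.
      by move=> q t [D _]; apply: df; split => //; exact: ltr01.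
    by rewrite subrr; apply: (sym_transfer sle _ sf).
  exact: dsym_cstD.
- move=> k _; rewrite mulr1.
  exists (`|falling delta k| * ((16 * B) `^ (delta - k%:R) + (16 * c) `^ (delta - k%:R))).
  move=> q t [[okq v16] r0]; rewrite /pow_tower normrM -mulrA ler_wpM2l// ger0_norm ?ppow_ge0//.
  have v0 := rad2_ge0 t okq.
  rewrite {1}/ppow; case: ifP => [x0|_]; last by rewrite mulr_ge0 ?addr_ge0 ?powR_ge0.
  have v1 : rad2 q t < 1 by rewrite ltNge; apply/negP => /xs_le0; rewrite leNgt x0.
  have := hx (rad2 q t); rewrite v0 v1 => /(_ isT) /andP[x1 x2].
  have rE : 1 - rad2 q t = 16 * sph q t.
    by rewrite /rho_sph ger0_norm ?subr_ge0 ?(ltW v1)//; field.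
  have xB : xs (rad2 q t) <= 16 * B * sph q t by move: x2; rewrite rE; lra.
  have xc : 16 * c * sph q t <= xs (rad2 q t) by move: x1; rewrite rE; lra.
  have c16 : 0 < 16 * c by lra.
  have B16 : 0 < 16 * B by lra.
  have hB : 0 < 16 * B * sph q t by rewrite mulr_gt0.
  have hc : 0 < 16 * c * sph q t by rewrite mulr_gt0.
  rewrite mulrDl; have [e0|e0] := leP 0 (delta - k%:R).
    apply: ler_wpDr; first by rewrite mulr_ge0 ?powR_ge0.
    rewrite -powRM ?(ltW B16) ?(ltW r0)//.
    by apply: ge0_ler_powR; rewrite ?nnegrE ?(ltW x0) ?(ltW hB).
  apply: ler_wpDl; first by rewrite mulr_ge0 ?powR_ge0.
  rewrite -powRM ?(ltW c16) ?(ltW r0)//.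
  rewrite -[delta - k%:R]opprK !(powRN _ (- (delta - k%:R))) lef_pV2 ?posrE ?powR_gt0//.
  by apply: ge0_ler_powR; rewrite ?nnegrE ?(ltW x0) ?(ltW hc) ?oppr_ge0 ?(ltW e0).
move=> k q t _ [[okq v16] r0]; apply: is_derive_pow_tower.
apply/orP; right.
have v0 := rad2_ge0 t okq.
have [v1|v1|v1] := ltgtP (rad2 q t) 1.
- have := hx (rad2 q t); rewrite v0 v1 => /(_ isT) /andP[x1 x2].
  rewrite gt_eqF//; apply: lt_le_trans x1; rewrite mulr_gt0//; lra.
- rewrite lt_eqF// /xs vtE; last lra.
  rewrite ppowE; last lra.
  rewrite subr_lt0; have := @gt0_ltr_powR R g g0 1 (rad2 q t).
  by rewrite powR1; apply; rewrite ?nnegrE; lra.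
by move: r0; rewrite /rho_sph v1 subrr normr0 mul0r ltxx.
Qed.

Lemma ws_le v : 0 <= ws v <= (1 - (1 / 64) `^ g) `^ delta.
Proof.
rewrite ppow_ge0 /ws /ppow; case: ifP => [x0|_]; last exact: powR_ge0.
apply: ge0_ler_powR; rewrite ?nnegrE ?(ltW d0) ?(ltW x0)//.
  rewrite subr_ge0; have := @ge0_ler_powR R g (ltW g0) (1 / 64) 1.
  by rewrite powR1; apply; rewrite ?nnegrE; lra.
have tv := vt_ge v.
rewrite /xs lerD2l lerN2 ppowE; last lra.
by apply: ge0_ler_powR; rewrite ?nnegrE ?(ltW g0)//; lra.
Qed.

Lemma ws_bound_lt1 : (1 - (1 / 64) `^ g) `^ delta < 1 :> R.
Proof.
have z0 : 0 < (1 / 64 : R) `^ g by apply: powR_gt0; lra.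
have z1 : (1 / 64 : R) `^ g <= 1.
  by have := @ge0_ler_powR R g (ltW g0) (1 / 64) 1; rewrite powR1; apply; rewrite ?nnegrE; lra.
have := @gt0_ltr_powR R delta d0 (1 - (1 / 64) `^ g) 1.
by rewrite powR1; apply; rewrite ?nnegrE; lra.
Qed.

(** A smooth factor A keeps the order delta. *)
Lemma difb_sphere s A : 0 <= s -> s <= m%:R ->
  sym (pos_on sph) sph m 0 (fun q t => A (rad2 q t)) ->
  difb sph (Num.min delta s) s (fun v => S1 m g delta v * A v).
Proof.
move=> s0 sm sA; apply: (@difb_of_sym _ _ m0 _ 1 delta s 0) => //.
- by move=> q t _; rewrite divr_ge0.
- exact: rho_sph_lip.
- exact: ltW.
- apply: (@sym_ext _ _ _ _ _ _ (fun q t => (1 - chi0 (rad2 q t)) * ws (rad2 q t) * A (rad2 q t))).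
    by move=> q t _ x; rewrite subr0.
  apply: (symM0r spos) => //; apply: (symM0l spos); last exact: sym_ws.
  apply: (@sym_transfer _ _ 1 sle _ 0 0) => //.
  apply: (symBB opos ole); first exact: (sym_cst0 opos ole).
  by apply: (@sym_cut_one (1 / 16) (1 / 8)); lra.
move=> q t _ /eqP; rewrite mulf_eq0 invr_eq0 normr_eq0 subr_eq0 (gt_eqF (_ : 0 < 16 :> R))// orbF.
move=> /eqP v1; rewrite /S1 /ws ppow_le0 ?mulr0 ?mul0r//; apply: xs_le0; lra.
Qed.

Lemma difb_S1 s : 0 <= s -> s <= m%:R -> difb sph (Num.min delta s) s (S1 m g delta).
Proof.
move=> s0 sm; have [|C C0 H] := @difb_sphere s (fun _ => 1) s0 sm.
  exact: (sym_cst0 spos sle).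
by exists C => // q t e okq v e0 me; have := H q t e okq v e0 me; under eq_fun do rewrite mulr1.
Qed.

Lemma difb_S2 s : 0 <= s -> s <= m%:R -> difb sph (Num.min delta s) s (S2 m g delta).
Proof.
move=> s0 sm; apply: difb_sphere => //; apply: (@sym_transfer _ _ 1 sle _ 0 0) => //.
exact: sym_ppow_vt.
Qed.

Lemma difb_S3 s : 0 <= s -> s <= m%:R -> difb sph (Num.min delta s) s (S3 m g delta).
Proof.
move=> s0 sm; apply: difb_sphere => //; apply: (symM0l spos).
  by apply: (@sym_transfer _ _ 1 sle _ 0 0) => //; exact: sym_ppow_vt.
apply: (@sym_pow _ _ _ _ _ spos sle _ _ _ (1 - (1 - (1 / 64) `^ g) `^ delta)) => //.
- by rewrite subr_gt0 ws_bound_lt1.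
- apply: (symBB spos sle); first exact: (sym_cst0 spos sle).
  apply: (sym_le spos sle _ sym_ws); exact: ltW.
by move=> q t _; rewrite lerD2l lerN2; have /andP[] := ws_le (rad2 q t).
Qed.

End sphere_pieces.

(** * The three multipliers *)

Section multipliers.
Context (R : realType).
Variables (m : nat) (g delta : R).
Hypothesis m0 : (0 < m)%N.
Hypothesis g0 : 0 < g.
Hypothesis d0 : 0 < delta.

(** Although the sum is just (1 - r^beta)_+^delta ([Phi1E]), the splitting puts
    the singularity at the origin and that at the sphere into different
    summands, to which different lattice sums apply.  [Phi2] and [Phi3] are
    cut off beyond r = 1, where only their values for r <= 1 matter. *)
Definition Phi1 v := O1 m g delta v + S1 m g delta v.
Definition Phi2 v := O2 m g delta v + M2 m g v + -1 * S2 m g delta v.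
Definition Phi3 v := O3 m g delta v + M3 m g v + S3 m g delta v.

Lemma ub_lo (v : R) : v <= 1 / 8 -> ub m g v = ppow g v.
Proof. by move=> h; rewrite /ub /chi1 cut1 ?mul1r//; lra. Qed.

Lemma chi0_lo (v : R) : v <= 1 / 16 -> chi0 m v = 1.
Proof. by move=> h; apply: cut1 => //; lra. Qed.

Lemma chi0_hi (v : R) : 1 / 8 <= v -> chi0 m v = 0.
Proof. exact: cut0. Qed.

Lemma chi3_lo (v : R) : v <= 1 -> chi3 m v = 1.
Proof. by move=> h; apply: cut1 => //; lra. Qed.

Lemma ws_hi (v : R) : 1 / 16 <= v -> ws m g delta v = ppow delta (1 - ppow g v).
Proof. by move=> h; rewrite /ws /xs vtE. Qed.

Lemma Phi1E (v : R) : Phi1 v = ppow delta (1 - ppow g v).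
Proof.
rewrite /Phi1 /O1 /S1.
have [h|h] := leP v (1 / 16).
  by rewrite chi0_lo// ub_lo ?subrr ?mul1r ?mul0r ?addr0//; lra.
rewrite ws_hi ?(ltW h)//.
have [h'|h'] := leP v (1 / 8); first by rewrite ub_lo//; ring.
by rewrite chi0_hi ?(ltW h')//; ring.
Qed.

Lemma Phi1_ge1 (v : R) : 1 <= v -> Phi1 v = 0.
Proof.
move=> h; rewrite Phi1E ppow_le0//.
rewrite ppowE; last lra.
rewrite subr_le0; have := @ge0_ler_powR R g (ltW g0) 1 v.
by rewrite powR1; apply; rewrite ?nnegrE; lra.
Qed.

Lemma Phi2_ge2 (v : R) : 2 <= v -> Phi2 v = 0.
Proof.
move=> h; rewrite /Phi2 /O2 /M2 /S2 /S1 chi0_hi; last lra.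
rewrite /chi3 cut0// mul0r subrr mul0r addr0 add0r /ws ppow_le0; last first.
  by apply: xs_le0 => //; lra.
ring.
Qed.

Lemma Phi3_ge2 (v : R) : 2 <= v -> Phi3 v = 0.
Proof.
move=> h; rewrite /Phi3 /O3 /M3 /S3 /S1 chi0_hi; last lra.
rewrite /chi3 cut0// mul0r subrr mul0r addr0 add0r /ws ppow_le0; last first.
  by apply: xs_le0 => //; lra.
ring.
Qed.

Lemma quot_mul (a y : R) : quot a 1 y * y = 1 - ppow a (1 - y).
Proof.
rewrite /quot; case: eqP => [->|/eqP y0]; last by rewrite mul1r divfK.
by rewrite mulr0 subr0 ppowE// powR1 subrr.
Qed.

Lemma ppow_inv_mul (v : R) : 0 < v -> ppow (- g) v * ppow g v = 1.
Proof.
by move=> v0; rewrite !ppowE// -powR_split// addNr powRr0.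
Qed.

Lemma Phi2_mul (v : R) : 0 <= v <= 1 -> Phi2 v * ppow g v = 1 - Phi1 v.
Proof.
move=> /andP[v0 v1].
have [h|h] := leP v (1 / 16).
  have -> : Phi2 v = quot delta 1 (ub m g v).
    by rewrite /Phi2 /O2 /M2 /S2 /S1 chi0_lo// chi3_lo//; ring.
  by rewrite ub_lo ?quot_mul ?Phi1E//; lra.
have vp : 0 < v by lra.
have hv := ppow_inv_mul vp.
have key : O2 m g delta v * ppow g v = chi0 m v * (1 - Phi1 v).
  have [h'|h'] := leP v (1 / 8).
    by rewrite /O2 ub_lo// -mulrA quot_mul Phi1E.
  by rewrite /O2 chi0_hi ?(ltW h')// !mul0r.
have hw : ws m g delta v = Phi1 v by rewrite ws_hi ?(ltW h)// Phi1E.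
rewrite /Phi2 !mulrDl key /M2 /S2 /S1 vtE ?(ltW h)// chi3_lo// hw.
move: hv; move: (ppow (- g) v) (ppow g v) (chi0 m v) (Phi1 v) => A B c F AB.
rewrite (_ : _ + _ = c * (1 - F) + (1 - c) * (1 - F) * (A * B)); last by ring.
rewrite AB; ring.
Qed.

Lemma Phi3_mul (v : R) : 0 <= v <= 1 -> Phi3 v * (1 - Phi1 v) = ppow g v.
Proof.
move=> /andP[v0 v1].
have wbE (w : R) : w <= 1 / 8 -> 0 <= w -> quot (1 / delta) 1 (wb m g delta w) * (1 - Phi1 w) = ppow g w.
  move=> w8 w0; have -> : 1 - Phi1 w = wb m g delta w by rewrite Phi1E /wb ub_lo.
  rewrite quot_mul /wb subKr -ub_lo//.
  have /andP[u0 u1] := @ub_lt1 R m g g0 w.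
  have u1' : 0 < 1 - ub m g w by lra.
  rewrite [ppow delta _]ppowE// ppowE; last exact: powR_gt0.
  by rewrite -powRrM mul1r mulfV ?gt_eqF// powRr1 ?(ltW u1')// subKr.
have [h|h] := leP v (1 / 16).
  have -> : Phi3 v = quot (1 / delta) 1 (wb m g delta v).
    by rewrite /Phi3 /O3 /M3 /S3 /S1 chi0_lo// chi3_lo//; ring.
  by apply: wbE => //; lra.
have key : O3 m g delta v * (1 - Phi1 v) = chi0 m v * ppow g v.
  have [h'|h'] := leP v (1 / 8).
    by rewrite /O3 -mulrA wbE.
  by rewrite /O3 chi0_hi ?(ltW h')// !mul0r.
have hw : ws m g delta v = Phi1 v by rewrite ws_hi ?(ltW h)// Phi1E.
have w1 : 0 < 1 - Phi1 v.
  rewrite -hw; have /andP[_ h1] := @ws_le R m g delta g0 d0 v.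
  have := @ws_bound_lt1 R g delta g0 d0; lra.
rewrite /Phi3 !mulrDl key /M3 /S3 /S1 vtE ?(ltW h)// chi3_lo// hw.
rewrite [ppow (-1) _]ppowE// powR_inv1 ?(ltW w1)//.
by field; rewrite gt_eqF.
Qed.

End multipliers.

(** * Lattice sums of singular weights *)

Section line_sums.
Context (R : realType).

Lemma powR_subadd (p x y : R) : 0 < p -> p <= 1 -> 0 <= x -> 0 <= y ->
  (x + y) `^ p <= x `^ p + y `^ p.
Proof.
move=> p0 p1 x0 y0.
have [s0|s0] := eqVneq (x + y) 0.
  by rewrite s0 powR0 ?gt_eqF// addr_ge0 ?powR_ge0.
have sp : 0 < x + y by rewrite lt_neqAle eq_sym s0 addr_ge0.
have H z : 0 <= z -> z <= x + y -> z / (x + y) <= (z / (x + y)) `^ p.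
  move=> z0 zs; have [->|zn] := eqVneq z 0; first by rewrite mul0r powR_ge0.
  have zp : 0 < z by rewrite lt_neqAle eq_sym zn.
  apply: ger1_powR => //.
  by rewrite divr_gt0//= ler_pdivrMr// mul1r.
have Hx := H x x0 (_ : x <= x + y); have Hy := H y y0 (_ : y <= x + y).
have E z : 0 <= z -> z `^ p = (z / (x + y)) `^ p * (x + y) `^ p.
  by move=> z0; rewrite -powRM ?divr_ge0 ?(ltW sp)// divfK.
rewrite (E x)// (E y)// -mulrDl -[leLHS]mul1r ler_wpM2r ?powR_ge0//.
rewrite -(divff s0) mulrDl; apply: lerD; [apply: Hx|apply: Hy]; lra.
Qed.

Variable gam : R.
Hypothesis gam0 : 0 <= gam.
Hypothesis gam1 : gam < 1.
Local Notation th := (1 - gam).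
Let th0 : 0 < th. Proof. by rewrite subr_gt0. Qed.
Let th1 : th <= 1. Proof. by rewrite lerBlDr lerDl. Qed.

(** sgn x |x|^th, up to constants a primitive of |x|^(- gam). *)
Definition odd_pow (x : R) : R := if 0 <= x then x `^ th else - ((- x) `^ th).

Definition spread (x : R) : R := Num.max `|x| 1 `^ (- gam).

Lemma powR_incr (x : R) : 0 <= x -> th * (x + 1) `^ (- gam) <= (x + 1) `^ th - x `^ th.
Proof.
rewrite le_eqVlt => /orP[/eqP <-|x0].
  by rewrite add0r !powR1 powR0 ?gt_eqF//; have := th1; lra.
have [| | |c cx E] := @MVT_segment R (fun y => y `^ th) (fun y => th * y `^ (th - 1)) x (x + 1).
- by rewrite lerDl.
- move=> y; rewrite in_itv/= => /andP[xy _]; apply: is_derive1_powR; exact: lt_trans xy.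
- apply: continuous_in_subspaceT => y; rewrite inE/= in_itv/= => /andP[xy _].
  apply: (is_derive_continuous (@is_derive1_powR R th y _)); exact: lt_le_trans xy.
rewrite E (_ : x + 1 - x = 1); last by ring.
rewrite mulr1 ler_wpM2l ?(ltW th0)// (_ : th - 1 = - gam); last by ring.
move: cx; rewrite in_itv/= => /andP[xc c1].
have c0 : 0 < c by exact: lt_le_trans xc.
rewrite !powRN lef_pV2 ?posrE ?powR_gt0//; last lra.
by apply: ge0_ler_powR; rewrite ?nnegrE ?(ltW c0)//; lra.
Qed.

(** The increments of the odd power dominate [spread] also across 0 and near
    it, where [spread] is capped. *)
Lemma odd_pow_incr (x : R) : th * 2 `^ (- gam) * spread x <= odd_pow (x + 1) - odd_pow x.
Proof.
have g2 : 2 `^ (- gam) <= 1 :> R.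
  rewrite powRN invf_le1 ?powR_gt0//.
  by have := @ge0_ler_powR R gam gam0 1 2; rewrite powR1; apply; rewrite ?nnegrE; lra.
have g2' := powR_ge0 (2 : R) (- gam).
rewrite /odd_pow /spread.
have [x0|x0] := leP 0 x.
  rewrite ifT; last by lra.
  apply: le_trans (powR_incr x0); rewrite -mulrA ler_wpM2l ?(ltW th0)//.
  have m0 : 0 < Num.max `|x| 1 by rewrite lt_max ltr01 orbT.
  rewrite -powRM ?(ltW m0)// !powRN lef_pV2 ?posrE ?powR_gt0 ?mulr_gt0//; last lra.
  apply: ge0_ler_powR; rewrite ?nnegrE ?mulr_ge0 ?(ltW m0)//; first lra.
  rewrite ger0_norm//.
  have : x <= Num.max x 1 by rewrite le_max lexx.
  have : 1 <= Num.max x 1 by rewrite le_max lexx orbT.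
  lra.
have [x1|x1] := leP 0 (x + 1).
  rewrite (max_idPr _); last by rewrite ltr0_norm//; lra.
  rewrite powR1 mulr1 opprK.
  have x0' : 0 <= - x by lra.
  have := @powR_subadd th (x + 1) (- x) th0 th1 x1 x0'.
  rewrite (_ : x + 1 - x = 1) ?powR1; last by ring.
  have : th * 2 `^ (- gam) <= 1 by have := th0; have := th1; nra.
  by move=> h1 h2; lra.
have y0 : 0 <= - x - 1 by lra.
have := powR_incr y0; rewrite subrK => h.
rewrite (max_idPl _) ltr0_norm//; last by lra.
have -> : - (x + 1) = - x - 1 by ring.
suff : th * 2 `^ (- gam) * (- x) `^ (- gam) <= th * (- x) `^ (- gam) by lra.
by rewrite ler_wpM2r ?powR_ge0// ler_piMr// ltW.
Qed.

Lemma odd_pow_sub (a b : R) : a <= b -> odd_pow b - odd_pow a <= 2 * (b - a) `^ th.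
Proof.
move=> ab; rewrite /odd_pow.
have p0 := powR_ge0 (b - a) th.
have [a0|a0] := leP 0 a.
  rewrite ifT; last lra.
  have := @powR_subadd th (b - a) a th0 th1; rewrite subrK subr_ge0 => /(_ ab a0) ?; lra.
have [b0|b0] := leP 0 b.
  have h1 : b `^ th <= (b - a) `^ th.
    by apply: ge0_ler_powR; rewrite ?nnegrE ?(ltW th0)//; lra.
  have h2 : (- a) `^ th <= (b - a) `^ th.
    by apply: ge0_ler_powR; rewrite ?nnegrE ?(ltW th0)//; lra.
  lra.
have := @powR_subadd th (b - a) (- b) th0 th1; rewrite (_ : b - a + - b = - a); last by ring.
move=> h; have : (- a) `^ th <= (b - a) `^ th + (- b) `^ th by apply: h; lra.
lra.
Qed.

(** By [odd_pow_incr] the sum telescopes, uniformly in the shift x. *)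
Lemma spread_sum (n : nat) (x : R) :
  \sum_(i < n) spread (i%:R - x) <= 2 / (th * 2 `^ (- gam)) * n%:R `^ th.
Proof.
have c0 : 0 < th * 2 `^ (- gam) by rewrite mulr_gt0 ?powR_gt0.
rewrite mulrAC ler_pdivlMr// mulrC mulr_sumr.
apply: (@le_trans _ _ (\sum_(i < n) (odd_pow (i.+1%:R - x) - odd_pow (i%:R - x)))).
  apply: ler_sum => i _; have := odd_pow_incr (i%:R - x).
  by rewrite (_ : i%:R - x + 1 = i.+1%:R - x)// -natr1; ring.
rewrite -(big_mkord xpredT (fun i => odd_pow (i.+1%:R - x) - odd_pow (i%:R - x))).
rewrite telescope_sumr//; apply: (le_trans (odd_pow_sub _)).
  by rewrite lerD2r ler_nat.
by rewrite (_ : n%:R - x - (0%:R - x) = n%:R)//; ring.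
Qed.

End line_sums.

Section lattice_sums.
Context (R : realType) (d : nat).
Hypothesis d_gt0 : (0 < d)%N.
Local Notation K := 'rV[int]_d.

Definition kn2 (k : K) : R := \sum_j (k 0 j)%:~R ^+ 2.

(** The square of the bound in [difb], summed over the lattice, is a multiple
    of n^d times the right power of the step; 3 n covers the supports of all
    differences. *)
Definition lattice_bound (rhov : R -> R) (al : R) := exists2 C : R, 0 <= C &
  forall n : nat, (0 < n)%N ->
  \sum_(k <- box d (3 * n)) Num.max (rhov (kn2 k / n%:R ^+ 2)) (1 / n%:R) `^ (- al) <=
    C * n%:R `^ d%:R.

Lemma kn2_ge0 k : 0 <= kn2 k.
Proof. by apply: sumr_ge0 => j _; exact: sqr_ge0. Qed.

Lemma sum_box (M : nat) (F : K -> R) : \sum_(k <- box d M) F k =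
  \sum_(f : {ffun 'I_d -> 'I_(2 * M).+1}) F (\row_j ((f j)%:Z - M%:Z)).
Proof. by rewrite big_map big_enum. Qed.

Lemma powR_decr (x y a : R) : 0 <= a -> 0 < x -> x <= y -> y `^ (- a) <= x `^ (- a).
Proof.
move=> a0 x0 xy; have y0 : 0 < y by exact: lt_le_trans xy.
rewrite !powRN lef_pV2 ?posrE ?powR_gt0//.
by apply: ge0_ler_powR; rewrite ?nnegrE ?(ltW x0) ?(ltW y0).
Qed.

Lemma side_le (n : nat) : (0 < n)%N -> (2 * (3 * n)).+1%:R <= 7 * n%:R :> R.
Proof. by move=> n0; rewrite -natrM ler_nat; lia. Qed.

Lemma le_side (n : nat) : n%:R <= (2 * (3 * n)).+1%:R :> R.
Proof. by rewrite ler_nat; lia. Qed.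

Lemma side_pow (n : nat) (C : R) : (0 < n)%N -> 0 <= C ->
  C * (2 * (3 * n)).+1%:R `^ d%:R <= C * 7 `^ d%:R * n%:R `^ d%:R.
Proof.
move=> n0 C0; rewrite -mulrA ler_wpM2l// -powRM ?ler0n//.
apply: ge0_ler_powR; rewrite ?nnegrE ?ler0n//; last exact: side_le.
Qed.

Lemma lattice_bound_one al : lattice_bound (fun=> 1) al.
Proof.
exists (1 * 7 `^ d%:R); first by rewrite mul1r powR_ge0.
move=> n n0; apply: le_trans (side_pow n0 ler01).
rewrite (eq_bigr (fun=> 1)); last first.
  move=> k _; rewrite (max_idPl _) ?powR1// ler_pdivrMr ?ltr0n// mul1r.
  by rewrite ler1n.
rewrite big_const_seq count_predT size_box iter_addr addr0 mul1r.
by rewrite powR_mulrn ?ler0n// -natrX.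
Qed.

Lemma sum_int_spread (M : nat) (gam x : R) : 0 <= gam -> gam < 1 ->
  \sum_(i < (2 * M).+1) spread gam ((i%:Z - M%:Z)%:~R - x) <=
   2 / ((1 - gam) * 2 `^ (- gam)) * (2 * M).+1%:R `^ (1 - gam).
Proof.
move=> g0 g1; have := spread_sum g0 g1 (2 * M).+1 (M%:R + x).
congr (_ <= _); apply: eq_bigr => i _; congr spread.
by rewrite rmorphB /= opprD addrA.
Qed.

Lemma scale_weight (x n al : R) : 0 <= x -> 0 < n -> 
  Num.max (x / n) (1 / n) `^ (- al) = n `^ al * Num.max x 1 `^ (- al).
Proof.
move=> x0 n0; rewrite -maxr_pMl ?invr_ge0 ?(ltW n0)//.
have m0 : 0 < Num.max x 1 by rewrite lt_max ltr01 orbT.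
rewrite powRM ?invr_ge0 ?(ltW n0) ?(ltW m0)// mulrC; congr (_ * _).
by rewrite -powR_inv1 ?(ltW n0)// -powRrM mulrNN mul1r.
Qed.

(** |k|^(- al) is at most the product of the |k_j|^(- al / d), and al / d < 1
    makes each one-dimensional sum converge at the required rate. *)
Lemma lattice_bound_org al : 0 <= al -> al < d%:R ->
  lattice_bound (@Num.sqrt R) al.
Proof.
move=> al0 ald.
have D0 : 0 < d%:R :> R by rewrite ltr0n.
(* the d factors of the product share the exponent al *)
pose gam := al / d%:R.
have g0 : 0 <= gam by rewrite divr_ge0// ltW.
have g1 : gam < 1 by rewrite ltr_pdivrMr// mul1r.
pose c := 2 / ((1 - gam) * 2 `^ (- gam)).
have c0 : 0 <= c by rewrite divr_ge0// mulr_ge0 ?powR_ge0// subr_ge0 ltW.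
exists (c `^ d%:R * 7 `^ d%:R); first by rewrite mulr_ge0 ?powR_ge0.
move=> n n0; have N0 : 0 < n%:R :> R by rewrite ltr0n.
apply: le_trans (side_pow n0 (powR_ge0 c d%:R)).
set M := (3 * n)%N; set Q := (2 * M).+1.
rewrite (eq_bigr (fun k => n%:R `^ al * Num.max (Num.sqrt (kn2 k)) 1 `^ (- al))); last first.
  move=> k _; rewrite -scale_weight ?sqrtr_ge0//.
  by rewrite sqrtrM ?kn2_ge0// -exprVn sqrtr_sqr ger0_norm ?invr_ge0 ?ler0n.
rewrite -mulr_sumr.
have wk k : Num.max (Num.sqrt (kn2 k)) 1 `^ (- al) <= \prod_j spread gam (k 0 j)%:~R.
  set X := Num.max _ _.
  have X0 : 0 < X by rewrite lt_max ltr01 orbT.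
  have -> : X `^ (- al) = \prod_(j < d) X `^ (- gam).
    rewrite prodr_const card_ord -powR_mulrn ?powR_ge0// -powRrM; congr (_ `^ _).
    by rewrite mulNr /gam divfK// gt_eqF.
  apply: ler_prod => j _; rewrite powR_ge0/=; rewrite /spread; apply: powR_decr => //.
  rewrite ge_max !le_max lexx orbT andbT; apply/orP; left.
  rewrite -ler_sqr ?nnegrE ?sqrtr_ge0// sqr_sqrtr ?kn2_ge0// real_normK ?num_real//.
  by rewrite /kn2 (bigD1 j)//= lerDl; apply: sumr_ge0 => *; exact: sqr_ge0.
have S : \sum_(k <- box d M) Num.max (Num.sqrt (kn2 k)) 1 `^ (- al) <=
    (c * Q%:R `^ (1 - gam)) ^+ d.
  apply: (@le_trans _ _ (\sum_(k <- box d M) \prod_j spread gam (k 0 j)%:~R)).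
    by apply: ler_sum => k _; exact: wk.
  rewrite sum_box.
  under eq_bigr do under eq_bigr do rewrite mxE.
  rewrite -(bigA_distr_bigA (fun (j : 'I_d) (i : 'I_Q) => spread gam (i%:Z - M%:Z)%:~R)).
  rewrite prodr_const card_ord lerXn2r// ?nnegrE.
  - by apply: sumr_ge0 => *; exact: powR_ge0.
  - by rewrite mulr_ge0 ?powR_ge0.
  apply: le_trans (sum_int_spread M 0 g0 g1).
  by apply: ler_sum => i _; rewrite subr0.
apply: (le_trans (ler_wpM2l (powR_ge0 _ _) S)).
rewrite exprMn mulrCA powR_mulrn// ler_wpM2l ?exprn_ge0//.
rewrite -powR_mulrn ?powR_ge0// -powRrM.
have -> : (1 - gam) * d%:R = d%:R - al by rewrite mulrBl mul1r /gam divfK// gt_eqF.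
have Q0 : 0 < Q%:R :> R by rewrite ltr0n.
have -> : Q%:R `^ d%:R = Q%:R `^ al * Q%:R `^ (d%:R - al) :> R.
  by rewrite -powR_split//; congr (_ `^ _); ring.
rewrite ler_wpM2r ?powR_ge0//; apply: ge0_ler_powR; rewrite ?nnegrE ?ler0n//.
exact: le_side.
Qed.

Definition upd (Q : nat) (i : 'I_d) (f : {ffun 'I_d -> 'I_Q}) (r : 'I_Q) :
  {ffun 'I_d -> 'I_Q} := [ffun j => if j == i then r else f j].

(** Exchanging the new value with the old one is an involution of the pairs
    (f, r). *)
Lemma sum_upd (Q : nat) (i : 'I_d) (G : {ffun 'I_d -> 'I_Q} -> R) :
  \sum_f \sum_r G (upd i f r) = Q%:R * \sum_f G f.
Proof.
rewrite pair_big /=.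
pose sw (p : {ffun 'I_d -> 'I_Q} * 'I_Q) := (upd i p.1 p.2, p.1 i).
have swK : involutive sw.
  move=> [f r]; rewrite /sw /=; congr pair; last by rewrite ffunE eqxx.
  by apply/ffunP => j; rewrite !ffunE; case: eqP => [->|].
rewrite (reindex_inj (inv_inj swK)) /=.
rewrite (eq_bigr (fun p => G p.1)); last by move=> p _; have := swK p; rewrite /sw => /(congr1 fst) /= ->.
rewrite -(pair_big xpredT xpredT (fun f _ => G f)) /= mulr_sumr.
by apply: eq_bigr => f _; rewrite sumr_const card_ord mulr_natl.
Qed.

(** Choose i with |k_i| largest, so that |k_i| >= n / (4 d).  In this
    coordinate n^2 - |k|^2 = (t - |k_i|) (t + |k_i|), t being the coordinate of
    the sphere on the line through k; if the line misses the sphere, t = 0. *)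
Lemma sphere_dist (k : K) (n : nat) : (0 < n)%N ->
  1 / 16 <= kn2 k / n%:R ^+ 2 -> exists i : 'I_d,
  let t := Num.sqrt (n%:R ^+ 2 - \sum_(j | j != i) (k 0 j)%:~R ^+ 2) in
  `| `|(k 0 i)%:~R| - t | / (64 * d%:R) / n%:R <= `|1 - kn2 k / n%:R ^+ 2| / 16.
Proof.
move=> n0 hk; have N0 : 0 < n%:R :> R by rewrite ltr0n.
have D0 : 0 < d%:R :> R by rewrite ltr0n.
have D1 : 1 <= d%:R :> R by rewrite ler1n.
(* some coordinate carries at least the average of the squares *)
have [i hi] : exists i : 'I_d, kn2 k <= d%:R * (k 0 i)%:~R ^+ 2.
  pose i0 := Ordinal d_gt0.
  case: (@arg_maxP _ _ _ i0 xpredT (fun j => (k 0 j)%:~R ^+ 2 : R) isT) => i _ hi; exists i.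
  have -> : d%:R * (k 0 i)%:~R ^+ 2 = \sum_(j < d) (k 0 i)%:~R ^+ 2 :> R.
    by rewrite sumr_const card_ord mulr_natl.
  by apply: ler_sum => j _; exact: hi.
exists i => t.
set ki : R := `|(k 0 i)%:~R|.
set s : R := \sum_(j | j != i) (k 0 j)%:~R ^+ 2.
have s0 : 0 <= s by apply: sumr_ge0 => *; exact: sqr_ge0.
have kE : kn2 k = ki ^+ 2 + s by rewrite /kn2 (bigD1 i)//= real_normK ?num_real.
have ki0 : 0 <= ki by exact: normr_ge0.
have t0 : 0 <= t by exact: sqrtr_ge0.
have kil : n%:R <= 4 * d%:R * ki.
  rewrite -ler_sqr ?nnegrE ?mulr_ge0 ?ler0n//.
  have h1 : n%:R ^+ 2 <= 16 * kn2 k by move: hk; rewrite ler_pdivlMr ?exprn_gt0//; lra.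
  apply: (le_trans h1); rewrite -real_normK ?num_real// -/ki in hi.
  have : d%:R * ki ^+ 2 <= d%:R ^+ 2 * ki ^+ 2.
    by rewrite ler_wpM2r ?sqr_ge0// expr2 ler_peMl// ltW.
  rewrite !exprMn; lra.
have main : `|ki - t| * ki <= `|n%:R ^+ 2 - kn2 k|.
  have [h|h] := leP s (n%:R ^+ 2).
    have tE : t ^+ 2 = n%:R ^+ 2 - s by rewrite sqr_sqrtr// subr_ge0.
    have -> : n%:R ^+ 2 - kn2 k = (t - ki) * (t + ki) by rewrite -subr_sqr tE kE; ring.
    by rewrite normrM distrC ler_wpM2l// ger0_norm ?addr_ge0// lerDr.
  have tE : t = 0 by apply: ler0_sqrtr; rewrite subr_le0 ltW.
  rewrite tE subr0 ger0_norm// -expr2 ler0_norm; rewrite kE; have := sqr_ge0 ki; lra.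
have -> : 1 - kn2 k / n%:R ^+ 2 = (n%:R ^+ 2 - kn2 k) / n%:R ^+ 2.
  by field; rewrite gt_eqF.
rewrite normrM [X in _ * X / 16]ger0_norm ?invr_ge0 ?exprn_ge0//.
rewrite -[leLHS]mulrA -invfM ler_pdivrMr ?mulr_gt0//.
have step : `|ki - t| * n%:R <= 4 * d%:R * `|n%:R ^+ 2 - kn2 k|.
  apply: (@le_trans _ _ (`|ki - t| * (4 * d%:R * ki))); first by rewrite ler_wpM2l.
  by rewrite mulrCA ler_wpM2l// mulr_ge0// ltW.
rewrite [leRHS](_ : _ = 4 * d%:R * `|n%:R ^+ 2 - kn2 k| / n%:R); last first.
  by field; rewrite gt_eqF.
by rewrite ler_pdivlMr.
Qed.

End lattice_sums.

Section sphere_sum.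
Context (R : realType) (d : nat).
Hypothesis d_gt0 : (0 < d)%N.
Local Notation K := 'rV[int]_d.

Lemma spread_abs_le (al x t : R) : 0 <= al ->
  spread al (`|x| - t) <= spread al (x - t) + spread al (x - - t).
Proof.
move=> al0; have [x0|x0] := leP 0 x.
  by rewrite ger0_norm// lerDl; exact: powR_ge0.
rewrite ltr0_norm// (_ : spread al (- x - t) = spread al (x - - t)); last first.
  by rewrite /spread -normrN; congr (Num.max `|_| _ `^ _); ring.
by rewrite lerDr; exact: powR_ge0.
Qed.

Definition rest_root (n : nat) (i : 'I_d) (k : K) : R :=
  Num.sqrt (n%:R ^+ 2 - \sum_(j | j != i) (k 0 j)%:~R ^+ 2).

(** The index i of [sphere_dist] depends on k; the sum over all i removes the
    dependence. *)
Lemma sphere_weight (al : R) (n : nat) (k : K) : 0 <= al -> (0 < n)%N ->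
  Num.max (`|1 - kn2 R k / n%:R ^+ 2| / 16) (1 / n%:R) `^ (- al) <=
  (15 / 256) `^ (- al) + \sum_i (64 * d%:R) `^ al * n%:R `^ al *
    (spread al ((k 0 i)%:~R - rest_root n i k) + spread al ((k 0 i)%:~R - - rest_root n i k)).
Proof.
move=> al0 n0; have N0 : 0 < n%:R :> R by rewrite ltr0n.
have D0 : 0 < 64 * d%:R :> R by rewrite mulr_gt0// ltr0n.
have D1 : 1 <= 64 * d%:R :> R by have : 1 <= d%:R :> R; [rewrite ler1n|lra].
have tge0 i : 0 <= (64 * d%:R) `^ al * n%:R `^ al *
    (spread al ((k 0 i)%:~R - rest_root n i k) + spread al ((k 0 i)%:~R - - rest_root n i k)) :> R.
  by rewrite !mulr_ge0 ?addr_ge0 ?powR_ge0.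
have [h|h] := ltP (kn2 R k / n%:R ^+ 2) (1 / 16).
  apply: ler_wpDr; first exact: sumr_ge0.
  apply: powR_decr => //.
  have v0 : 0 <= kn2 R k / n%:R ^+ 2 by rewrite divr_ge0 ?kn2_ge0 ?exprn_ge0// ltW.
  move: h v0; set v := kn2 R k / n%:R ^+ 2 => h v0.
  have -> : `|1 - v| = 1 - v by rewrite ger0_norm//; lra.
  by rewrite le_max; apply/orP; left; lra.
have [i hi] := sphere_dist d_gt0 n0 h.
apply: ler_wpDl; first exact: powR_ge0.
rewrite (bigD1 i)//=; apply: ler_wpDr; first by apply: sumr_ge0.
set t := rest_root n i k in hi *.
set x : R := (k 0 i)%:~R in hi *.
apply: (@le_trans _ _ (n%:R `^ al * ((64 * d%:R) `^ al * spread al (`|x| - t)))); last first.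
  rewrite mulrCA -mulrA ler_wpM2l ?powR_ge0// ler_wpM2l ?powR_ge0//.
  exact: spread_abs_le.
have E : (64 * d%:R) `^ al * spread al (`|x| - t) =
    (Num.max `| `|x| - t | 1 / (64 * d%:R)) `^ (- al).
  have m0 : 0 < Num.max `| `|x| - t | 1 by rewrite lt_max ltr01 orbT.
  rewrite [RHS]powRM ?invr_ge0 ?(ltW m0) ?(ltW D0)// [RHS]mulrC; congr (_ * _).
  by rewrite -powR_inv1 ?(ltW D0)// -powRrM mulrNN mul1r.
rewrite E; set X := _ / (64 * d%:R).
have X0 : 0 < X by rewrite divr_gt0// lt_max ltr01 orbT.
have -> : n%:R `^ al * X `^ (- al) = (X / n%:R) `^ (- al).
  rewrite [RHS]powRM ?invr_ge0 ?(ltW X0) ?(ltW N0)// [RHS]mulrC; congr (_ * _).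
  by rewrite -powR_inv1 ?(ltW N0)// -powRrM mulrNN mul1r.
apply: powR_decr => //; first by rewrite divr_gt0.
rewrite ler_pdivrMr// /X ler_pdivrMr// ge_max; apply/andP; split.
  rewrite -ler_pdivrMr// -ler_pdivrMr//; apply: (le_trans hi).
  by rewrite le_max lexx.
have h1 : 1 <= Num.max (`|1 - kn2 R k / n%:R ^+ 2| / 16) (1 / n%:R) * n%:R.
  by rewrite -ler_pdivrMr// le_max lexx orbT.
by apply: (le_trans h1); rewrite ler_peMr// (le_trans ler01 h1).
Qed.

(** On every line in direction i the weights of [sphere_weight] are shifted
    one-dimensional weights with exponent al < 1, to which [spread_sum]
    applies. *)
Lemma lattice_bound_sph (al : R) : 0 <= al -> al < 1 ->
  lattice_bound d (fun v : R => `|1 - v| / 16) al.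
Proof.
move=> al0 al1.
pose c : R := 2 / ((1 - al) * 2 `^ (- al)).
have c0 : 0 <= c by rewrite divr_ge0// mulr_ge0 ?powR_ge0// subr_ge0 ltW.
have c20 : 0 <= 2 * c by rewrite mulr_ge0.
pose c1 : R := (15 / 256) `^ (- al).
pose B : R := c1 + d%:R * ((64 * d%:R) `^ al * (2 * c)).
have B0 : 0 <= B.
  have h1 : 0 <= c1 by exact: powR_ge0.
  have h2 : 0 <= (64 * d%:R) `^ al :> R by exact: powR_ge0.
  by rewrite /B addr_ge0// mulr_ge0// mulr_ge0// mulr_ge0.
exists (B * 7 `^ d%:R); first by rewrite mulr_ge0 ?powR_ge0.
move=> n n0; have N0 : 0 < n%:R :> R by rewrite ltr0n.
apply: (le_trans _ (side_pow d_gt0 n0 B0)).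
set M := (3 * n)%N; set Q := (2 * M).+1.
have Q0 : 0 < Q%:R :> R by rewrite ltr0n.
apply: (le_trans (ler_sum _ (fun k _ => sphere_weight k al0 n0))).
rewrite big_split /= exchange_big /=.
pose G i (k : K) : R := spread al ((k 0 i)%:~R - rest_root n i k) +
  spread al ((k 0 i)%:~R - - rest_root n i k).
have SG i : \sum_(k <- box d M) G i k <= 2 * c * Q%:R `^ (d%:R - al).
  rewrite sum_box -(ler_pM2l Q0) -(sum_upd i).
  apply: (@le_trans _ _ (\sum_(f : {ffun 'I_d -> 'I_Q}) 2 * c * Q%:R `^ (1 - al))).
    apply: ler_sum => f _.
    set tau := rest_root n i (\row_j ((f j)%:Z - M%:Z)).
    have GE r : G i (\row_j ((upd i f r j)%:Z - M%:Z)) =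
        spread al ((r%:Z - M%:Z)%:~R - tau) + spread al ((r%:Z - M%:Z)%:~R - - tau).
      have -> : tau = rest_root n i (\row_j ((upd i f r j)%:Z - M%:Z)).
        rewrite /tau /rest_root; congr (Num.sqrt (_ - _)); apply: eq_bigr => j ji.
        by rewrite !mxE ffunE (negbTE ji).
      by rewrite /G !mxE ffunE eqxx.
    rewrite (eq_bigr _ (fun r _ => GE r)) big_split /=.
    rewrite -mulrA mulr_natl mulr2n lerD//; exact: sum_int_spread.
  rewrite sumr_const card_ffun !card_ord -[leLHS]mulr_natl natrX -powR_mulrn ?ler0n//.
  rewrite mulrCA [leRHS]mulrCA (ler_wpM2l c20)//.
  rewrite -[X in _ <= X * _]powRr1 ?ler0n// -!powR_split//.
  by rewrite (_ : d%:R + (1 - al) = 1 + (d%:R - al))//; ring.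
have -> : \sum_(k <- box d M) (15 / 256) `^ (- al) = c1 * Q%:R `^ d%:R.
  rewrite big_const_seq count_predT size_box iter_addr addr0 -[LHS]mulr_natr natrX.
  by rewrite powR_mulrn.
rewrite /B [leRHS]mulrDl lerD2l.
have QE : Q%:R `^ d%:R = Q%:R `^ al * Q%:R `^ (d%:R - al) :> R.
  by rewrite -powR_split//; congr (_ `^ _); ring.
apply: (@le_trans _ _ (\sum_(i < d) ((64 * d%:R) `^ al * (2 * c)) * Q%:R `^ d%:R)); last first.
  by rewrite sumr_const card_ord -[leLHS]mulr_natl [leLHS]mulrA.
apply: ler_sum => i _; rewrite -mulr_sumr.
apply: (le_trans (ler_wpM2l _ (SG i))); first by rewrite mulr_ge0 ?powR_ge0.
rewrite QE [leRHS](_ : _ = (64 * d%:R) `^ al * Q%:R `^ al * (2 * c * Q%:R `^ (d%:R - al))); last by ring.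
rewrite (ler_wpM2r (mulr_ge0 c20 (powR_ge0 Q%:R (d%:R - al))))// ler_wpM2l ?powR_ge0//.
apply: ge0_ler_powR => //.
- by rewrite nnegrE.
- by rewrite nnegrE ltW.
- by rewrite ler_nat /Q /M; lia.
Qed.

End sphere_sum.

(** * Kernels of multipliers *)

Section good_multipliers.
Context (R : realType) (d : nat).
Hypothesis d_gt0 : (0 < d)%N.
Local Notation C := R[i].
Local Notation normc := (@ComplexField.Normc.normc R).
Local Notation K := 'rV[int]_d.
Local Notation leb d := (lebesgue_space R d).
Local Notation P := (R * R)%type.

Definition mult (n : nat) (Phi : R -> R) (k : K) : C :=
  ((Phi (kn2 R k / n%:R ^+ 2))%:C)%C.

(** The integral of the p-th power of a kernel of height n^d concentrated on a
    ball of radius 1/n. *)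
Definition good (p : R) (Phi : R -> R) := exists2 C1 : R, 0 < C1 &
  forall n : nat, (0 < n)%N ->
  (tint (fun x : leb d => (normc (tp (2 * n) (mult n Phi) x) `^ p)%:E) <=
    (C1 * n%:R `^ (d%:R * (p - 1)))%:E)%E.

Lemma inbox_mono (N M : nat) (k : K) : (N <= M)%N -> inbox N k -> inbox M k.
Proof.
by move=> NM /forallP h; apply/forallP => j; rewrite (le_trans (h j))// lez_nat.
Qed.

Lemma fdiffn_Dn (m : nat) (j : 'I_d) (h n : nat) (k : K) (F : R -> R) (a : K -> C) :
  (forall k' : K, (forall i, i != j -> k' 0 i = k 0 i) -> a k' = ((F ((k' 0 j)%:~R / n%:R))%:C)%C) ->
  fdiffn m j h a k = ((Dn m (h%:R / n%:R) F ((k 0 j)%:~R / n%:R))%:C)%C.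
Proof.
elim: m F a => [|m IH] F a ha /=; first exact: ha.
apply: IH => k' hk'; rewrite /fdiff !ha//; last first.
  by move=> i ij; rewrite !mxE (negbTE ij) addr0 hk'.
by rewrite !mxE eqxx rmorphD /= mulrDl rmorphB.
Qed.

(** The parameter of the line through k / n in direction j. *)
Definition slice (n : nat) (j : 'I_d) (k : K) : P :=
  (\sum_(i | i != j) (k 0 i)%:~R ^+ 2 / n%:R ^+ 2, 1).

Lemma slice_ok n j k : okpar (slice n j k).
Proof.
split; last by rewrite ler01 lexx.
by apply: sumr_ge0 => i _; rewrite divr_ge0 ?sqr_ge0.
Qed.

Lemma rad2_slice n j k : rad2 (slice n j k) ((k 0 j)%:~R / n%:R) = kn2 R k / n%:R ^+ 2.
Proof.
rewrite /rad2 /kn2 (bigD1 j)//= mulrDl addrC expr_div_n; congr (_ + _).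
by rewrite mulr_suml.
Qed.

Lemma fdiffn_mult m j h n Phi k : fdiffn m j h (mult n Phi) k =
  ((Dn m (h%:R / n%:R) (fun x => Phi (rad2 (slice n j k) x)) ((k 0 j)%:~R / n%:R))%:C)%C.
Proof.
apply: fdiffn_Dn => k' hk'; rewrite /mult -(rad2_slice n j); congr ((Phi (rad2 _ _))%:C)%C.
by congr pair; apply: eq_bigr => i ij; rewrite hk'.
Qed.

(** Solve the difference for its leading value. *)
Lemma Dn_head (m : nat) (e t B : R) (F : R -> R) : 0 <= B ->
  (forall i, (0 < i <= m)%N -> `|F (t + i%:R * e)| <= B) ->
  `|F t| <= `|Dn m e F t| + 4 ^+ m * B.
Proof.
elim: m F B => [|m IH] F B B0 hF /=; first by rewrite lerDl mul1r.
have h1 : `|F (t + e)| <= B by have := hF 1%N isT; rewrite mul1r.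
have h2 : forall i, (0 < i <= m)%N -> `|F (t + i%:R * e + e) - F (t + i%:R * e)| <= 2 * B.
  move=> i /andP[i0 im]; have h3 := hF i.+1; have h4 := hF i.
  rewrite (_ : t + i%:R * e + e = t + i.+1%:R * e); last by rewrite -[i.+1%:R]natr1; ring.
  apply: (le_trans (ler_normB _ _)); rewrite mulrDl mul1r lerD//.
    by apply: h3; rewrite ltnS.
  by apply: h4; rewrite i0 (leq_trans im).
have B2 : 0 <= 2 * B by rewrite mulr_ge0.
have := IH (fun x => F (x + e) - F x) (2 * B) B2 h2.
move=> H; have := ler_normB (F (t + e)) (F (t + e) - F t).
rewrite (_ : F (t + e) - (F (t + e) - F t) = F t); last by ring.
have p4 : 1 <= 4 ^+ m :> R by rewrite exprn_ege1//; lra.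
rewrite exprS; nra.
Qed.

Variables (m : nat) (s : R).
Hypothesis m0 : (0 < m)%N.
Hypothesis s0 : 0 <= s.

(** Phi vanishes for large arguments; by [Dn_head] a bound at distance at least
    2 - j / m from 0 gives one at distance at least 2 - (j + 1) / m, and after
    2 m steps everything is covered. *)
Lemma difb_bounded rho k Phi : k <= s -> @difb R m rho k s Phi ->
  (forall v : R, 2 <= v -> Phi v = 0) ->
  exists2 B : R, 0 <= B & forall v : R, 0 <= v -> `|Phi v| <= B.
Proof.
move=> ks [Cd Cd0 H] hz.
have M0 : 0 < m%:R :> R by rewrite ltr0n.
pose e : R := m%:R^-1.
have e0 : 0 < e by rewrite invr_gt0.
have e1 : e <= 1 by rewrite invf_le1// ler1n.
pose F (t : R) := Phi (rad2 (0, 1) t).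
pose D := Cd * (e `^ s * e `^ (k - s)).
have D0 : 0 <= D by rewrite !mulr_ge0 ?powR_ge0.
have hD t : 0 <= t -> t <= 2 -> `|Dn m e F t| <= D.
  move=> t0 t2; have ok : okpar ((0, 1) : P) by split => //=; rewrite ler01 lexx.
  have := H (0, 1) t e ok; rewrite /rad2 /= add0r => /(_ _ e0 _).
  move=> /(_ ltac:(nra) ltac:(by rewrite mulfV ?gt_eqF)).
  rewrite /F /rad2 /= => h; apply: (le_trans h).
  rewrite ler_wpM2l// ler_wpM2l ?powR_ge0//.
  have -> : k - s = - (s - k) by ring.
  by apply: powR_decr => //; [rewrite subr_ge0|rewrite le_max lexx orbT].
have main : forall j, exists2 B, 0 <= B & forall t, 0 <= t -> 2 - j%:R * e <= t -> `|F t| <= B.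
  elim=> [|j [B B0 IH]].
    exists 0 => // t t0; rewrite mul0r subr0 => t2.
    by rewrite /F /rad2 /= add0r hz ?normr0//; nra.
  exists (D + 4 ^+ m * B); first by rewrite addr_ge0// mulr_ge0// exprn_ge0.
  move=> t t0 tj; have [t2|t2] := leP t 2; last first.
    rewrite /F /rad2 /= add0r hz ?normr0; last by nra.
    by rewrite addr_ge0// mulr_ge0// exprn_ge0.
  apply: le_trans (lerD (hD t t0 t2) (lexx _)); apply: Dn_head => // i /andP[i0 im].
  have ie : e <= i%:R * e by rewrite ler_peMl ?(ltW e0)// ler1n.
  by apply: IH; move: tj; rewrite -[j.+1%:R]natr1 mulrDl mul1r; lra.
have [B B0 hB] := main (2 * m)%N; exists B => // v v0.
have := hB (Num.sqrt v) (sqrtr_ge0 v); rewrite /F /rad2 /= add0r sqr_sqrtr//; apply.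
by rewrite natrM /e mulfK ?gt_eqF// subrr sqrtr_ge0.
Qed.

(** Where [difb] does not apply, for r >= 3, all nodes lie outside the support
    r^2 < 2. *)
Lemma far_nodes (q : P) (t u : R) : okpar q -> 9 <= rad2 q t -> 0 <= u <= 1 -> 2 <= rad2 q (t + u).
Proof.
move=> [q0 _]; rewrite /rad2 => h /andP[u0 u1]; rewrite leNgt; apply/negP => h'.
have h1 : (t + u) ^+ 2 < 2 by lra.
have h2 : t + u <= 2 by nra.
have h3 : -2 <= t + u by nra.
have h4 : t <= 2 by lra.
have h5 : -3 <= t by lra.
nra.
Qed.

Lemma supp_mult n Phi : (0 < n)%N -> (forall v : R, 2 <= v -> Phi v = 0) -> supp (2 * n) (mult n Phi).
Proof.
move=> n0 hz k hk; apply/forallP => j; rewrite leNgt; apply/negP => hj.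
move/eqP: hk; apply; rewrite /mult hz//.
have N0 : 0 < n%:R :> R by rewrite ltr0n.
rewrite ler_pdivlMr ?exprn_gt0//.
have h : (2 * n)%:R ^+ 2 <= kn2 R k.
  apply: (@le_trans _ _ ((k 0 j)%:~R ^+ 2)); last first.
    by rewrite /kn2 (bigD1 j)//= lerDl; apply: sumr_ge0 => *; exact: sqr_ge0.
  rewrite -[leRHS]real_normK ?num_real// ler_sqr ?nnegrE//.
  by rewrite -intr_norm [leLHS]pmulrn ler_int ltW.
apply: le_trans h; rewrite natrM exprMn; nra.
Qed.

(** The bounds on differences are squared and summed with the lattice bound; as
    m h <= n, all differences stay in the cube of 3 n. *)
Lemma good_of_difb p k rhov rho Phi : 0 < p -> p < 2 ->
  d%:R * (1 / p - 1 / 2) < s -> k <= s ->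
  lattice_bound d rhov (2 * (s - k)) -> (forall (q : P) t, rho q t = rhov (rad2 q t)) ->
  @difb R m rho k s Phi -> (forall v : R, 2 <= v -> Phi v = 0) -> good p Phi.
Proof.
move=> p0 p2 hs ks [Cl Cl0 hl] rhoE hdif hz.
have [B B0 hB] := difb_bounded ks hdif hz.
have [Cd Cd0 H] := hdif.
pose C0 := Num.max (B ^+ 2 * 5 ^+ d) (Cd ^+ 2 * Cl).
have [C1 C10 HK] := @kernel_estimate R d p s C0 m p0 p2 m0 hs.
exists C1 => // n n0; have N0 : 0 < n%:R :> R by rewrite ltr0n.
have sa := supp_mult n0 hz.
apply: (HK n (2 * n)%N (mult n Phi)) => //.
  apply: (@le_trans _ _ (B ^+ 2 * 5 ^+ d * n%:R `^ d%:R)); last first.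
    by rewrite ler_wpM2r ?powR_ge0// le_max lexx.
  apply: (@le_trans _ _ (\sum_(k0 <- box d (2 * n)) B ^+ 2)).
    apply: ler_sum => l _; rewrite /mult normc_real ler_sqr ?nnegrE//.
    by apply: hB; rewrite divr_ge0 ?kn2_ge0 ?exprn_ge0// ltW.
  rewrite big_const_seq count_predT size_box iter_addr addr0 -[leLHS]mulr_natr -mulrA.
  rewrite ler_wpM2l ?sqr_ge0// powR_mulrn ?ler0n// -exprMn natrX lerXn2r ?nnegrE ?mulr_ge0//.
  by rewrite -natrM ler_nat; lia.
move=> h j h0 hm.
have H0 : 0 < h%:R :> R by rewrite ltr0n.
set e : R := h%:R / n%:R.
have e0 : 0 < e by rewrite divr_gt0.
have me : m%:R * e <= 1 by rewrite /e mulrA ler_pdivrMr// mul1r -natrM ler_nat mulnC.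
have ne : 1 / n%:R <= e by rewrite /e ler_pM2r ?invr_gt0// ler1n.
have sd : supp (2 * n + m * h) (fdiffn m j h (mult n Phi)) by exact: supp_fdiffn.
have hN : (2 * n + m * h <= 3 * n)%N by rewrite (mulSn 2) addnC leq_add2r mulnC.
rewrite (@sum_supp d _ (box d (2 * n + m * h)) (box d (3 * n))) ?uniq_box//; last first.
  move=> l; have [->|l0] := eqVneq (fdiffn m j h (mult n Phi) l) 0.
    by rewrite normc_real normr0 expr0n eqxx.
  by move=> _; rewrite !mem_box sd//; apply/esym/(inbox_mono hN)/sd.
apply: (@le_trans _ _ (\sum_(l <- box d (3 * n)) Cd ^+ 2 * e `^ (2 * s) *
   Num.max (rhov (kn2 R l / n%:R ^+ 2)) (1 / n%:R) `^ (- (2 * (s - k))))).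
  apply: ler_sum => l _; rewrite fdiffn_mult normc_real.
  set q := slice n j l; set t := (l 0 j)%:~R / n%:R.
  have okq := slice_ok n j l.
  have [v9|v9] := leP 9 (rad2 q t).
    rewrite (@Dn_ext _ m _ (fun=> 0)).
      have := @Dn_crude _ m (fun=> 0) 0 e t; rewrite normr0 lexx mulr0 => /(_ (fun _ _ => isT)).
      rewrite normr_le0 => /eqP ->.
      by rewrite normr0 expr0n /= !mulr_ge0 ?powR_ge0 ?sqr_ge0.
    move=> i im; apply: hz; apply: far_nodes => //.
    rewrite mulr_ge0 ?(ltW e0)//= (le_trans _ me)// ler_wpM2r ?(ltW e0)// ler_nat//.
  have hX := H q t e okq v9 e0 me.
  set X := Num.max (rhov _) _.
  have X0 : 0 < X by rewrite lt_max divr_gt0 ?orbT.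
  have hY : `|Dn m e (fun x => Phi (rad2 q x)) t| <= Cd * (e `^ s * X `^ (k - s)).
    apply: (le_trans hX); rewrite ler_wpM2l// ler_wpM2l ?powR_ge0//.
    rewrite -opprB; apply: powR_decr; rewrite ?subr_ge0//.
    rewrite rhoE rad2_slice ge_max !le_max lexx ne !orbT//.
  have sq2 (y b : R) : 0 < y -> y `^ (2 * b) = (y `^ b) ^+ 2.
    by move=> y0; rewrite -powR_mulrn ?powR_ge0// -powRrM mulrC.
  rewrite -mulrN opprB !sq2// -mulrA -!exprMn ler_sqr ?nnegrE ?mulr_ge0 ?powR_ge0//.
rewrite -mulr_sumr.
have ce : 0 <= Cd ^+ 2 * e `^ (2 * s) by rewrite mulr_ge0 ?powR_ge0 ?sqr_ge0.
apply: (le_trans (ler_wpM2l ce (hl n n0))).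
rewrite [leLHS](_ : _ = Cd ^+ 2 * Cl * (n%:R `^ d%:R * e `^ (2 * s))); last by ring.
by rewrite ler_wpM2r ?mulr_ge0 ?powR_ge0// le_max lexx orbT.
Qed.

End good_multipliers.

Section good_algebra.
Context (R : realType) (d : nat).
Local Notation C := R[i].
Local Notation normc := (@ComplexField.Normc.normc R).
Local Notation leb d := (lebesgue_space R d).

Lemma normc_triangle (x y : C) : normc (x + y) <= normc x + normc y.
Proof. exact: le_normcD. Qed.

Lemma measurable_normc_pow (p : R) (f : leb d -> C) : cmeas f ->
  measurable_fun [set: leb d] (fun x => (normc (f x) `^ p)%:E).
Proof.
move=> mf; apply/measurable_EFinP.
apply: (@measurableT_comp _ _ _ _ _ _ (@powR R ^~ p)); first exact: measurable_powR.
exact: measurable_normc.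
Qed.

Lemma goodD (p : R) (f g : R -> R) : 0 < p -> p <= 1 -> good d p f -> good d p g ->
  good d p (fun v => f v + g v).
Proof.
move=> p0 p1 [A A0 hA] [B B0 hB]; exists (A + B); first exact: addr_gt0.
move=> n n0; rewrite mulrDl EFinD; apply: (le_trans _ (leeD (hA n n0) (hB n n0))).
rewrite -tintD; first last.
- by move=> x; rewrite lee_fin powR_ge0.
- by move=> x; rewrite lee_fin powR_ge0.
- by apply: measurable_normc_pow; exact: cmeas_tp.
- by apply: measurable_normc_pow; exact: cmeas_tp.
apply: le_tint => x; first by rewrite lee_fin powR_ge0.
move=> _; rewrite -EFinD lee_fin.
apply: le_trans (powR_subadd p0 p1 (normc_ge0 _) (normc_ge0 _)).
apply: ge0_ler_powR; rewrite ?nnegrE ?addr_ge0 ?normc_ge0 ?(ltW p0)//.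
apply: le_trans (normc_triangle _ _).
rewrite le_eqVlt; apply/orP; left; apply/eqP; congr normc.
by rewrite /tp -big_split /=; apply: eq_bigr => k _; rewrite -mulrDl /mult rmorphD.
Qed.

Lemma goodN (p : R) (f : R -> R) : good d p f -> good d p (fun v => -1 * f v).
Proof.
move=> [A A0 hA]; exists A; first exact: A0.
move=> n n0; apply: le_trans (hA n n0).
apply: le_tint => x; first by rewrite lee_fin powR_ge0.
move=> _; rewrite lee_fin (_ : tp _ _ _ = - tp (2 * n) (mult n f) x); last first.
  by rewrite /tp -sumrN; apply: eq_bigr => k _; rewrite /mult mulN1r rmorphN mulNr.
by rewrite normcN.
Qed.

End good_algebra.

Section good_instances.
Context (R : realType) (d : nat).
Hypothesis d_gt0 : (0 < d)%N.
Local Notation P := (R * R)%type.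
Variables (m : nat) (g delta s : R).
Hypothesis m0 : (0 < m)%N.
Hypothesis g0 : 0 < g.
Hypothesis d0 : 0 < delta.
Hypothesis s0 : 0 <= s.
Hypothesis sm : s <= m%:R.

(** The distance is left open because two different ones are used: for an even
    integer beta the pieces at the origin are smooth. *)
Definition origin_regular := exists rho rhov k, [/\
  forall (q : P) t, rho q t = rhov (rad2 q t), k <= s,
  lattice_bound d rhov (2 * (s - k)) &
  [/\ @difb R m rho k s (O1 m g delta), @difb R m rho k s (O2 m g delta) &
      @difb R m rho k s (O3 m g delta)]].

Lemma org_le (q : P) t : pos_on (@rho_org R) q t -> rho_org q t <= 4.
Proof. by move=> [D _]; exact: rho_org_le. Qed.

Lemma difb_origin_pieces (rho : P -> R -> R) (k : R) :
  (forall q t, dom q t -> 0 <= rho q t) ->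
  (forall q t, pos_on rho q t -> rho q t <= 4) ->
  (forall q t t', dom q t -> dom q t' -> `|rho q t' - rho q t| <= `|t' - t|) ->
  0 <= k ->
  (forall q t, dom q t -> rho q t = 0 -> rad2 q t = 0) ->
  (forall q t, pos_on rho q t -> 1 / 16 < rad2 q t -> 1 / 4 <= rho q t) ->
  (forall q q' t, q.1 = q'.1 -> rho q t = rho q' t) ->
  sym (pos_on rho) rho m 0 (@rad2 R) ->
  sym (pos_on rho) rho m k (fun q t => ppow g (rad2 q t)) ->
  [/\ difb m rho (Num.min k s) s (O1 m g delta), difb m rho (Num.min k s) s (O2 m g delta) &
      difb m rho (Num.min k s) s (O3 m g delta)].
Proof.
move=> r0 rm rl k0 rz gap rq sv su.
have Q := difb_quot m0 r0 rm rl k0 s0 sm rz gap sv.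
have [H2 H1] := Q delta _ _ (@ub_itv R m g g0) (theta_lt1 g0) (ub0 m g) (sym_ub rm sv su) rq.
have [H3 _] := Q (1 / delta) _ _ (@wb_itv R m g delta g0 d0) (wb_bound_lt1 delta g0)
  (wb0 m g delta) (sym_wb delta g0 rm k0 sv su) rq.
by split.
Qed.

Lemma origin_regular_org : s < g + g + d%:R / 2 -> origin_regular.
Proof.
move=> hs; pose k := Num.min (g + g) s.
have ks : k <= s by rewrite /k ge_min lexx orbT.
exists (@rho_org R), (@Num.sqrt R), k; split => //.
  have al0 : 0 <= 2 * (s - k) by rewrite mulr_ge0// subr_ge0.
  apply: lattice_bound_org => //.
  have D0 : 0 < d%:R :> R by rewrite ltr0n.
  by rewrite /k minEle; case: ifP => _; lra.
have gg0 : 0 <= g + g by rewrite addr_ge0// ltW.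
have rz (q : P) t : dom q t -> rho_org q t = 0 -> rad2 q t = 0.
  by move=> [okq _] h; rewrite -rho_org_sqr// h expr0n.
have gap (q : P) t : pos_on (@rho_org R) q t -> 1 / 16 < rad2 q t -> 1 / 4 <= rho_org q t.
  move=> [[okq _] r0]; rewrite -rho_org_sqr// => h.
  by rewrite leNgt; apply/negP => h'; nra.
have sv : sym (pos_on (@rho_org R)) (@rho_org R) m 0 (@rad2 R).
  by apply: (@sym_transfer R (@rho_org R) 4 org_le m 0 0) => //; exact: sym_rad2_one.
have su := @sym_ppow_org R m g.
have r0 (q : P) t : dom q t -> 0 <= rho_org q t by move=> _; exact: sqrtr_ge0.
have rq (q q' : P) t : q.1 = q'.1 -> rho_org q t = rho_org q' t.
  by rewrite /rho_org /rad2 => ->.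
exact: (difb_origin_pieces r0 org_le (@rho_org_lip R) gg0 rz gap rq sv su).
Qed.

Lemma origin_regular_even (M : nat) : (0 < M)%N -> g = M%:R -> origin_regular.
Proof.
move=> M0 gM; pose k := Num.min 0 s.
have ks : k <= s by rewrite /k ge_min lexx orbT.
exists (@rho_one R), (fun=> 1), k; split => //; first exact: lattice_bound_one.
apply: difb_origin_pieces => //.
- by move=> q t _; rewrite /rho_one; lra.
- by move=> q t t' _ _; rewrite subrr normr0.
- by move=> q t _ /eqP; rewrite oner_eq0.
- by move=> q t _ _; rewrite /rho_one; lra.
- exact: sym_rad2_one.
apply: (@sym_ext _ _ _ _ _ _ (fun q t => rad2 q t ^+ M)).
  move=> q t [[okq _] _] x; have := rad2_ge0 x okq; rewrite le_eqVlt => /orP[/eqP <-|v0].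
    by rewrite ppow_le0// expr0n eqn0Ngt M0.
  by rewrite ppowE// gM powR_mulrn// ltW.
by apply: (@symX _ _ _ _ _ (@rho_one_pos R) (@rho_one_le R)) => //; exact: sym_rad2_one.
Qed.

Lemma good_pieces (p : R) : 0 < p -> p <= 1 -> d%:R * (1 / p - 1 / 2) < s ->
  s < delta + 1 / 2 -> origin_regular ->
  [/\ good d p (Phi1 m g delta), good d p (Phi2 m g delta) & good d p (Phi3 m g delta)].
Proof.
move=> p0 p1 hs sd [rho [rhov [k [rhoE ks lb [H1 H2 H3]]]]].
have p2 : p < 2 by lra.
pose kd := Num.min delta s.
have kds : kd <= s by rewrite /kd ge_min lexx orbT.
have lbS : lattice_bound d (fun v : R => `|1 - v| / 16) (2 * (s - kd)).
  apply: lattice_bound_sph => //; first by rewrite mulr_ge0// subr_ge0.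
  by rewrite /kd minEle; case: ifP => _; lra.
have lbM : lattice_bound d (fun _ : R => 1) (2 * (s - Num.min 0 s)) by exact: lattice_bound_one.
have mks : Num.min 0 s <= s by rewrite ge_min lexx orbT.
have G (rho' : P -> R -> R) rhov' k' Phi := @good_of_difb R d d_gt0 m s m0 s0 p k' rhov' rho' Phi p0 p2 hs.
have chi3z v : 2 <= v -> chi3 m v = 0 :> R by move=> h; exact: cut0.
have chi0z v : 2 <= v -> chi0 m v = 0 :> R by move=> h; apply: chi0_hi; lra.
have wsz v : 2 <= v -> ws m g delta v = 0.
  by move=> h; rewrite /ws ppow_le0//; apply: xs_le0 => //; lra.
have S1z v : 2 <= v -> S1 m g delta v = 0 by move=> h; rewrite /S1 wsz ?mulr0.
have gO Phi : difb m rho k s Phi -> (forall v, 2 <= v -> Phi v = 0) -> good d p Phi.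
  by move=> h z; apply: (G rho rhov k).
have gS Phi : difb m (@rho_sph R) kd s Phi -> (forall v, 2 <= v -> Phi v = 0) -> good d p Phi.
  by move=> h z; apply: (G (@rho_sph R) _ kd _ kds lbS).
have gM a : good d p (fun v => (chi3 m v - chi0 m v) * ppow a (vt m v)).
  apply: (G (@rho_one R) _ _ _ mks lbM) => //; first exact: difb_smooth.
  by move=> v h; rewrite chi3z// chi0z// subrr mul0r.
split.
- apply: goodD => //; [apply: gO => // v h|apply: gS; [exact: difb_S1|exact: S1z]].
  by rewrite /O1 chi0z// mul0r.
- apply: goodD => //.
    apply: goodD => //; last exact: gM.
    by apply: gO => // v h; rewrite /O2 chi0z// mul0r.
  apply: goodN; apply: gS; first exact: difb_S2.
  by move=> v h; rewrite /S2 S1z// mul0r.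
- apply: goodD => //.
    apply: goodD => //; last exact: gM.
    by apply: gO => // v h; rewrite /O3 chi0z// mul0r.
  apply: gS; first exact: difb_S3.
  by move=> v h; rewrite /S3 S1z// mul0r.
Qed.

End good_instances.

(** One s and one m serve all pieces: s lies between d (1/p - 1/2) and the
    bounds delta + 1/2 and, unless beta is an even integer, beta + d/2. *)
Lemma good_multipliers (R : realType) (d : nat) (p beta delta : R) :
  (0 < d)%N -> 0 < p -> p < 1 -> Sigma_set d (1 / p, delta) -> B_set d (1 / p, beta) ->
  [/\ 0 < beta, 0 < delta & exists m, [/\
    good d p (Phi1 m (beta / 2) delta), good d p (Phi2 m (beta / 2) delta) &
    good d p (Phi3 m (beta / 2) delta)]].
Proof.
move=> d_gt0 p0 p1 [_ _ /= hS] [_ _ /= hB].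
have D1 : 1 <= d%:R :> R by rewrite ler1n.
have q1 : 1 < 1 / p by rewrite ltr_pdivlMr// mul1r.
move: hS; rewrite gt_max => /andP[hS1 hS2].
have d0 : 0 < delta by lra.
have b0 : 0 < beta.
  case: hB => [[M [M0 ->]]|]; first by rewrite ltr0n muln_gt0.
  by apply: le_lt_trans; rewrite mulr_ge0// le_max lexx orbT.
have g0 : 0 < beta / 2 by rewrite divr_gt0.
have sig0 : 0 <= d%:R * (1 / p - 1 / 2) by rewrite mulr_ge0//; lra.
split => //.
(* upper end of the admissible range of s *)
pose s1 := if `[< exists m : nat, (0 < m)%N /\ beta = (2 * m)%:R >] then delta + 1 / 2
  else Num.min (delta + 1 / 2) (beta + d%:R / 2).
have s1h : d%:R * (1 / p - 1 / 2) < s1.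
  rewrite /s1; case: asboolP => h; first by lra.
  case: hB => // hB; rewrite lt_min; apply/andP; split; first by lra.
  move: hB; rewrite (max_idPl _); last by lra.
  rewrite !mulrBr; lra.
pose s := (d%:R * (1 / p - 1 / 2) + s1) / 2.
have hs : d%:R * (1 / p - 1 / 2) < s by rewrite /s; lra.
have ss1 : s < s1 by rewrite /s; lra.
have s0 : 0 <= s by lra.
have sd : s < delta + 1 / 2.
  apply: (lt_le_trans ss1); rewrite /s1; case: ifP => // _.
  by rewrite ge_min lexx.
pose m := (Num.bound s).+1.
have sm : s <= m%:R.
  apply: (le_trans (ltW (archi_boundP s0))); by rewrite ler_nat.
exists m; apply: (@good_pieces R d d_gt0 m _ delta s) => //; first exact: ltW.
move: ss1; rewrite /s1; case: asboolP => [[M [M0 bM]] _|_ ss1].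
  have gE : beta / 2 = M%:R by rewrite bM natrM; field.
  exact: (origin_regular_even d_gt0 _ g0 d0 s0 sm M0 gE).
apply: origin_regular_org => //; apply: (lt_le_trans ss1); rewrite ge_min; apply/orP; right; lra.
Qed.

(** * Sampling operators with a general kernel *)

Section grid_operators.
Context (R : realType) (d : nat).
Local Notation C := R[i].
Local Notation normc := (@ComplexField.Normc.normc R).
Local Notation K := 'rV[int]_d.
Local Notation leb d := (lebesgue_space R d).
Variable p : R.
Hypothesis p0 : 0 < p.
Hypothesis p1 : p <= 1.

(** The p-th power of the quasi-norm, which is subadditive. *)
Definition Np (g : leb d -> C) : \bar R := tint (fun x : leb d => (normc (g x) `^ p)%:E).

Lemma Np_ge0 g : (0 <= Np g)%E.
Proof. by apply: tint_ge0 => x; rewrite lee_fin powR_ge0. Qed.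

Lemma normcM (x y : C) : normc (x * y) = normc x * normc y.
Proof. exact: ComplexField.Normc.normcM. Qed.

Lemma normc0 : normc 0 = 0. Proof. exact: ComplexField.Normc.normc0. Qed.

Lemma normcN1 (x : C) : normc (- x) = normc x.
Proof. exact: normcN. Qed.

Lemma powR_normcD (x y : C) : normc (x + y) `^ p <= normc x `^ p + normc y `^ p.
Proof.
apply: le_trans (powR_subadd p0 p1 (normc_ge0 _) (normc_ge0 _)).
by apply: ge0_ler_powR; rewrite ?nnegrE ?addr_ge0 ?normc_ge0 ?(ltW p0) ?normc_triangle.
Qed.

Lemma powR_normcM (x y : C) : normc (x * y) `^ p = normc x `^ p * normc y `^ p.
Proof. by rewrite normcM powRM ?normc_ge0. Qed.

Lemma powR_normc_sum (I : Type) (r : seq I) (F : I -> C) :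
  normc (\sum_(i <- r) F i) `^ p <= \sum_(i <- r) normc (F i) `^ p.
Proof.
elim: r => [|i r IH]; first by rewrite !big_nil normc0 powR0// gt_eqF.
rewrite !big_cons; apply: (le_trans (powR_normcD _ _)); exact: lerD.
Qed.

Lemma NpD f g : cmeas f -> cmeas g -> (Np (fun x => (f x + g x)%R) <= Np f + Np g)%E.
Proof.
move=> mf mg; rewrite /Np -tintD.
- apply: le_tint => x; first by rewrite lee_fin powR_ge0.
  by move=> _; rewrite -EFinD lee_fin powR_normcD.
- exact: measurable_normc_pow.
- exact: measurable_normc_pow.
- by move=> x; rewrite lee_fin powR_ge0.
- by move=> x; rewrite lee_fin powR_ge0.
Qed.

Lemma NpZ c g : cmeas g -> Np (fun x => c * g x) = ((normc c `^ p)%:E * Np g)%E.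
Proof.
move=> mg; rewrite /Np -(tintZ (powR_ge0 _ _) (measurable_normc_pow p mg)).
  by congr tint; apply/funext => x; rewrite -EFinM powR_normcM.
by move=> x; rewrite lee_fin powR_ge0.
Qed.

Lemma Np_tp_fin N a : exists2 D, 0 <= D & (Np (tp N a) <= D%:E)%E.
Proof.
exists ((\sum_(k <- box d N) normc (a k) `^ p) * (2 * pi) ^+ d).
  rewrite mulr_ge0//; first by apply: sumr_ge0 => *; exact: powR_ge0.
  by rewrite exprn_ge0// ltW// two_pi_gt0.
rewrite EFinM -tint_cst ?lee_fin ?sumr_ge0// => [|k _]; last exact: powR_ge0.
apply: le_tint => x; first by rewrite lee_fin powR_ge0.
move=> _; rewrite lee_fin; apply: (le_trans (powR_normc_sum _ _)).
by apply: ler_sum => k _; rewrite powR_normcM normc_chi powR1 mulr1.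
Qed.

(** The function is translated back, so that only a translation by a point of
    the torus is used. *)
Lemma tint_vsub (a : d.-tuple R) (F : leb d -> \bar R) :
  torus R d a -> measurable_fun [set: leb d] (fun x => F (vsub x a)) -> (forall x, 0 <= F x)%E ->
  tperiodic F -> tint (fun x => F (vsub x a)) = tint F.
Proof.
move=> ta mF F0 pF; rewrite -(tint_vadd ta (F := fun x => F (vsub x a)))//.
  congr tint; apply/funext => x; congr F.
  by apply: eq_from_tnth => i; rewrite !tnth_mktuple addrK.
move=> x j; rewrite -[RHS](pF _ j); congr F.
by apply: eq_from_tnth => i; rewrite !tnth_mktuple addrAC.
Qed.

Lemma cmeasN f : @cmeas R d f -> cmeas (fun x => - f x).
Proof.
move=> mf; rewrite (_ : (fun x => _) = (fun x => (-1) * f x)).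
  by apply: cmeasM; [exact: cmeas_cst|exact: mf].
by apply/funext => x; rewrite mulN1r.
Qed.

Lemma cmeasB f g : @cmeas R d f -> cmeas g -> cmeas (fun x => f x - g x).
Proof. by move=> mf mg; apply: cmeasD; [exact: mf|exact: cmeasN]. Qed.

Lemma tpB n (a b : K -> C) (x : d.-tuple R) : tp n (fun k => a k - b k) x = tp n a x - tp n b x :> C.
Proof. by rewrite /tp -sumrB; apply: eq_bigr => k _; rewrite mulrBl. Qed.

Lemma cmeas_vsub a (f : leb d -> C) : cmeas f -> cmeas (fun x => f (vsub x a)).
Proof.
by move=> mf; under eq_fun do rewrite vsubE; exact: cmeas_vadd.
Qed.

Lemma tperiodic_vsub (T : Type) a (F : d.-tuple R -> T) : tperiodic F -> tperiodic (fun x => F (vsub x a)).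
Proof.
move=> pF x j; rewrite -[RHS](pF _ j); congr F.
by apply: eq_from_tnth => i; rewrite !tnth_mktuple addrAC.
Qed.

Lemma Np_vsub a (g : leb d -> C) : torus R d a -> cmeas g -> tperiodic g ->
  Np (fun x => g (vsub x a)) = Np g.
Proof.
move=> ta mg pg.
apply: (@tint_vsub a (fun x => (normc (g x) `^ p)%:E)); first exact: ta.
- by apply: measurable_normc_pow; exact: cmeas_vsub.
- by move=> x; rewrite lee_fin powR_ge0.
- by move=> x j; rewrite pg.
Qed.

Variable P : nat.
Local Notation G := {ffun 'I_d -> 'I_P}.

(** The sampling operator with kernel [tp N a] in place of the Bochner-Riesz
    kernel and with P points per axis. *)
Definition gridop (N : nat) (a : K -> C) (lam : d.-tuple R) (f : leb d -> C) (x : leb d) : C :=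
  (P ^ d)%:R^-1 * \sum_(g : G) f (vadd (tgrid R g) lam) * tp N a (vsub (vsub x (tgrid R g)) lam).

Lemma cmeas_gridop N a lam f : cmeas (gridop N a lam f).
Proof.
apply: cmeasM; first exact: cmeas_cst.
apply: cmeas_sum => g; apply: cmeasM; first exact: cmeas_cst.
by apply: (@cmeas_vsub (tgrid R g) (fun x => tp N a (vsub x lam))); apply: cmeas_vsub; exact: cmeas_tp.
Qed.

Lemma gridopB N a lam f h x :
  gridop N a lam (fun y => f y - h y) x = gridop N a lam f x - gridop N a lam h x.
Proof.
by rewrite /gridop -mulrBr -sumrB; congr (_ * _); apply: eq_bigr => g _; rewrite mulrBl.
Qed.

Lemma gridop_tp A B a c lam x : (A + B < P)%N -> supp A a -> supp B c ->
  gridop A a lam (tp B c) x = tp A (fun k => a k * c k) x.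
Proof.
move=> AB sa sc; rewrite /gridop quadrature// mulKf// pnatr_eq0 expn_eq0 negb_and.
by rewrite -lt0n (leq_ltn_trans _ AB).
Qed.

Definition gridcoef (lam : d.-tuple R) (f : leb d -> C) (k : K) : C :=
  (P ^ d)%:R^-1 * \sum_(g : G) f (vadd (tgrid R g) lam) * chi (- k) (vadd (tgrid R g) lam).

(** Sampling produces a polynomial whose coefficients are those of the kernel
    times discrete Fourier coefficients. *)
Lemma gridop_coef N a lam f x :
  gridop N a lam f x = tp N (fun k => a k * gridcoef lam f k) x.
Proof.
rewrite /gridop /tp /gridcoef.
under eq_bigr do rewrite big_distrr /=.
rewrite exchange_big big_distrr /=; apply: eq_bigr => k _.
rewrite !big_distrr /= big_distrl /=; apply: eq_bigr => g _.
by rewrite !chiBr chiDr; ring.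
Qed.

(** Subadditivity of the p-th power; all translates of the kernel have the same
    quasi-norm. *)
Lemma Np_gridop N a lam f D : torus R d lam -> (Np (tp N a) <= D%:E)%E ->
  (Np (gridop N a lam f) <= (((P ^ d)%:R `^ (- p)) * D *
      \sum_(g : G) normc (f (vadd (tgrid R g) lam)) `^ p)%:E)%E.
Proof.
move=> tl hD.
have m2 (g : G) : cmeas (fun x : leb d => tp N a (vsub (vsub x (tgrid R g)) lam)).
  by apply: (@cmeas_vsub (tgrid R g) (fun x => tp N a (vsub x lam))); apply: cmeas_vsub; exact: cmeas_tp.
have N1 (g : G) : Np (fun x : leb d => tp N a (vsub (vsub x (tgrid R g)) lam)) = Np (tp N a).
  rewrite (@Np_vsub (tgrid R g) (fun x => tp N a (vsub x lam))).
  - exact: (Np_vsub tl (@cmeas_tp R d N a) (@tp_tperiodic R d N a)).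
  - exact: tgrid_torus.
  - by apply: cmeas_vsub; exact: cmeas_tp.
  - by apply: tperiodic_vsub; exact: tp_tperiodic.
rewrite NpZ; last by apply: cmeas_sum => g; apply: cmeasM; [exact: cmeas_cst|exact: m2].
have -> : normc ((P ^ d)%:R^-1 : C) `^ p = (P ^ d)%:R `^ (- p).
  rewrite (_ : (P ^ d)%:R^-1 = (((P ^ d)%:R^-1 : R)%:C)%C); last by rewrite fmorphV rmorph_nat.
  by rewrite normc_real ger0_norm ?invr_ge0// -powR_inv1// -powRrM mulN1r.
rewrite -mulrA EFinM; apply: lee_wpmul2l; first by rewrite lee_fin powR_ge0.
pose H (g : G) (x : leb d) := ((normc (f (vadd (tgrid R g) lam)) `^ p)%:E *
  (normc (tp N a (vsub (vsub x (tgrid R g)) lam)) `^ p)%:E)%E.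
have mH (g : G) : measurable_fun [set: leb d]
    (fun x : leb d => (normc (tp N a (vsub (vsub x (tgrid R g)) lam)) `^ p)%:E).
  exact: measurable_normc_pow (m2 g).
apply: (@le_trans _ _ (tint (fun x => \sum_(g : G) H g x)%E)).
  apply: le_tint => x; first by rewrite lee_fin powR_ge0.
  move=> _; rewrite (eq_bigr (fun g : G => (normc (f (vadd (tgrid R g) lam)) `^ p *
     normc (tp N a (vsub (vsub x (tgrid R g)) lam)) `^ p)%:E)); last by [].
  rewrite sumEFin lee_fin; apply: (le_trans (powR_normc_sum _ _)).
  by apply: ler_sum => g _; rewrite powR_normcM.
rewrite tint_sum; last 2 first.
- by move=> g; apply: emeasurable_funM => //; exact: measurable_cst.
- by move=> g x; rewrite mule_ge0// lee_fin powR_ge0.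
rewrite mulr_sumr -sumEFin; apply: lee_sum => g _.
rewrite /H tintZ ?powR_ge0//; last by move=> x; rewrite lee_fin powR_ge0.
rewrite -/(Np _) N1 mulrC EFinM; apply: lee_wpmul2l => //; by rewrite lee_fin powR_ge0.
Qed.

(** Each point of the grid contributes the integral of a translate of |f|^p. *)
Lemma grid_average (f : leb d -> C) : cmeas f -> tperiodic f ->
  tint (fun lam : leb d => (\sum_(g : G) normc (f (vadd (tgrid R g) lam)) `^ p)%:E) =
  ((P ^ d)%:R%:E * Np f)%E.
Proof.
move=> mf pf.
have -> : (fun lam : leb d => (\sum_(g : G) normc (f (vadd (tgrid R g) lam)) `^ p)%:E) =
    (fun lam => \sum_(g : G) (normc (f (vadd lam (tgrid R g))) `^ p)%:E)%E.
  by apply/funext => lam; rewrite sumEFin; under eq_bigr do rewrite vaddC.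
rewrite tint_sum.
- have E1 (g : G) : tint (fun x : leb d => (normc (f (vadd x (tgrid R g))) `^ p)%:E) = Np f.
    apply: (@tint_vadd _ _ (tgrid R g) (fun x : leb d => (normc (f x) `^ p)%:E)).
    - exact: tgrid_torus.
    - exact: measurable_normc_pow.
    - by move=> x; rewrite lee_fin powR_ge0.
    - by move=> x j; rewrite pf.
  rewrite (eq_bigr (fun=> Np f)) => [|g _]; last exact: E1.
  by rewrite sume_const ?Np_ge0// card_ffun !card_ord.
- by move=> g; apply: measurable_normc_pow; exact: cmeas_vadd.
- by move=> g x; rewrite lee_fin powR_ge0.
Qed.

End grid_operators.

Section realization.
Context (R : realType) (d : nat).
Local Notation C := R[i].
Local Notation normc := (@ComplexField.Normc.normc R).
Local Notation K := 'rV[int]_d.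
Local Notation leb d := (lebesgue_space R d).
Variable p : R.
Hypothesis p0 : 0 < p.
Hypothesis p1 : p <= 1.
Local Notation Np := (@Np R d p).

Definition vol : R := (2 * pi) ^+ d.

Lemma vol_gt0 : 0 < vol. Proof. by rewrite exprn_gt0// two_pi_gt0. Qed.

(** The number of points enters with the power d (1 - p), and the kernel with
    n^(d (p - 1)); the two cancel. *)
Lemma grid_scale (C1 : R) (n Pn Q : nat) : 0 <= C1 -> (0 < n)%N -> (0 < Pn)%N -> (Pn <= Q * n)%N ->
  (Pn ^ d)%:R `^ (- p) * (C1 * n%:R `^ (d%:R * (p - 1))) * (Pn ^ d)%:R <= C1 * Q%:R ^+ d.
Proof.
move=> C0 n0 P0 PQ.
have N0 : 0 < n%:R :> R by rewrite ltr0n.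
have PP : 0 < Pn%:R :> R by rewrite ltr0n.
have Q0 : (0 < Q)%N by rewrite lt0n; apply/eqP => Q0; move: PQ; rewrite Q0 mul0n leqNgt P0.
have Q1 : 1 <= Q%:R :> R by rewrite ler1n.
have -> : (Pn ^ d)%:R = Pn%:R `^ d%:R :> R by rewrite natrX powR_mulrn ?ler0n.
have X0 : 0 < Pn%:R `^ d%:R :> R by exact: powR_gt0.
set X := Pn%:R `^ d%:R in X0 *.
have -> : X `^ (- p) * (C1 * n%:R `^ (d%:R * (p - 1))) * X =
   C1 * (X `^ (1 - p) * n%:R `^ (d%:R * (p - 1))).
  have -> : X `^ (1 - p) = X * X `^ (- p) by rewrite powR_split// powRr1// ltW.
  by ring.
rewrite ler_wpM2l//.
have -> : n%:R `^ (d%:R * (p - 1)) = (n%:R `^ d%:R) `^ (- (1 - p)).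
  by rewrite -powRrM opprB.
have Y0 : 0 < n%:R `^ d%:R :> R by exact: powR_gt0.
rewrite powRN ler_pdivrMr ?powR_gt0//.
have XY : X <= Q%:R ^+ d * n%:R `^ d%:R.
  rewrite /X !powR_mulrn ?ler0n// -exprMn -natrM lerXn2r ?nnegrE ?ler0n//.
  by rewrite ler_nat.
apply: (@le_trans _ _ ((Q%:R ^+ d * n%:R `^ d%:R) `^ (1 - p))).
  apply: ge0_ler_powR; rewrite ?nnegrE ?mulr_ge0 ?exprn_ge0 ?(ltW X0) ?(ltW Y0) ?subr_ge0//.
have QQ1 : 1 <= Q%:R ^+ d :> R by rewrite exprn_ege1.
rewrite powRM ?exprn_ge0 ?(ltW Y0)// ler_wpM2r ?powR_ge0//.
rewrite -[leRHS]powRr1 ?exprn_ge0//; apply: ler_powR => //; have := p0; lra.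
Qed.

(** The quasi-norm of the operator as a function of lam is only bounded, by a
    function W that is measurable by construction. *)
Lemma gridop_majorant (C1 : R) (n Pn Q N : nat) (a : K -> C) (f : leb d -> C) :
  0 <= C1 -> (0 < n)%N -> (0 < Pn)%N -> (Pn <= Q * n)%N ->
  (Np (tp N a) <= (C1 * n%:R `^ (d%:R * (p - 1)))%:E)%E ->
  cmeas f -> tperiodic f ->
  exists W : leb d -> R, [/\ measurable_fun [set: leb d] (fun x => (W x)%:E), forall x, 0 <= W x,
    forall lam, torus R d lam -> (Np (gridop Pn N a lam f) <= (W lam)%:E)%E &
    (tint (fun lam => (W lam)%:E) <= (C1 * Q%:R ^+ d)%:E * Np f)%E].
Proof.
move=> C0 n0 P0 PQ hK mf pf.
set D := C1 * n%:R `^ (d%:R * (p - 1)) in hK.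
have D0 : 0 <= D by rewrite mulr_ge0 ?powR_ge0.
pose kap := (Pn ^ d)%:R `^ (- p) * D.
have k0 : 0 <= kap by rewrite mulr_ge0 ?powR_ge0.
pose S (lam : leb d) := \sum_(g : {ffun 'I_d -> 'I_Pn}) normc (f (vadd (tgrid R g) lam)) `^ p.
have S0 lam : 0 <= S lam by apply: sumr_ge0 => *; exact: powR_ge0.
have mS : measurable_fun [set: leb d] (fun x => (S x)%:E).
  rewrite (_ : (fun x => _) = (fun lam => \sum_(g : {ffun 'I_d -> 'I_Pn}) (normc (f (vadd lam (tgrid R g))) `^ p)%:E)%E); last first.
    by apply/funext => lam; rewrite sumEFin /S; under eq_bigr do rewrite vaddC.
  apply: emeasurable_sum => g; apply: measurable_normc_pow; exact: cmeas_vadd.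
exists (fun lam => kap * S lam); split.
- apply/measurable_EFinP; apply: measurable_funM; first exact: measurable_cst.
  exact/measurable_EFinP.
- by move=> x; rewrite mulr_ge0.
- by move=> lam tl; exact: (Np_gridop p0 p1 Pn f tl hK).
under [X in tint X]eq_fun do rewrite EFinM.
rewrite tintZ//.
rewrite grid_average// muleA -EFinM; apply: lee_wpmul2r; first exact: Np_ge0.
by rewrite lee_fin; exact: grid_scale.
Qed.

Lemma Np_le_of_vol (X : \bar R) (Y : \bar R) (c : R) : (0 <= X)%E ->
  (X * vol%:E <= c%:E * Y)%E -> (X <= (c / vol)%:E * Y)%E.
Proof.
move=> X0 h; rewrite mulrC EFinM -muleA.
have -> : X = ((vol^-1)%:E * (X * vol%:E))%E.
  by rewrite muleCA -EFinM mulVf ?mule1// gt_eqF// vol_gt0.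
by apply: lee_wpmul2l => //; rewrite lee_fin invr_ge0 ltW// vol_gt0.
Qed.

(** For a grid of 3 n + 1 points per axis [gridop] is this multiplier for every
    lam, so the left side is a constant that the average of the majorant
    bounds. *)
Lemma multiplier_bound (Phi : R -> R) : good d p Phi -> (forall v : R, 2 <= v -> Phi v = 0) ->
  exists2 M : R, 0 < M & forall (n : nat) (c : K -> C), (0 < n)%N -> supp n c ->
  (Np (tp n (fun k => (mult n Phi k * c k)%R)) <= M%:E * Np (tp n c))%E.
Proof.
move=> [C1 C10 hG] hz; exists (C1 * 4 ^+ d / vol).
  by rewrite divr_gt0 ?vol_gt0// mulr_gt0// exprn_gt0.
move=> n c n0 sc.
have sa := supp_mult n0 hz.
have sac : supp n (fun k => mult n Phi k * c k).
  by move=> k; rewrite mulf_eq0 negb_or => /andP[_]; exact: sc.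
have sac2 : supp (2 * n) (fun k => mult n Phi k * c k).
  by move=> k; rewrite mulf_eq0 negb_or => /andP[+ _]; exact: sa.
have [|W [mW W0 hW iW]] := @gridop_majorant C1 n (3 * n).+1 4 (2 * n) (mult n Phi) (tp n c)
    (ltW C10) n0 isT _ (hG n n0) (@cmeas_tp R d n c) (@tp_tperiodic R d n c).
  by rewrite ltn_pmul2r.
apply: Np_le_of_vol; first exact: Np_ge0.
apply: le_trans iW; rewrite -tint_cst ?Np_ge0//; apply: le_tint => [x|x tx]; first exact: Np_ge0.
apply: le_trans (hW x tx); rewrite le_eqVlt; apply/orP; left; apply/eqP.
congr Np; apply/funext => y; rewrite gridop_tp//; last by rewrite -mulSnr ltnS.
exact: tp_supp.
Qed.
End realization.

(** * The two inequalities for trigonometric polynomials *)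

Section two_sided.
Context (R : realType) (d : nat).
Local Opaque tp gridop Np.
Local Notation C := R[i].
Local Notation normc := (@ComplexField.Normc.normc R).
Local Notation K := 'rV[int]_d.
Local Notation leb d := (lebesgue_space R d).
Variable p : R.
Hypothesis p0 : 0 < p.
Hypothesis p1 : p <= 1.
Local Notation Np := (@Np R d p).
Local Notation vol := (@vol R d).
Variables F1 F2 F3 w : R -> R.
Hypothesis G1 : good d p F1.
Hypothesis G2 : good d p F2.
Hypothesis G3 : good d p F3.
Hypothesis z1 : forall v : R, 1 <= v -> F1 v = 0.
Hypothesis z2 : forall v : R, 2 <= v -> F2 v = 0.
Hypothesis z3 : forall v : R, 2 <= v -> F3 v = 0.
Hypothesis e2 : forall v : R, 0 <= v <= 1 -> F2 v * w v = 1 - F1 v.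
Hypothesis e3 : forall v : R, 0 <= v <= 1 -> F3 v * (1 - F1 v) = w v.

(** The frequencies |k| <= n of the polynomials in the realization, as opposed
    to the cubes of [supp]. *)
Definition inball (n : nat) (c : K -> C) := forall k, c k != 0 -> kn2 R k <= n%:R ^+ 2.

Lemma inball_supp n c : inball n c -> supp n c.
Proof.
move=> h k /h hk; apply/forallP => j.
have : (k 0 j)%:~R ^+ 2 <= n%:R ^+ 2 :> R.
  apply: le_trans hk; rewrite /kn2 (bigD1 j)//= lerDl.
  by apply: sumr_ge0 => *; exact: sqr_ge0.
rewrite -[leLHS]real_normK ?num_real// ler_sqr ?nnegrE// -intr_norm [leRHS]pmulrn.
by rewrite ler_int.
Qed.

Lemma inball_mul n a c : inball n c -> inball n (fun k => a k * c k).
Proof. by move=> h k; rewrite mulf_eq0 negb_or => /andP[_]; exact: h. Qed.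

Lemma inball_kernel n : (0 < n)%N -> inball n (mult n F1).
Proof.
move=> n0 k; apply: contraNle => h; rewrite /mult z1// ler_pdivlMr ?mul1r ?ltW//.
by rewrite exprn_gt0// ltr0n.
Qed.

Lemma inball_mul1 n c : (0 < n)%N -> inball n (fun k => mult n F1 k * c k).
Proof.
by move=> n0 k; rewrite mulf_eq0 negb_or => /andP[+ _]; exact: inball_kernel.
Qed.

Lemma inball_itv n c k : (0 < n)%N -> inball n c -> c k != 0 -> 0 <= kn2 R k / n%:R ^+ 2 <= 1.
Proof.
move=> n0 h /h hk; have N0 : 0 < n%:R ^+ 2 :> R by rewrite exprn_gt0// ltr0n.
by rewrite divr_ge0 ?kn2_ge0 ?(ltW N0)//= ler_pdivrMr// mul1r.
Qed.

Lemma kernel_bound : exists2 C1 : R, 0 < C1 & forall n : nat, (0 < n)%N ->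
  (Np (tp n (mult n F1)) <= (C1 * n%:R `^ (d%:R * (p - 1)))%:E)%E.
Proof.
move: G1 => [C1 C10 h]; exists C1; first exact: C10.
move=> n n0; apply: le_trans (h n n0).
rewrite le_eqVlt; apply/orP; left; apply/eqP; congr Np; apply/funext => x.
apply: tp_supp; first by apply: inball_supp; exact: inball_kernel.
by apply: supp_mult => // v v2; apply: z1; lra.
Qed.

(** The coefficients of T - S_lam T. *)
Definition resid n (c : K -> C) := fun k => c k - mult n F1 k * c k.
(** The coefficients of n^(-beta) Delta^(beta/2) T when w (v) = v^(beta/2). *)
Definition smooth n (c : K -> C) := fun k => mult n w k * c k.

Lemma inball_resid n c : inball n c -> inball n (resid n c).
Proof.
by move=> h k hk; apply: h; apply: contra_neq hk; rewrite /resid => ->; rewrite mulr0 subr0.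
Qed.

Lemma resid_le : exists2 M : R, 0 < M & forall (n : nat) (c : K -> C), (0 < n)%N -> inball n c ->
  (Np (tp n (resid n c)) <= M%:E * Np (tp n (smooth n c)))%E.
Proof.
have [M M0 H] := multiplier_bound p0 p1 G2 z2; exists M; first exact: M0.
move=> n c n0 bc.
rewrite (_ : resid n c = fun k => mult n F2 k * smooth n c k).
  exact: H (inball_supp (inball_mul bc)).
apply/funext => k; rewrite /resid /smooth; have [->|ck] := eqVneq (c k) 0; first by rewrite !mulr0 subr0.
by rewrite mulrA /mult -rmorphM /= e2 ?(inball_itv n0 bc ck)// rmorphB mulrBl mul1r.
Qed.

Lemma smooth_le : exists2 M : R, 0 < M & forall (n : nat) (c : K -> C), (0 < n)%N -> inball n c ->
  (Np (tp n (smooth n c)) <= M%:E * Np (tp n (resid n c)))%E.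
Proof.
have [M M0 H] := multiplier_bound p0 p1 G3 z3; exists M; first exact: M0.
move=> n c n0 bc.
rewrite (_ : smooth n c = fun k => mult n F3 k * resid n c k).
  exact: H (inball_supp (inball_resid bc)).
apply/funext => k; rewrite /resid /smooth; have [->|ck] := eqVneq (c k) 0; first by rewrite !mulr0 subr0 mulr0.
rewrite -[X in X - _]mul1r -mulrBl mulrA /mult.
by rewrite (_ : 1 = (1%:C)%C)// -rmorphB -rmorphM /= e3 ?(inball_itv n0 bc ck).
Qed.

Definition sampling n (lam : d.-tuple R) (f : leb d -> C) := gridop (2 * n).+1 n (mult n F1) lam f.

Lemma sampling_tp n lam c x : (0 < n)%N -> inball n c ->
  sampling n lam (tp n c) x = tp n (fun k => mult n F1 k * c k) x.
Proof.
move=> n0 bc; apply: gridop_tp; rewrite ?addnn ?mul2n//.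
- exact: inball_supp (inball_kernel n0).
- exact: inball_supp.
Qed.

(** f - S_lam f = (f - T) - S_lam (f - T) + (T - S_lam T); the middle term is
    averaged over lam, the last one does not depend on lam. *)
Lemma upper_bound : exists2 A : R, 0 < A & forall (n : nat) (f : leb d -> C) (c : K -> C),
  (0 < n)%N -> cmeas f -> tperiodic f -> inball n c ->
  (tint (fun lam : leb d => Np (fun x => (f x - sampling n lam f x)%R)) <=
   A%:E * (Np (fun x => (f x - tp n c x)%R) + Np (tp n (smooth n c))))%E.
Proof.
have [C1 C10 hK] := kernel_bound.
have [M M0 hM] := resid_le.
have V0 := vol_gt0 R d.
exists (vol + C1 * 3 ^+ d + M * vol).
  by rewrite !addr_gt0 ?mulr_gt0// exprn_gt0.
move=> n f c n0 mf pf bc.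
pose g x := f x - tp n c x.
have mg : cmeas g by apply: cmeasB; [exact: mf|exact: cmeas_tp].
have pg : tperiodic g by move=> x j; rewrite /g pf tp_tperiodic.
have Pn : ((2 * n).+1 <= 3 * n)%N by rewrite ltn_pmul2r.
have [W [mW W0 hW iW]] := gridop_majorant p0 p1 (ltW C10) n0 (isT : (0 < (2 * n).+1)%N) Pn (hK n n0) mg pg.
have mS h lam : cmeas (sampling n lam h) by exact: cmeas_gridop.
set X := Np g in iW *; set Y := Np (tp n (smooth n c)).
have X0 : (0 <= X)%E by exact: Np_ge0.
have Y0 : (0 <= Y)%E by exact: Np_ge0.
have pt lam : torus R d lam ->
    (Np (fun x => (f x - sampling n lam f x)%R) <= (X + M%:E * Y) + (W lam)%:E)%E.
  move=> tl.
  rewrite (_ : (fun x => _) = (fun x => (g x + tp n (resid n c) x) + -1 * sampling n lam g x)); last first.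
    apply/funext => x; rewrite /g /sampling gridopB -!/(sampling _ _ _ _) sampling_tp// tpB; ring.
  apply: (@le_trans _ _ (Np (fun x => (g x + tp n (resid n c) x)%R) + Np (fun x => (-1 * sampling n lam g x)%R))%E).
    apply: (NpD p0 p1); first by apply: cmeasD; [exact: mg|exact: cmeas_tp].
    by apply: cmeasM; [exact: cmeas_cst|exact: mS].
  apply: leeD; last first.
    rewrite (NpZ p _ (mS g lam)) (_ : normc (-1) = 1); last by rewrite normcN1 ComplexField.Normc.normc1.
    by rewrite powR1 mul1e; exact: hW.
  apply: (le_trans (NpD p0 p1 mg (cmeas_tp _ _))).
  by apply: leeD; [exact: lexx|exact: hM].
apply: (@le_trans _ _ (tint (fun lam : leb d => (X + M%:E * Y) + (W lam)%:E)%E)).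
  by apply: le_tint; [move=> x; exact: Np_ge0|exact: pt].
have MY0 : (0 <= M%:E * Y)%E by apply: mule_ge0; [rewrite lee_fin ltW|exact: Y0].
have XY0 : (0 <= X + M%:E * Y)%E by exact: adde_ge0.
move: (X) (Y) X0 Y0 MY0 XY0 iW {pt} => {}X {}Y X0 Y0 MY0 XY0 iW.
rewrite tintD//.
rewrite tint_cst// -/vol.
rewrite muleC ge0_muleDr//.
rewrite muleA -EFinM ge0_muleDr//.
set a := C1 * 3 ^+ d; have a0 : 0 <= a by rewrite mulr_ge0 ?(ltW C10)// exprn_ge0.
have b0 : 0 <= vol * M by rewrite mulr_ge0// ltW.
rewrite addeAC; apply: leeD.
  apply: (@le_trans _ _ ((vol + a)%:E * X)%E).
    rewrite EFinD ge0_muleDl ?lee_fin ?(ltW V0)//. by apply: leeD.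
  by apply: lee_wpmul2r => //; rewrite lee_fin lerDl mulrC.
by apply: lee_wpmul2r => //; rewrite lee_fin mulrC lerDr addr_ge0// ltW.
Qed.

(** The polynomial is S_lam f for a lam at which the error is at most E' / vol,
    slightly more than its average.  For every mu,
      T - S_mu T = - g + S_mu g + (f - S_mu f)  with g = f - T,
    and the left side does not depend on mu. *)
Lemma lower_bound : exists2 A : R, 0 < A & forall (n : nat) (f : leb d -> C) (E E' : R),
  (0 < n)%N -> cmeas f -> tperiodic f -> 0 <= E -> E < E' ->
  (tint (fun lam : leb d => Np (fun x => (f x - sampling n lam f x)%R)) <= E%:E)%E ->
  exists lam, let c := fun k => mult n F1 k * gridcoef (2 * n).+1 lam f k in
  (Np (fun x => (f x - tp n c x)%R) <= (A * E')%:E)%E /\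
  (Np (tp n (smooth n c)) <= (A * E')%:E)%E.
Proof.
have [C1 C10 hK] := kernel_bound.
have [M M0 hM] := smooth_le.
have V0 := vol_gt0 R d.
set V := vol in V0 *.
pose B := (1 + (1 + C1 * 3 ^+ d / V)) / V.
have q0 : 0 < C1 * 3 ^+ d by rewrite mulr_gt0// exprn_gt0.
have B0 : 0 < B by rewrite divr_gt0// !addr_gt0// divr_gt0.
exists (1 / V + M * B).
  by apply: addr_gt0; [exact: divr_gt0|exact: mulr_gt0].
move=> n f E E' n0 mf pf E0 EE' hE.
have E'0 : 0 < E' by exact: le_lt_trans EE'.
have mS h lam : cmeas (sampling n lam h) by exact: cmeas_gridop.
(* otherwise the error would exceed E' / V everywhere *)
have [lam [tl hlam]] : exists lam, torus R d lam /\
    (Np (fun x => (f x - sampling n lam f x)%R) <= (E' / V)%:E)%E.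
  apply: contrapT => H; have : (E'%:E <= E%:E)%E; last by rewrite lee_fin leNgt EE'.
  apply: le_trans hE.
  rewrite (_ : E' = E' / V * V); last by rewrite divfK// gt_eqF.
  rewrite EFinM -tint_cst ?lee_fin ?divr_ge0 ?(ltW E'0) ?(ltW V0)//.
  apply: le_tint => x; first by rewrite lee_fin divr_ge0 ?(ltW E'0) ?(ltW V0).
  by move=> tx; rewrite leNgt; apply/negP => hx; apply: H; exists x; split => //; exact: ltW.
exists lam; set c := fun k => _.
have bc : inball n c by exact: inball_mul1.
have TE x : sampling n lam f x = tp n c x by exact: gridop_coef.
pose g x := f x - tp n c x.
have gE : g = (fun x => f x - sampling n lam f x) by apply/funext => x; rewrite /g TE.
have mg : cmeas g by apply: cmeasB; [exact: mf|exact: cmeas_tp].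
have pg : tperiodic g by move=> x j; rewrite /g pf tp_tperiodic.
have gle : (Np g <= (E' / V)%:E)%E by rewrite gE.
have gfin : (Np g) \is a fin_num by rewrite ge0_fin_numE ?Np_ge0// (le_lt_trans gle) ?ltry.
pose a := fine (Np g).
have aE : Np g = a%:E by rewrite fineK.
have a0 : 0 <= a by rewrite -lee_fin -aE Np_ge0.
have aV : a <= E' / V by rewrite -lee_fin -aE.
have Pn : ((2 * n).+1 <= 3 * n)%N by rewrite ltn_pmul2r.
have [W [mW W0 hW iW]] := gridop_majorant p0 p1 (ltW C10) n0 (isT : (0 < (2 * n).+1)%N) Pn (hK n n0) mg pg.
have [D0' D0'0 hD] := @Np_tp_fin R d p p0 p1 n (resid n c).
have rfin : (Np (tp n (resid n c))) \is a fin_num.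
  by rewrite ge0_fin_numE ?Np_ge0// (le_lt_trans hD) ?ltry.
pose r := fine (Np (tp n (resid n c))).
have rE : Np (tp n (resid n c)) = r%:E by rewrite fineK.
pose h mu := Np (fun x => (f x - sampling n mu f x)%R).
have pt mu : torus R d mu -> (r%:E <= (a + W mu)%:E + h mu)%E.
  move=> tm; rewrite -rE.
  rewrite (_ : tp n (resid n c) = (fun x => (-1 * g x + sampling n mu g x) + (f x - sampling n mu f x))); last first.
    apply/funext => x; rewrite /g /sampling gridopB -!/(sampling _ _ _ _) sampling_tp// tpB; ring.
  have m1 : cmeas (fun x => -1 * g x) by apply: cmeasM; [exact: cmeas_cst|exact: mg].
  have m2 : cmeas (fun x => f x - sampling n mu f x) by apply: cmeasB; [exact: mf|exact: mS].
  apply: (@le_trans _ _ (Np (fun x => (-1 * g x + sampling n mu g x)%R) + h mu)%E).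
    by apply: (NpD p0 p1); [apply: cmeasD; [exact: m1|exact: mS]|exact: m2].
  apply: leeD; last exact: lexx.
  apply: (le_trans (NpD p0 p1 m1 (mS g mu))); rewrite EFinD; apply: leeD.
    rewrite (NpZ p _ mg) (_ : normc (-1) = 1); last by rewrite normcN1 ComplexField.Normc.normc1.
    by rewrite powR1 mul1e aE.
  exact: hW.
have rB : r <= B * E'.
  (* u is a measurable minorant of the error at mu, an error which is not known to be measurable *)
  pose u mu := Num.max (r - (a + W mu)) 0.
  have u0 mu : 0 <= u mu by rewrite le_max lexx orbT.
  have mWr : measurable_fun [set: leb d] W by exact/measurable_EFinP.
  have mu_ : measurable_fun [set: leb d] (fun x => (u x)%:E).
    apply/measurable_EFinP; apply: measurable_maxr; last exact: measurable_cst.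
    apply: measurable_realfun.measurable_funB; first exact: measurable_cst.
    by apply: measurable_realfun.measurable_funD; first exact: measurable_cst.
  have uE : (tint (fun x : leb d => (u x)%:E) <= E%:E)%E.
    apply: le_trans hE; apply: le_tint => x; first by rewrite lee_fin.
    move=> tx; have := pt x tx; have := Np_ge0 p (fun y => f y - sampling n x f y).
    rewrite -/(h x); case: (h x) => [y| |] //; last by move=> _ _; exact: leey.
    by rewrite -EFinD !lee_fin => y0 hr; rewrite /u ge_max y0 andbT; lra.
  have sE : (tint (fun _ : leb d => r%:E) <= tint (fun x : leb d => (u x)%:E + (a%:E + (W x)%:E))%E)%E.
    apply: le_tint => x; first by rewrite -rE Np_ge0.
    move=> _; rewrite -!EFinD lee_fin.
    have : r - (a + W x) <= u x by rewrite le_max lexx.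
    lra.
  have maW : measurable_fun [set: leb d] (fun x => (a%:E + (W x)%:E)%E).
    by apply: emeasurable_funD => //; exact: measurable_cst.
  have aW0 x : (0 <= a%:E + (W x)%:E)%E by rewrite -EFinD lee_fin addr_ge0.
  have r0 : 0 <= r by rewrite -lee_fin -rE Np_ge0.
  have u0E x : (0 <= (u x)%:E)%E by rewrite lee_fin.
  have W0E x : (0 <= (W x)%:E)%E by rewrite lee_fin.
  have a0E (x : leb d) : (0 <= a%:E)%E by rewrite lee_fin.
  have ma : measurable_fun [set: leb d] (fun=> a%:E) by exact: measurable_cst.
  move: sE; rewrite (tintD mu_ maW u0E aW0) (tintD ma mW a0E W0E).
  rewrite (tint_cst d (r0 : (0 <= r%:E)%E)) (tint_cst d (a0 : (0 <= a%:E)%E)) => sE.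
  have : (r%:E * V%:E <= E%:E + (a%:E * V%:E + (C1 * 3 ^+ d)%:E * a%:E))%E.
    apply: (le_trans sE); apply: leeD; first exact: uE.
    by apply: leeD; [exact: lexx|rewrite -aE].
  rewrite -!EFinM -!EFinD lee_fin => rV.
  rewrite -(ler_pM2r V0); apply: (le_trans rV).
  have aV' : a * V <= E' by rewrite -ler_pdivlMr.
  have qa : C1 * 3 ^+ d * a <= C1 * 3 ^+ d * (E' / V) by rewrite ler_wpM2l// ltW.
  rewrite (_ : B * E' * V = E' + (E' + C1 * 3 ^+ d * (E' / V))); last first.
    by rewrite /B; field; rewrite gt_eqF.
  by apply: lerD; [exact: ltW|exact: lerD].
have MB0 : 0 <= M * B * E' by apply: mulr_ge0; [apply: mulr_ge0|]; exact: ltW.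
split.
  apply: (le_trans gle); rewrite lee_fin mulrDl div1r mulrC lerDl//.
apply: (le_trans (hM n c n0 bc)); rewrite rE -EFinM lee_fin.
apply: (@le_trans _ _ (M * (B * E'))); first by rewrite ler_wpM2l// ltW.
by rewrite mulrDl mulrA lerDr mulr_ge0 ?(ltW E'0)// divr_ge0// ltW.
Qed.
End two_sided.

(** * The classical operators, norms and polynomials *)

Section classical_objects.
Context (R : realType) (d : nat).
Local Notation C := R[i].
Local Notation normc := (@ComplexField.Normc.normc R).
Local Notation K := 'rV[int]_d.
Local Notation leb d := (lebesgue_space R d).

Lemma freq_norm_ratio (beta : R) (n : nat) (k : K) : 0 < beta -> (0 < n)%N ->
  freq_norm R k `^ beta / n%:R `^ beta = ppow (beta / 2) (kn2 R k / n%:R ^+ 2).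
Proof.
move=> b0 n0; have N0 : 0 < n%:R :> R by rewrite ltr0n.
rewrite /freq_norm -/(kn2 R k).
have := kn2_ge0 R k; rewrite le_eqVlt => /orP[/eqP <-|v0].
  by rewrite sqrtr0 powR0 ?gt_eqF// !mul0r ppow_le0.
rewrite ppowE; last by rewrite divr_gt0// exprn_gt0.
have s0 : 0 < Num.sqrt (kn2 R k) by rewrite sqrtr_gt0.
have -> : kn2 R k / n%:R ^+ 2 = (Num.sqrt (kn2 R k) / n%:R) `^ 2%:R.
  by rewrite powR_mulrn ?divr_ge0 ?(ltW s0) ?(ltW N0)// expr_div_n sqr_sqrtr ?ltW.
rewrite -powRrM (mulrC 2%:R) divfK// powRM ?invr_ge0 ?(ltW s0) ?(ltW N0)//.
by rewrite -[in RHS]powR_inv1 ?(ltW N0)// -powRrM mulN1r powRN.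
Qed.

Lemma kn2N (k : K) : kn2 R (- k) = kn2 R k.
Proof. by apply: eq_bigr => j _; rewrite mxE rmorphN sqrrN. Qed.

Lemma freq_norm_le (n : nat) (k : K) : (freq_norm R k <= n%:R) = (kn2 R k <= n%:R ^+ 2).
Proof.
rewrite /freq_norm -/(kn2 R k) -[RHS]ler_sqrt ?exprn_ge0//.
by rewrite sqrtr_sqr ger0_norm.
Qed.

(** Exponent delta > 0 turns the maximum with 0 into a truncated power, and
    beta > 0 gives |0|^beta = 0. *)
Lemma bochner_riesz_coef (m : nat) (beta delta : R) (n : nat) (k : K) :
  0 < beta -> 0 < delta -> (0 < n)%N ->
  ((Num.max (1 - freq_norm R k `^ beta / n%:R `^ beta) 0 `^ delta)%:C)%C =
  mult n (Phi1 m (beta / 2) delta) k.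
Proof.
move=> b0 d0 n0; rewrite freq_norm_ratio// /mult; congr (_%:C)%C.
rewrite Phi1E; have [h|h] := ltP 0 (1 - ppow (beta / 2) (kn2 R k / n%:R ^+ 2)).
  by rewrite [RHS]ppowE//.
by rewrite [RHS]ppow_le0// powR0// gt_eqF.
Qed.

Lemma bochner_riesz_tp (m : nat) (beta delta : R) (n : nat) (x : d.-tuple R) :
  0 < beta -> 0 < delta -> (0 < n)%N ->
  bochner_riesz beta delta n x = tp n (mult n (Phi1 m (beta / 2) delta)) x.
Proof.
move=> b0 d0 n0; rewrite /bochner_riesz.
have z1 (v : R) : 1 <= v -> Phi1 m (beta / 2) delta v = 0.
  by move=> h; apply: Phi1_ge1 => //; rewrite divr_gt0.
rewrite (@fsbig_box R d n).
  rewrite /tp big_mkcond /=; apply: eq_bigr => k _.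
  by rewrite in_setT (bochner_riesz_coef m).
move=> k _; rewrite (bochner_riesz_coef m)// mulf_eq0 negb_or => /andP[hk _].
exact: (inball_supp (inball_kernel z1 n0)).
Qed.

Lemma grid_tgrid (n : nat) (g : {ffun 'I_d -> 'I_(2 * n).+1}) : grid R g = tgrid R g.
Proof. by apply: eq_from_tnth => j; rewrite !tnth_mktuple addn1. Qed.

Lemma sampling_opE (m : nat) (beta delta : R) (n : nat) (lam : d.-tuple R) (f : d.-tuple R -> R)
    (x : d.-tuple R) : 0 < beta -> 0 < delta -> (0 < n)%N ->
  sampling_op beta delta n lam f x =
  sampling (Phi1 m (beta / 2) delta) n lam (fun y => ((f y)%:C)%C) x.
Proof.
move=> b0 d0 n0; rewrite /sampling_op /sampling /gridop addn1 natrX; congr (_ * _).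
by apply: eq_bigr => g _; rewrite grid_tgrid (bochner_riesz_tp m).
Qed.

(** The realization sums over the ball, while [tp] sums over a cube. *)
Definition truncate (n : nat) (c : K -> C) (k : K) : C := if freq_norm R k <= n%:R then c k else 0.

Lemma inball_truncate n c : inball n (truncate n c).
Proof.
by move=> k; rewrite /truncate freq_norm_le; case: ifP => //; rewrite eqxx.
Qed.

Lemma truncate_id n c : inball n c -> truncate n c = c.
Proof.
move=> h; apply/funext => k; rewrite /truncate freq_norm_le; case: ifPn => //.
by move=> hk; apply/esym/eqP; apply: contraNT hk => /h.
Qed.

Lemma trig_poly_tp n c (x : d.-tuple R) : trig_poly n%:R c x = tp n (truncate n c) x.
Proof.
rewrite /trig_poly (@fsbig_box R d n).
  rewrite /tp big_mkcond /=; apply: eq_bigr => k _.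
  have -> : (k \in [set k : K | freq_norm R k <= n%:R]) = (freq_norm R k <= n%:R).
    by apply/idP/idP => [/set_mem//|h]; exact: mem_set.
  by rewrite /truncate; case: ifP => // _; rewrite mul0r.
move=> k /= hk; rewrite mulf_eq0 negb_or => /andP[ck _].
by apply: (inball_supp (@inball_truncate n c)); rewrite /truncate hk.
Qed.

Lemma trig_poly_laplace n beta c (x : d.-tuple R) : 0 < beta -> (0 < n)%N ->
  tp n (smooth (ppow (beta / 2)) n (truncate n c)) x =
  (((1 / n%:R) `^ beta)%:C)%C * trig_poly n%:R (laplace_pow beta c) x.
Proof.
move=> b0 n0; rewrite trig_poly_tp /tp mulr_sumr; apply: eq_bigr => k _.
rewrite mulrA; congr (_ * _); rewrite /smooth /truncate; case: ifP => _; last by rewrite !mulr0.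
rewrite /laplace_pow mulrA -rmorphM /mult -freq_norm_ratio//; congr ((_)%:C%C * _).
rewrite mulrC; congr (_ * _).
by rewrite div1r -[in RHS]powR_inv1 ?ler0n// -powRrM mulN1r powRN.
Qed.

Lemma hermitian_gridcoef F1 n P lam (f : d.-tuple R -> R) :
  hermitian_coef (fun k => mult n F1 k * gridcoef P lam (fun y => ((f y)%:C)%C) k).
Proof.
have conjM (x y : C) : ((x * y)^*)%C = (x^*)%C * (y^*)%C by exact: rmorphM.
have conjR (x : R) : ((x%:C)^*)%C = (x%:C)%C by rewrite /= oppr0.
have conj_sum (G : {ffun 'I_d -> 'I_P} -> C) : ((\sum_g G g)^*)%C = \sum_g ((G g)^*)%C.
  exact: rmorph_sum.
move=> k; rewrite conjM /mult conjR kn2N; congr (_ * _).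
rewrite /gridcoef conjM conj_sum; congr (_ * _).
  by rewrite (_ : (P ^ d)%:R^-1 = ((((P ^ d)%:R^-1 : R))%:C)%C) ?conjR// fmorphV rmorph_nat.
by apply: eq_bigr => g _; rewrite conjM conjR -chiNl.
Qed.

Lemma Lp_norm_Np (p : R) (g : leb d -> C) : 0 < p -> Lp_norm p g = (Np p g `^ p^-1)%E.
Proof.
move=> p0; rewrite /Lp_norm /eLp_norm; congr (_ `^ _)%E.
by apply: eq_integral => x _; rewrite gee0_abs ?lee_fin ?normc_ge0.
Qed.

Lemma poweR_root (p : R) (X : \bar R) : 0 < p -> (0 <= X)%E -> ((X `^ p^-1) `^ p = X)%E.
Proof. by move=> p0 X0; rewrite -poweRrM mulVf ?gt_eqF// poweRe1. Qed.

Lemma sampling_error_tint (m : nat) (p beta delta : R) (n : nat) (f : d.-tuple R -> R) :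
  0 < p -> 0 < beta -> 0 < delta -> (0 < n)%N ->
  sampling_error p beta delta n f =
  (tint (fun lam : leb d => Np p (fun x => (((f x)%:C)%C -
     sampling (Phi1 m (beta / 2) delta) n lam (fun y => ((f y)%:C)%C) x)%R)) `^ p^-1)%E.
Proof.
move=> p0 b0 d0 n0; rewrite /sampling_error /mixed_norm /eLp_norm; congr (_ `^ _)%E.
apply: eq_integral => lam _; rewrite (Lp_norm_Np _ p0) gee0_abs; last exact: poweR_ge0.
rewrite (poweR_root p0 (Np_ge0 _ _)).
congr (Np p _); apply/funext => x; congr (_ - _); exact: sampling_opE.
Qed.

End classical_objects.

(** * The equivalence *)

Section final_step.
Context (R : realType) (d : nat).
Local Notation C := R[i].
Local Notation K := 'rV[int]_d.
Local Notation leb d := (lebesgue_space R d).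

Lemma gt0_ler_poweR_ge0 (q : R) (X Y : \bar R) : 0 <= q -> (0 <= X)%E -> (X <= Y)%E ->
  (X `^ q <= Y `^ q)%E.
Proof.
move=> q0 X0 XY; apply: gt0_ler_poweR => //; rewrite in_itv /= leey andbT//.
exact: le_trans XY.
Qed.

(** X + Y is at most twice the larger one. *)
Lemma poweR_sum_le (q A : R) (X Y : \bar R) : 0 < q -> 0 <= A -> (0 <= X)%E -> (0 <= Y)%E ->
  ((A%:E * (X + Y)) `^ q <= ((2 * A) `^ q)%:E * (X `^ q + Y `^ q))%E.
Proof.
move=> q0 A0; wlog XY : X Y / (X <= Y)%E.
  move=> W X0 Y0; have [h|h] := leP X Y; first exact: W.
  by rewrite addeC [(X `^ q + _)%E]addeC; apply: W => //; exact: ltW.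
move=> X0 Y0.
have A20 : 0 <= 2 * A by rewrite mulr_ge0.
apply: (@le_trans _ _ (((2 * A)%:E * Y) `^ q)%E).
  apply: gt0_ler_poweR_ge0; first exact: ltW.
    by rewrite mule_ge0 ?lee_fin// adde_ge0.
  rewrite mulrC EFinM -muleA; apply: lee_wpmul2l; first by rewrite lee_fin.
  by rewrite mule_natl mule2n; exact: leeD.
rewrite poweRM ?lee_fin// poweR_EFin; apply: lee_wpmul2l; first by rewrite lee_fin powR_ge0.
by rewrite leeDr// poweR_ge0.
Qed.

Lemma laplace_term (p beta : R) (n : nat) (c : K -> C) : 0 < p -> 0 < beta -> (0 < n)%N ->
  (((1 / n%:R) `^ beta)%:E * Lp_norm p (trig_poly n%:R (laplace_pow beta c)) =
   Np p (tp n (smooth (ppow (beta / 2)) n (truncate n c))) `^ p^-1)%E.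
Proof.
move=> p0 b0 n0; rewrite Lp_norm_Np//.
have -> : tp n (smooth (ppow (beta / 2)) n (truncate n c)) =
    (fun x => (((1 / n%:R) `^ beta)%:C)%C * trig_poly n%:R (laplace_pow beta c) x).
  by apply/funext => x; exact: trig_poly_laplace.
rewrite NpZ; last first.
  rewrite (_ : trig_poly _ _ = tp n (truncate n (laplace_pow beta c))); first exact: cmeas_tp.
  by apply/funext => x; exact: trig_poly_tp.
rewrite normc_real ger0_norm ?powR_ge0// poweRM ?lee_fin ?powR_ge0 ?Np_ge0//.
by rewrite poweR_EFin -[((_ `^ p) `^ _)%R]powRrM mulfV ?gt_eqF// powRr1 ?powR_ge0.
Qed.

Local Opaque tp gridop Np.

Lemma periodic2pi_tperiodic (f : d.-tuple R -> R) : periodic2pi f ->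
  tperiodic (fun x : leb d => ((f x)%:C)%C).
Proof.
move=> pf x j; rewrite -[in RHS](pf x j); congr (f _)%:C%C.
by apply: eq_from_tnth => i; rewrite !tnth_mktuple.
Qed.

End final_step.

Theorem theorem2p4 (R : realType) (d : nat) (p beta delta : R)
  (d_gt0 : (0 < d)%N) (p_gt0 : 0 < p) (p_lt1 : p < 1)
  (Hdelta : Sigma_set d (1 / p, delta)) (Hbeta : B_set d (1 / p, beta)) :
  exists C1 C2 : R, [/\ 0 < C1, 0 < C2 &
    forall (f : d.-tuple R -> R) (n : nat), inLp p f -> (0 < n)%N ->
      (C1%:E * sampling_error p beta delta n f <= K_realization p beta f (1 / n%:R))%E /\
      (K_realization p beta f (1 / n%:R) <= C2%:E * sampling_error p beta delta n f)%E].
Proof.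
have p_le1 := ltW p_lt1.
have [b0 d0 [m [G1 G2 G3]]] := good_multipliers d_gt0 p_gt0 p_lt1 Hdelta Hbeta.
have g0 : 0 < beta / 2 by rewrite divr_gt0.
have z1 (v : R) : 1 <= v -> Phi1 m (beta / 2) delta v = 0 by exact: Phi1_ge1.
have z2 (v : R) : 2 <= v -> Phi2 m (beta / 2) delta v = 0 by exact: Phi2_ge2.
have z3 (v : R) : 2 <= v -> Phi3 m (beta / 2) delta v = 0 by exact: Phi3_ge2.
have e2 := @Phi2_mul R m (beta / 2) delta.
have e3 := @Phi3_mul R m (beta / 2) delta g0 d0.
have [A A0 hU] := upper_bound p_gt0 p_le1 G1 G2 z1 z2 e2.
have [B B0 hL] := lower_bound p_gt0 p_le1 G1 G3 z1 z3 e3.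
pose q := p^-1; have q0 : 0 < q by rewrite invr_gt0.
exists ((2 * A) `^ q)^-1, (2 * (2 * B) `^ q).
have A2 : 0 < (2 * A) `^ q by rewrite powR_gt0// mulr_gt0.
have A2n : (2 * A) `^ q != 0 by rewrite gt_eqF.
split; [by rewrite invr_gt0|by rewrite mulr_gt0// powR_gt0// mulr_gt0|].
move=> f n [mf pf _] n0.
pose F x : R[i] := ((f x)%:C)%C.
have mF : cmeas (F : lebesgue_space R d -> R[i]) by exact: cmeas_real.
have pF : tperiodic F by exact: periodic2pi_tperiodic.
have Kterm c : (Lp_norm p (fun x => F x - trig_poly (1 / n%:R)^-1 c x)%R +
    ((1 / n%:R) `^ beta)%:E * Lp_norm p (trig_poly (1 / n%:R)^-1 (laplace_pow beta c)) =
    Np p (fun x => F x - tp n (truncate n c) x)%R `^ q +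
    Np p (tp n (smooth (ppow (beta / 2)) n (truncate n c))) `^ q)%E.
  have tE : (1 / n%:R)^-1 = n%:R :> R by rewrite div1r invrK.
  have TE : (fun x => F x - trig_poly n%:R c x) = (fun x => F x - tp n (truncate n c) x).
    by apply/funext => x; rewrite trig_poly_tp.
  by rewrite tE (laplace_term c p_gt0 b0 n0) TE (Lp_norm_Np _ p_gt0).
rewrite (@sampling_error_tint R d m p beta delta n f p_gt0 b0 d0 n0).
set E := tint _.
have E0 : (0 <= E)%E by apply: tint_ge0 => x; exact: Np_ge0.
split.
  apply: le_ereal_inf_tmp => _ [c hc <-]; rewrite Kterm.
  have bc := @inball_truncate R d n c.
  have h := hU n F (truncate n c) n0 mF pF bc.
  set X := Np p _ in h *; set Y := Np p _ in h *.
  have X0 : (0 <= X)%E by exact: Np_ge0.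
  have Y0 : (0 <= Y)%E by exact: Np_ge0.
  have h' := gt0_ler_poweR_ge0 (ltW q0) E0 h.
  have h2 := le_trans h' (poweR_sum_le q0 (ltW A0) X0 Y0).
  rewrite [leRHS](_ : _ = (((2 * A) `^ q)^-1)%:E * (((2 * A) `^ q)%:E * (X `^ q + Y `^ q)))%E.
    by apply: lee_wpmul2l; [rewrite lee_fin invr_ge0 ltW|exact: h2].
  by rewrite muleA -EFinM mulVf// mul1e.
have main (r r' : R) : (E <= r%:E)%E -> 0 <= r -> r < r' ->
    (K_realization p beta f (1 / n%:R) <= (2 * (B * r') `^ q)%:E)%E.
  move=> Er r0 rr'; have [lam] := hL n F r r' n0 mF pF r0 rr' Er.
  set c := fun k => _; move=> /= [hX hY].
  have bc : inball n c by exact: inball_mul1.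
  apply: (@le_trans _ _ (Np p (fun x => F x - tp n (truncate n c) x)%R `^ q +
    Np p (tp n (smooth (ppow (beta / 2)) n (truncate n c))) `^ q)%E).
    rewrite -Kterm; apply: ereal_inf_lbound; exists c => //.
    exact: hermitian_gridcoef.
  rewrite truncate_id// mulrDl mul1r EFinD.
  by apply: leeD; rewrite -poweR_EFin; apply: gt0_ler_poweR_ge0; rewrite ?(ltW q0) ?Np_ge0.
(* the claim is trivial for an infinite error; a positive error r leaves room for r' = 2 r, and for r = 0 the value r' tends to 0 *)
move: E0; case: E main => [r| |] // main E0; last first.
  by rewrite poweRyr ?gt_eqF// gt0_muley ?leey// lte_fin mulr_gt0// powR_gt0// mulr_gt0.
rewrite lee_fin in E0; rewrite poweR_EFin -EFinM.
move: (E0); rewrite le_eqVlt => /orP[/eqP r0|r0]; last first.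
  have r2 : r < 2 * r by lra.
  apply: (le_trans (main r _ (lexx _) E0 r2)); rewrite lee_fin -mulrA ler_pM2l//.
  by rewrite (_ : B * (2 * r) = 2 * B * r) ?powRM ?mulr_ge0 ?(ltW B0)//; ring.
rewrite -r0 powR0 ?gt_eqF// mulr0; apply/lee_addgt0Pr => e e0; rewrite add0e.
(* chosen so that 2 (B r')^(1/p) = e *)
pose r' := (e / 2) `^ p / B.
have r'0 : 0 < r' by rewrite divr_gt0// powR_gt0// divr_gt0.
have := main 0 r' _ (lexx _) r'0; rewrite -r0 => /(_ (lexx _)).
rewrite /r' (mulrC B) divfK ?gt_eqF// -powRrM mulfV ?gt_eqF// powRr1 ?divr_ge0 ?(ltW e0)//.
by rewrite (mulrC 2) divfK.
Qed.
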